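(* (Eight loop.) Let $H=\frac12y^2-\frac12x^2+\frac14x^4$ and let $M_n(h)$ be the first nonzero coefficient in the expansion $d(h,\varepsilon)=\sum_{k\ge1}M_k(h)\varepsilon^k$ of the displacement function at $H=h$, $h\in(-\frac14,0)\cup(0,\infty)$, of the deformation $X_{\lambda(\varepsilon)}$. Put $$\begin{aligned}L_n(h)=&\Big[\big(\tfrac43\lambda_{6,n}+\tfrac{320}{231}\lambda_{5,n}\big)h+\big(\tfrac{32}{21}\lambda_{6,n}+\tfrac{40}{231}\lambda_{5,n}+\tfrac87\lambda_{4,n}+\tfrac37\lambda_{3,n}+\lambda_{2,n}\big)\Big]I_2(h)\\&+\Big[\tfrac{240}{77}\lambda_{5,n}h^2+\big(\tfrac{16}{21}\lambda_{6,n}+\tfrac{20}{231}\lambda_{5,n}+\tfrac47\lambda_{4,n}+\tfrac{12}{7}\lambda_{3,n}\big)h+\lambda_{1,n}\Big]I_0(h).\end{aligned}$$ Then for any $n\in\mathbb{N}$: if $n=3m$ with $m\in\mathbb{N}$, $$M_n(h)=L_n(h)-\tfrac{8}{1001}\lambda_{3,m}^3\Big[(308h^2+181h+24)I_2(h)+(80h^2+12h)I_0(h)\Big],$$ and if $n$ is not a multiple of $3$, $M_n(h)=L_n(h)$.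
   Context: The perturbed system is $$X_\lambda:\quad \dot x=H_y,\qquad \dot y=-H_x+(\lambda_1+\lambda_2x^2+\lambda_3y^2+\lambda_4x^4+\lambda_5y^4+\lambda_6x^6)\,y,$$ considered along an analytic arc $\varepsilon\mapsto\lambda(\varepsilon)$ with $\lambda_j(\varepsilon)=\sum_{k=1}^\infty\lambda_{j,k}\varepsilon^k$, $1\le j\le6$ (so $\lambda_{j,k}$ denotes the coefficient of $\varepsilon^k$ in $\lambda_j$, and $\lambda_{3,m}$ that of $\varepsilon^m$ in $\lambda_3$). The period annuli of $X_0$ are the two interior annuli (ovals around the centers $(\pm1,0)$, $-\frac14<h<0$) and the exterior annulus (ovals $\{H=h\}$, $h>0$); the statement concerns any fixed one of them, $h$ running in the corresponding interval. The displacement function is $d(h,\varepsilon)=P(h,\varepsilon)-h$, where $P(\cdot,\varepsilon)$ is the first return map of $X_{\lambda(\varepsilon)}$ on a cross-section to the periodic orbits of the annulus, parametrized by the value $h$ of $H$; it is analytic in $h,\varepsilon$. $I_0(h)=\int_{H=h}y\,dx$ and $I_2(h)=\int_{H=h}x^2y\,dx$ are integrals over the oval of the annulus, oriented by the flow of $X_0$. *)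

(* Defs.v *)
From Stdlib Require Import Reals.
From Coquelicot Require Import Coquelicot.
Open Scope R_scope.

Definition Ham (x y : R) : R := 1/2 * y^2 - 1/2 * x^2 + 1/4 * x^4.
Definition Ham_x (x y : R) : R := Derive (fun u => Ham u y) x.
Definition Ham_y (x y : R) : R := Derive (fun v => Ham x v) y.

(* Parameters are indexed from 1 to 6; other indices are never used. *)
Definition damping (l : nat -> R) (x y : R) : R :=
  l 1%nat + l 2%nat * x^2 + l 3%nat * y^2 + l 4%nat * x^4 + l 5%nat * y^4
  + l 6%nat * x^6.

(* Solutions of X_l, the field with parameter vector l (X_0 is Hamiltonian).
   The derivatives at 0 and T are two-sided, which is no restriction since
   solutions extend beyond [0, T]. *)
Definition solution (l : nat -> R) (x y : R -> R) (T : R) : Prop :=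
  forall t, 0 <= t <= T ->
    is_derive x t (Ham_y (x t) (y t)) /\
    is_derive y t (- Ham_x (x t) (y t) + damping l (x t) (y t) * y t).

Inductive annulus : Type := interior_left | interior_right | exterior.

Definition energy (A : annulus) (h : R) : Prop :=
  match A with
  | exterior => 0 < h
  | _ => - (1/4) < h < 0
  end.

(* Meaningful for h in energy A. For -1/4 < h < 0 the level set {H = h} does
   not meet the y-axis and has one component around each of (-1,0) and (1,0);
   for h > 0 it is connected. *)
Definition oval (A : annulus) (h : R) (x y : R) : Prop :=
  Ham x y = h /\
  match A with
  | interior_left => x < 0
  | interior_right => 0 < x
  | exterior => True
  end.

(* v is the integral of w(x,y) dx over the oval, run through exactly once (T is
   the minimal period) in the direction of the flow of X_0. *)
Definition is_oval_integral (A : annulus) (w : R -> R -> R) (h v : R) : Prop :=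
  exists (x y : R -> R) (T : R),
    0 < T /\ solution (fun _ => 0) x y T /\
    oval A h (x 0) (y 0) /\
    x T = x 0 /\ y T = y 0 /\
    (forall t, 0 < t < T -> ~ (x t = x 0 /\ y t = y 0)) /\
    is_RInt (fun t => w (x t) (y t) * Derive x t) 0 T v.

Definition analytic_at (f : R -> R) (x0 : R) : Prop :=
  exists (a : nat -> R) (r : R), 0 < r /\
    forall t, Rabs t < r -> is_pseries a t (f (x0 + t)).

(* An analytic curve h |-> (sx h, sy h) meeting each oval of the annulus once,
   parametrized by the value of H. Transversality to X_0 is automatic:
   differentiating H(sx h, sy h) = h gives dH(sx' h, sy' h) = 1, so the
   curve is nowhere tangent to a level set of H. *)
Definition cross_section (A : annulus) (sx sy : R -> R) : Prop :=
  forall h, energy A h ->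
    analytic_at sx h /\ analytic_at sy h /\ oval A h (sx h) (sy h).

(* The orbit of X_l starting at the point h of the section meets the section
   again, for the first positive time, at the point p. *)
Definition first_return (A : annulus) (sx sy : R -> R) (l : nat -> R)
    (h p : R) : Prop :=
  energy A p /\
  exists (x y : R -> R) (T : R),
    0 < T /\ solution l x y T /\
    x 0 = sx h /\ y 0 = sy h /\ x T = sx p /\ y T = sy p /\
    forall t q, 0 < t < T -> energy A q -> ~ (x t = sx q /\ y t = sy q).

(* lam j k is the coefficient of eps^k in the j-th parameter. *)
Definition analytic_arc (lam : nat -> nat -> R) : Prop :=
  forall j, (1 <= j <= 6)%nat ->
    lam j 0%nat = 0 /\ Rbar_lt 0 (CV_radius (lam j)).

Definition arc (lam : nat -> nat -> R) (eps : R) : nat -> R :=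
  fun j => PSeries (lam j) eps.

(* The range of eps on which P(h, eps) is defined may depend on h; the total
   function P is unconstrained elsewhere. *)
Definition return_map (A : annulus) (sx sy : R -> R) (lam : nat -> nat -> R)
    (P : R -> R -> R) : Prop :=
  forall h, energy A h -> exists r, 0 < r /\
    forall eps, Rabs eps < r -> first_return A sx sy (arc lam eps) h (P h eps).

Definition displacement (P : R -> R -> R) (h eps : R) : R := P h eps - h.

(* d(h, eps) = sum_(k >= 1) M_k(h) eps^k; M 0 is not used. *)
Definition displacement_expansion (A : annulus) (P : R -> R -> R)
    (M : nat -> R -> R) : Prop :=
  forall h, energy A h -> exists r, 0 < r /\
    forall eps, Rabs eps < r ->
      is_series (fun k => M (S k) h * eps ^ (S k)) (displacement P h eps).

(* "Nonzero" is meant for functions on the annulus: not identically zero. *)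
Definition first_nonzero (A : annulus) (M : nat -> R -> R) (n : nat) : Prop :=
  (1 <= n)%nat /\
  (forall k, (1 <= k < n)%nat -> forall h, energy A h -> M k h = 0) /\
  (exists h, energy A h /\ M n h <> 0).

Definition L (lam : nat -> nat -> R) (I0 I2 : R -> R) (n : nat) (h : R) : R :=
  let l j := lam j n in
  ((4/3 * l 6%nat + 320/231 * l 5%nat) * h
   + (32/21 * l 6%nat + 40/231 * l 5%nat + 8/7 * l 4%nat + 3/7 * l 3%nat
      + l 2%nat)) * I2 h
  + (240/77 * l 5%nat * h^2
     + (16/21 * l 6%nat + 20/231 * l 5%nat + 4/7 * l 4%nat + 12/7 * l 3%nat) * h
     + l 1%nat) * I0 h.

(* Main.v *)
Require Import Defs.
From Stdlib Require Import Reals Psatz Ranalysis5 ClassicalEpsilon.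
From Coquelicot Require Import Coquelicot.
Open Scope R_scope.

(** Write [v = 3 x^2 + y^2 - 3 x^4], [c = lambda_3(eps)] and split the damping
    factor as [c v + r], so that [r] has no [y^2] term.  The form [v y dx] is
    exact on the ovals: along [X_0] one has [d/dt (x y^3) = v y^2].  Hence the
    energy [H] can be corrected by [- c x y^3], which removes the term [c v y^2]
    from [dH/dt] at the price of a term of order [c^2].  That one is again the
    derivative along [X_0] of a polynomial, because [y^2] is a function of [x]
    on an oval and forms [p(x, y^2) dx] integrate to zero there; a second
    correction removes it.  The twice corrected energy satisfies exactly
      [d/dt = c^3 * cubic_integrand + r * (y^2 + O(c))]
    ([corrected_energy_derive]), and its increment over a first return is the
    displacement plus boundary terms that are [O(c)] times the displacement.

    Let [n] be such that [M_1, ..., M_(n-1)] vanish and suppose that the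
    parameters up to order [n - 1] are along [v] ([r = O(eps^n)]) and that
    [c^3 = O(eps^n)].  Dividing by [eps^n] and letting [eps -> 0] gives
    [M_n] as the integral over the oval of [r_n y^2 + kappa * cubic_integrand],
    where [kappa = lim c^3 / eps^n] is [lambda_{3,m}^3] if [n = 3 m] and [0]
    otherwise ([melnikov_formula]).  Both integrals are expressed through [I_0]
    and [I_2] by the recursion between the moments [mu_k] of [(x^2 - 1)^k]
    ([moment_recursion], [linear_melnikov], [cubic_melnikov]).

    The supposition is proved by induction on [n] ([normal_form_step]): if [M_n]
    vanishes identically, then [I_0] and [I_2] being independent over the
    polynomials of degree two, all coefficients in the formula vanish.  The one
    of [h^2 I_2] is a multiple of [kappa], so [lambda_{3,m} = 0] when [n = 3 m];
    the others say that the parameters of order [n] are along [v].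
    Independence ([moments_independent]) is elementary: near a center the
    moment recursion yields enough terms of the expansion of [I_2 / I_0] in
    powers of [1 + 4 h], and near infinity [I_2 / I_0] grows like [sqrt h].

    The limit [eps -> 0] requires that the first return orbit converge to the
    unperturbed closed orbit, run through once ([first_return_close]).  This
    follows from Gronwall's inequality and from the transversality of the
    section.  That two closed orbits on one oval have the same integrals
    ([oval_integral_on_orbit]) follows from uniqueness for [X_0], both passing
    through the rightmost point of the oval. *)

(** * The vector field *)

Lemma Ham_x_eq (x y : R) : Ham_x x y = - x + x ^ 3.
Proof.
  unfold Ham_x, Ham. apply is_derive_unique.
  auto_derive; [exact I | field].
Qed.

Lemma Ham_y_eq (x y : R) : Ham_y x y = y.
Proof.
  unfold Ham_y, Ham. apply is_derive_unique.
  auto_derive; [exact I | field].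
Qed.

Lemma solution_derive (l : nat -> R) (x y : R -> R) (T t : R) :
  solution l x y T -> 0 <= t <= T ->
  is_derive x t (y t) /\
  is_derive y t (x t - x t ^ 3 + damping l (x t) (y t) * y t).
Proof.
  intros Hs Ht. destruct (Hs t Ht) as [Hx Hy].
  rewrite Ham_y_eq in Hx. rewrite Ham_x_eq in Hy. split; [exact Hx |].
  replace (x t - x t ^ 3 + damping l (x t) (y t) * y t)
    with (- (- x t + x t ^ 3) + damping l (x t) (y t) * y t) by ring.
  exact Hy.
Qed.

(** [auto_derive] leaves the derivatives of abstract functions in eta-expanded
    form; this replaces one of them by its known value. *)
Ltac rewrite_derive H :=
  match type of H with is_derive ?f ?t ?l =>
    replace (Derive (fun z => f z) t) with l
      by (symmetry; apply is_derive_unique; exact H)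
  end.

Ltac derivability := repeat apply conj; try exact I; eexists; eassumption.

Lemma solution_shorten (l : nat -> R) (x y : R -> R) (T T' : R) :
  T' <= T -> solution l x y T -> solution l x y T'.
Proof. intros HT Hs t Ht. apply Hs. lra. Qed.

Lemma is_derive_continuity_pt (f : R -> R) (t l : R) :
  is_derive f t l -> continuity_pt f t.
Proof.
  intros Hf. apply continuity_pt_filterlim.
  apply (ex_derive_continuous f t). now exists l.
Qed.

Lemma mean_value (f df : R -> R) (a b : R) :
  a <= b -> (forall t, a <= t <= b -> is_derive f t (df t)) ->
  exists c, a <= c <= b /\ f b - f a = df c * (b - a).
Proof.
  intros Hab Hd.
  destruct (MVT_gen f a b df) as [c [Hc Hv]].
  - intros t Ht. rewrite Rmin_left, Rmax_right in Ht by lra. apply Hd; lra.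
  - intros t Ht. rewrite Rmin_left, Rmax_right in Ht by lra.
    eapply is_derive_continuity_pt. apply Hd; lra.
  - rewrite Rmin_left, Rmax_right in Hc by lra. now exists c.
Qed.

(** * Continuous dependence on the parameters *)

Lemma gronwall (u du : R -> R) (K d tau t : R) :
  0 <= K -> 0 <= d -> 0 <= t <= tau ->
  (forall s, 0 <= s <= tau -> is_derive u s (du s)) ->
  (forall s, 0 <= s <= t -> du s <= K * u s + d) ->
  u t <= (u 0 + d * t) * exp (K * t).
Proof.
  intros HK Hd Ht Hu Hdu.
  destruct (mean_value (fun s => u s * exp (- (K * s)) - d * s)
    (fun s => (du s - K * u s) * exp (- (K * s)) - d) 0 t) as [c [Hc Hv]].
  - lra.
  - intros s Hs. assert (Hus : is_derive u s (du s)) by (apply Hu; lra).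
    auto_derive.
    + derivability.
    + rewrite_derive Hus. ring.
  - assert (Hexp : 0 < exp (- (K * c)) <= 1).
    { split; [apply exp_pos |]. rewrite <- exp_0.
      destruct (Req_dec (K * c) 0) as [E | E].
      - rewrite E, Ropp_0. lra.
      - left. apply exp_increasing. assert (0 <= K * c) by nra. lra. }
    assert (Hle : (du c - K * u c) * exp (- (K * c)) - d <= 0).
    { assert (du c - K * u c <= d) by (specialize (Hdu c Hc); lra). nra. }
    rewrite Rmult_0_r, Ropp_0, exp_0 in Hv.
    assert (Hut : u t * exp (- (K * t)) <= u 0 + d * t) by nra.
    replace (u t) with (u t * exp (- (K * t)) * exp (K * t)).
    + apply Rmult_le_compat_r; [left; apply exp_pos | exact Hut].
    + rewrite Rmult_assoc, <- exp_plus.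
      replace (- (K * t) + K * t) with 0 by ring. rewrite exp_0. ring.
Qed.

(** Continuous induction: a bound that reproduces itself strictly on every
    initial segment where it holds can never be lost. *)
Lemma bootstrap_bound (u : R -> R) (tau : R) :
  u 0 < 1 ->
  (forall t, 0 <= t <= tau -> continuity_pt u t) ->
  (forall t, 0 <= t <= tau -> (forall s, 0 <= s <= t -> u s <= 1) -> u t < 1) ->
  forall t, 0 <= t <= tau -> u t < 1.
Proof.
  intros H0 Hc Hb t1 Ht1.
  set (E := fun s => 0 <= s <= t1 /\ forall r, 0 <= r <= s -> u r <= 1).
  assert (E0 : E 0).
  { split; [lra |]. intros r Hr. replace r with 0 by lra. lra. }
  destruct (completeness E) as [c [Hub Hlub]].
  - exists t1. intros s [Hs _]. lra.
  - now exists 0.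
  - assert (Hc0 : 0 <= c) by now apply Hub.
    assert (Hct : c <= t1) by (apply Hlub; intros s [Hs _]; lra).
    assert (Hbelow : forall r, 0 <= r < c -> u r <= 1).
    { intros r Hr. apply Rnot_lt_le. intros Hgt.
      assert (Hcr : c <= r); [| lra].
      apply Hlub. intros s [Hs Hsr]. apply Rnot_lt_le. intros Hlt.
      assert (u r <= 1) by (apply Hsr; lra). lra. }
    assert (Huc : u c <= 1).
    { apply Rnot_lt_le. intros Hgt.
      destruct (Rle_lt_or_eq_dec 0 c Hc0) as [Hpos | Heq].
      - destruct (Hc c ltac:(lra) (u c - 1)) as [a [Ha Hac]]; [lra |].
        set (r := Rmax 0 (c - a / 2)).
        assert (Hr : 0 <= r < c).
        { unfold r. split; [apply Rmax_l | apply Rmax_lub_lt; lra]. }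
        assert (Hrc : c - a / 2 <= r) by apply Rmax_r.
        assert (Hd : Rabs (u r - u c) < u c - 1).
        { apply (Hac r). split.
          - split; [exact I | lra].
          - simpl. unfold R_dist. apply Rabs_def1; lra. }
        apply Rabs_def2 in Hd. specialize (Hbelow r Hr). lra.
      - rewrite <- Heq in Hgt. lra. }
    assert (Huc' : u c < 1).
    { apply Hb; [lra |]. intros s Hs.
      destruct (Rle_lt_or_eq_dec s c) as [Hlt | Heq]; [lra | |].
      - apply Hbelow; lra.
      - now rewrite Heq. }
    destruct (Rle_lt_or_eq_dec c t1 Hct) as [Hlt | Heq].
    + destruct (Hc c ltac:(lra) (1 - u c)) as [a [Ha Hac]]; [lra |].
      set (b := Rmin t1 (c + a / 2)).
      assert (Hcb : c < b) by (unfold b; apply Rmin_glb_lt; lra).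
      assert (Hbt : b <= t1) by apply Rmin_l.
      assert (Hba : b <= c + a / 2) by apply Rmin_r.
      assert (E b).
      { split; [lra |]. intros r Hr.
        destruct (Rlt_le_dec r c) as [Hrc | Hrc]; [apply Hbelow; lra |].
        destruct (Req_dec r c) as [-> | Hne]; [lra |].
        assert (Hd : Rabs (u r - u c) < 1 - u c).
        { apply (Hac r). split.
          - split; [exact I | lra].
          - simpl. unfold R_dist. apply Rabs_def1; lra. }
        apply Rabs_def2 in Hd. lra. }
      assert (b <= c) by now apply Hub. lra.
    + now rewrite <- Heq.
Qed.

Lemma damping_bound (l : nat -> R) (x y W rho : R) :
  1 <= W -> Rabs x <= W -> Rabs y <= W ->
  (forall j, (1 <= j <= 6)%nat -> Rabs (l j) <= rho) ->
  Rabs (damping l x y) <= 6 * rho * W ^ 6.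
Proof.
  intros HW Hx Hy Hl.
  assert (Hrho : 0 <= rho).
  { apply Rle_trans with (Rabs (l 1%nat)); [apply Rabs_pos | apply Hl; lia]. }
  assert (Hmono : forall j z k, (1 <= j <= 6)%nat -> Rabs z <= W ->
     (k <= 6)%nat -> Rabs (l j * z ^ k) <= rho * W ^ 6).
  { intros j z k Hj Hz Hk. rewrite Rabs_mult, <- RPow_abs.
    apply Rmult_le_compat; try apply Rabs_pos; [apply pow_le, Rabs_pos | now apply Hl |].
    apply Rle_trans with (W ^ k).
    - apply pow_incr. split; [apply Rabs_pos | exact Hz].
    - apply Rle_pow; [exact HW | exact Hk]. }
  unfold damping.
  pose proof (Hmono 1%nat x 0%nat ltac:(lia) Hx ltac:(lia)) as H1.
  pose proof (Hmono 2%nat x 2%nat ltac:(lia) Hx ltac:(lia)) as H2.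
  pose proof (Hmono 3%nat y 2%nat ltac:(lia) Hy ltac:(lia)) as H3.
  pose proof (Hmono 4%nat x 4%nat ltac:(lia) Hx ltac:(lia)) as H4.
  pose proof (Hmono 5%nat y 4%nat ltac:(lia) Hy ltac:(lia)) as H5.
  pose proof (Hmono 6%nat x 6%nat ltac:(lia) Hx ltac:(lia)) as H6.
  rewrite pow_O, Rmult_1_r in H1.
  apply Rabs_le_between in H1, H2, H3, H4, H5, H6.
  apply Rabs_le. lra.
Qed.

Definition flow (x y : R -> R) (t : R) : Prop :=
  is_derive x t (y t) /\ is_derive y t (x t - x t ^ 3).

Lemma solution_flow (x y : R -> R) (T t : R) :
  solution (fun _ => 0) x y T -> 0 <= t <= T -> flow x y t.
Proof.
  intros Hs Ht. destruct (solution_derive _ _ _ _ _ Hs Ht) as [Hx Hy].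
  split; [exact Hx |]. unfold damping in Hy.
  match type of Hy with is_derive _ _ ?v =>
    replace (x t - x t ^ 3) with v by ring end.
  exact Hy.
Qed.

Lemma flow_solution (x y : R -> R) (T : R) :
  (forall t, 0 <= t <= T -> flow x y t) -> solution (fun _ => 0) x y T.
Proof.
  intros Hf t Ht. destruct (Hf t Ht) as [Hx Hy].
  rewrite Ham_y_eq, Ham_x_eq. split; [exact Hx |].
  unfold damping.
  match goal with |- is_derive _ _ ?v =>
    replace v with (x t - x t ^ 3) by ring end.
  exact Hy.
Qed.

(** Continuous dependence on the parameters.  The squared distance [u] of the
    two orbits satisfies [u' <= K u + C rho] as long as [u <= 1]; Gronwall then
    improves [u <= 1] to a strict inequality, so that the estimate persists. *)
Lemma orbit_comparison (B tau eta : R) :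
  0 <= B -> 0 <= tau -> 0 < eta ->
  exists rho, 0 < rho /\
  forall (l : nat -> R) (x y x0 y0 : R -> R) (T : R),
    T <= tau ->
    (forall j, (1 <= j <= 6)%nat -> Rabs (l j) <= rho) ->
    solution l x y T ->
    (forall t, 0 <= t <= T -> flow x0 y0 t) ->
    (forall t, 0 <= t <= T -> Rabs (x0 t) <= B /\ Rabs (y0 t) <= B) ->
    x 0 = x0 0 -> y 0 = y0 0 ->
    forall t, 0 <= t <= T -> Rabs (x t - x0 t) < eta /\ Rabs (y t - y0 t) < eta.
Proof.
  intros HB Htau Heta.
  set (W := B + 1). set (K := 2 + 3 * W ^ 2).
  set (Q := 12 * W ^ 7 * tau * exp (K * tau)).
  assert (HW : 1 <= W) by (unfold W; lra).
  assert (HK : 0 <= K) by (unfold K; nra).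
  assert (HW7 : 0 <= W ^ 7) by (apply pow_le; lra).
  assert (HQ : 0 <= Q).
  { unfold Q. pose proof (exp_pos (K * tau)).
    repeat apply Rmult_le_pos; lra. }
  set (m := Rmin 1 (eta ^ 2)).
  assert (Hm : 0 < m).
  { unfold m. apply Rmin_glb_lt; [lra | now apply pow_lt]. }
  set (rho := m / (Q + 1)).
  assert (Hrho : 0 < rho) by (unfold rho; apply Rdiv_lt_0_compat; lra).
  assert (HrQ : rho * Q < m).
  { assert (rho * (Q + 1) = m) by (unfold rho; field; lra). lra. }
  exists rho. split; [exact Hrho |].
  intros l x y x0 y0 T HT Hl Hs H0 HB0 Hx0 Hy0.
  set (u := fun t => (x t - x0 t) ^ 2 + (y t - y0 t) ^ 2).
  set (du := fun t => 2 * (x t - x0 t) * (y t - y0 t) + 2 * (y t - y0 t)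
    * ((x t - x t ^ 3 + damping l (x t) (y t) * y t) - (x0 t - x0 t ^ 3))).
  assert (Hu : forall t, 0 <= t <= T -> is_derive u t (du t)).
  { intros t Ht. destruct (solution_derive _ _ _ _ _ Hs Ht) as [Dx Dy].
    destruct (H0 t Ht) as [Dx0 Dy0]. unfold u.
    auto_derive.
    - derivability.
    - rewrite_derive Dx. rewrite_derive Dy. rewrite_derive Dx0. rewrite_derive Dy0.
      unfold du. ring. }
  assert (Hdu : forall t, 0 <= t <= T -> u t <= 1 ->
     du t <= K * u t + 12 * rho * W ^ 7).
  { intros t Ht Hut. destruct (HB0 t Ht) as [Bx By].
    unfold u in *. unfold du. clear u du Hu.
    set (a := x t - x0 t) in *. set (b := y t - y0 t) in *.
    assert (Ha : -1 <= a <= 1) by (split; nra).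
    assert (Hb : -1 <= b <= 1) by (split; nra).
    assert (Bx1 : Rabs (x t) <= W).
    { replace (x t) with (x0 t + a) by (unfold a; ring).
      apply Rabs_le_between in Bx. apply Rabs_le. unfold W. lra. }
    assert (By1 : Rabs (y t) <= W).
    { replace (y t) with (y0 t + b) by (unfold b; ring).
      apply Rabs_le_between in By. apply Rabs_le. unfold W. lra. }
    assert (Hf : Rabs (damping l (x t) (y t) * y t) <= 6 * rho * W ^ 7).
    { rewrite Rabs_mult.
      replace (6 * rho * W ^ 7) with (6 * rho * W ^ 6 * W) by ring.
      apply Rmult_le_compat; try apply Rabs_pos; [| exact By1].
      now apply damping_bound. }
    set (f := damping l (x t) (y t) * y t) in *.
    assert (Bx0 : Rabs (x0 t) <= W) by (unfold W; lra).
    apply Rabs_le_between in Bx1, Bx0, Hf.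
    set (q := x t ^ 2 + x t * x0 t + x0 t ^ 2).
    assert (Hq : 0 <= q <= 3 * W ^ 2).
    { unfold q. split; nra. }
    replace (2 * a * b + 2 * b * (x t - x t ^ 3 + f - (x0 t - x0 t ^ 3)))
      with (2 * (2 * a * b) - 2 * a * b * q + 2 * b * f)
      by (unfold a, b, q; ring).
    assert (H1 : 2 * (2 * a * b) <= 2 * (a ^ 2 + b ^ 2))
      by (pose proof (pow2_ge_0 (a - b)); nra).
    assert (H2 : - (2 * a * b * q) <= (a ^ 2 + b ^ 2) * (3 * W ^ 2)).
    { apply Rle_trans with ((a ^ 2 + b ^ 2) * q).
      - assert (0 <= q * (a + b) ^ 2)
          by (apply Rmult_le_pos; [lra | apply pow2_ge_0]). lra.
      - apply Rmult_le_compat_l; [| lra].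
        apply Rplus_le_le_0_compat; apply pow2_ge_0. }
    assert (H3 : 2 * b * f <= 12 * rho * W ^ 7).
    { assert (Rabs (b * f) <= 6 * rho * W ^ 7) as Hbf.
      { rewrite Rabs_mult. rewrite <- (Rmult_1_l (6 * rho * W ^ 7)).
        apply Rmult_le_compat; try apply Rabs_pos; apply Rabs_le; lra. }
      apply Rabs_le_between in Hbf. lra. }
    unfold K. lra. }
  assert (Hu0 : u 0 = 0) by (unfold u; rewrite Hx0, Hy0; ring).
  assert (Hsmall : forall t, 0 <= t <= T ->
     (forall s, 0 <= s <= t -> u s <= 1) -> u t < m).
  { intros t Ht Hle. apply Rle_lt_trans with (rho * Q); [| exact HrQ].
    eapply Rle_trans.
    - apply (gronwall u du K (12 * rho * W ^ 7) T t HK); try assumption.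
      + apply Rmult_le_pos; lra.
      + intros s Hs'. apply Hdu; [lra | now apply Hle].
    - rewrite Hu0. unfold Q.
      replace ((0 + 12 * rho * W ^ 7 * t) * exp (K * t))
        with (rho * (12 * W ^ 7) * (t * exp (K * t))) by ring.
      replace (rho * (12 * W ^ 7 * tau * exp (K * tau)))
        with (rho * (12 * W ^ 7) * (tau * exp (K * tau))) by ring.
      apply Rmult_le_compat_l; [apply Rmult_le_pos; lra |].
      apply Rmult_le_compat; [lra | left; apply exp_pos | lra |].
      destruct (Req_dec t tau) as [-> | Hne]; [lra |].
      destruct (Req_dec (K * t) (K * tau)) as [-> | Hne']; [lra |].
      left. apply exp_increasing. assert (K * t <= K * tau) by nra. lra. }
  assert (Hm1 : m <= 1) by apply Rmin_l.
  assert (Hu1 : forall t, 0 <= t <= T -> u t < 1).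
  { apply bootstrap_bound.
    - lra.
    - intros t Ht. eapply is_derive_continuity_pt. now apply Hu.
    - intros t Ht Hle. specialize (Hsmall t Ht Hle). lra. }
  intros t Ht.
  assert (Hut : u t < eta ^ 2).
  { apply Rlt_le_trans with m; [| apply Rmin_r].
    apply Hsmall; [exact Ht |]. intros s Hs'. left. apply Hu1. lra. }
  unfold u in Hut.
  pose proof (pow2_ge_0 (x t - x0 t)). pose proof (pow2_ge_0 (y t - y0 t)).
  split; apply Rabs_def1; nra.
Qed.

(** * Closed orbits and integrals over ovals *)

Lemma flow_shift (x y : R -> R) (c t : R) :
  flow x y (t + c) -> flow (fun s => x (s + c)) (fun s => y (s + c)) t.
Proof.
  intros [Dx Dy]. split; (auto_derive; [derivability |]).
  - rewrite_derive Dx. ring.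
  - rewrite_derive Dy. ring.
Qed.

(** [X_0] is reversible: [(x, y, t) -> (x, -y, -t)] preserves it. *)
Lemma flow_reverse (x y : R -> R) (c t : R) :
  flow x y (c - t) -> flow (fun s => x (c - s)) (fun s => - y (c - s)) t.
Proof.
  unfold Rminus. intros [Dx Dy]. split; (auto_derive; [derivability |]).
  - rewrite_derive Dx. ring.
  - rewrite_derive Dy. ring.
Qed.

Lemma flow_bounded (x y : R -> R) (T : R) :
  0 <= T -> (forall t, 0 <= t <= T -> flow x y t) ->
  exists B, 0 <= B /\
    forall t, 0 <= t <= T -> Rabs (x t) <= B /\ Rabs (y t) <= B.
Proof.
  intros HT Hf.
  assert (Hc : forall t, 0 <= t <= T ->
    continuity_pt (fun t => Rabs (x t) + Rabs (y t)) t).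
  { intros t Ht. destruct (Hf t Ht) as [Dx Dy].
    apply continuity_pt_plus; apply (continuity_pt_comp _ Rabs);
      try apply Rcontinuity_abs; eapply is_derive_continuity_pt; eassumption. }
  destruct (continuity_ab_maj _ 0 T HT Hc) as [m [Hm _]].
  exists (Rabs (x m) + Rabs (y m)).
  pose proof (Rabs_pos (x m)). pose proof (Rabs_pos (y m)).
  split; [lra |]. intros t Ht. specialize (Hm t Ht). simpl in Hm.
  pose proof (Rabs_pos (x t)). pose proof (Rabs_pos (y t)). lra.
Qed.

Lemma flow_unique_forward (x y x0 y0 : R -> R) (T : R) :
  0 <= T -> (forall t, 0 <= t <= T -> flow x y t) ->
  (forall t, 0 <= t <= T -> flow x0 y0 t) -> x 0 = x0 0 -> y 0 = y0 0 ->
  forall t, 0 <= t <= T -> x t = x0 t /\ y t = y0 t.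
Proof.
  intros HT Hf H0 Hx Hy t Ht.
  destruct (flow_bounded _ _ _ HT H0) as [B [HB HB0]].
  assert (Hclose : forall eta, 0 < eta ->
    Rabs (x t - x0 t) < eta /\ Rabs (y t - y0 t) < eta).
  { intros eta Heta.
    destruct (orbit_comparison B T eta HB HT Heta) as [rho [Hrho Hcmp]].
    apply (Hcmp (fun _ => 0) x y x0 y0 T); try assumption; try lra.
    - intros j _. rewrite Rabs_R0. lra.
    - now apply flow_solution. }
  split; apply cond_eq; intros eta Heta; now apply Hclose.
Qed.

Lemma flow_unique (x y x0 y0 : R -> R) (t1 : R) :
  (forall t, flow x y t) -> (forall t, flow x0 y0 t) ->
  x t1 = x0 t1 -> y t1 = y0 t1 -> forall t, x t = x0 t /\ y t = y0 t.
Proof.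
  intros Hf H0 Hx Hy t.
  destruct (Rle_lt_dec t1 t) as [Hle | Hlt].
  - destruct (flow_unique_forward
      (fun s => x (s + t1)) (fun s => y (s + t1))
      (fun s => x0 (s + t1)) (fun s => y0 (s + t1)) (t - t1)) with (t - t1)
      as [E1 E2]; try lra; try (intros; now apply flow_shift);
      try (now rewrite Rplus_0_l).
    replace (t - t1 + t1) with t in E1, E2 by ring. now split.
  - destruct (flow_unique_forward
      (fun s => x (t1 - s)) (fun s => - y (t1 - s))
      (fun s => x0 (t1 - s)) (fun s => - y0 (t1 - s)) (t1 - t)) with (t1 - t)
      as [E1 E2]; try lra; try (intros; now apply flow_reverse);
      rewrite ?Rminus_0_r; try lra.
    replace (t1 - (t1 - t)) with t in E1, E2 by ring. split; lra.
Qed.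

Definition periodic_orbit (x y : R -> R) (T : R) : Prop :=
  0 < T /\ (forall t, flow x y t) /\
  (forall t, x (t + T) = x t /\ y (t + T) = y t) /\
  (forall t, 0 < t < T -> ~ (x t = x 0 /\ y t = y 0)).

(** Closed solutions are only given on one period; extending them lets
    different starting points on an oval be compared. *)
Definition periodic_extension (f : R -> R) (T t : R) : R :=
  f (t - IZR (Int_part (t / T)) * T).

Lemma Int_part_unique (r : R) (k : Z) :
  IZR k <= r < IZR k + 1 -> Int_part r = k.
Proof.
  intros Hk. destruct (base_Int_part r) as [H1 H2].
  assert (IZR k < IZR (Int_part r + 1)) by (rewrite plus_IZR; lra).
  assert (IZR (Int_part r) < IZR (k + 1)) by (rewrite plus_IZR; lra).
  apply lt_IZR in H, H0. lia.
Qed.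

Lemma periodic_extension_period (f : R -> R) (T t : R) :
  0 < T -> periodic_extension f T (t + T) = periodic_extension f T t.
Proof.
  intros HT. unfold periodic_extension.
  assert (E : Int_part ((t + T) / T) = (Int_part (t / T) + 1)%Z).
  { apply Int_part_unique. rewrite plus_IZR.
    destruct (base_Int_part (t / T)) as [H1 H2].
    replace ((t + T) / T) with (t / T + 1) by (field; lra). lra. }
  rewrite E, plus_IZR. f_equal. ring.
Qed.

(** On each period window, both endpoints included, the extension is a
    translate of [f]; closing the windows at both ends is what lets two of them
    be glued differentiably. *)
Lemma periodic_extension_window (f : R -> R) (T t : R) (k : Z) :
  0 < T -> f T = f 0 -> IZR k * T <= t <= IZR k * T + T ->
  periodic_extension f T t = f (t - IZR k * T).
Proof.
  intros HT Hf Ht. unfold periodic_extension.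
  destruct (Req_dec t (IZR k * T + T)) as [-> | Hne].
  - replace ((IZR k * T + T) / T) with (IZR (k + 1))
      by (rewrite plus_IZR; field; lra).
    rewrite (Int_part_unique (IZR (k + 1)) (k + 1)) by lra.
    rewrite plus_IZR.
    replace (IZR k * T + T - (IZR k + 1) * T) with 0 by ring.
    replace (IZR k * T + T - IZR k * T) with T by ring. now symmetry.
  - rewrite (Int_part_unique (t / T) k); [reflexivity |].
    split.
    + apply Rmult_le_reg_r with T; [lra |]. unfold Rdiv.
      rewrite Rmult_assoc, Rinv_l, Rmult_1_r by lra. lra.
    + apply Rmult_lt_reg_r with T; [lra |]. unfold Rdiv.
      rewrite Rmult_assoc, Rinv_l, Rmult_1_r by lra. lra.
Qed.

Lemma is_derive_glue (f g k : R -> R) (t l d : R) :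
  0 < d -> (forall s, t - d <= s <= t -> f s = g s) ->
  (forall s, t <= s <= t + d -> f s = k s) ->
  is_derive g t l -> is_derive k t l -> is_derive f t l.
Proof.
  intros Hd Hg Hk Dg Dk. apply is_derive_Reals.
  apply is_derive_Reals in Dg. apply is_derive_Reals in Dk.
  intros eps Heps.
  destruct (Dg eps Heps) as [d1 H1]. destruct (Dk eps Heps) as [d2 H2].
  assert (Hmin : 0 < Rmin d (Rmin d1 d2)).
  { repeat apply Rmin_glb_lt; try apply cond_pos; lra. }
  exists (mkposreal _ Hmin). intros h Hh0 Hh. simpl in Hh.
  assert (Hh' : Rabs h < d /\ Rabs h < d1 /\ Rabs h < d2).
  { pose proof (Rmin_l d (Rmin d1 d2)). pose proof (Rmin_r d (Rmin d1 d2)).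
    pose proof (Rmin_l d1 d2). pose proof (Rmin_r d1 d2). lra. }
  destruct Hh' as [A [A1 A2]]. apply Rabs_def2 in A.
  destruct (Rle_lt_dec 0 h).
  - rewrite (Hk (t + h)), (Hk t) by lra. now apply H2.
  - rewrite (Hg (t + h)), (Hg t) by lra. now apply H1.
Qed.

Lemma is_derive_translate (f df : R -> R) (c t : R) :
  is_derive f (t - c) (df (t - c)) ->
  is_derive (fun s => f (s - c)) t (df (t - c)).
Proof.
  unfold Rminus. intros D. auto_derive; [derivability |].
  rewrite_derive D. ring.
Qed.

Lemma periodic_extension_derive (f df : R -> R) (T : R) :
  0 < T -> f T = f 0 -> df T = df 0 ->
  (forall t : R, 0 <= t <= T -> is_derive f t (df t)) ->
  forall t : R, is_derive (periodic_extension f T) t (periodic_extension df T t).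
Proof.
  intros HT Hf Hdf D t.
  set (k := Int_part (t / T)).
  assert (Hk : IZR k * T <= t < IZR k * T + T).
  { destruct (base_Int_part (t / T)) as [H1 H2]. fold k in H1, H2.
    assert (Et : t = t / T * T) by (field; lra).
    split; rewrite Et at 1; nra. }
  rewrite (periodic_extension_window df T t k) by (assumption || lra).
  destruct (Req_dec t (IZR k * T)) as [Et | Hne].
  - apply (is_derive_glue _ (fun s => f (s - IZR (k - 1) * T))
      (fun s => f (s - IZR k * T)) _ _ T HT).
    + intros s Hs. apply periodic_extension_window; try assumption.
      rewrite minus_IZR. lra.
    + intros s Hs. apply periodic_extension_window; try assumption. lra.
    + replace (df (t - IZR k * T)) with (df (t - IZR (k - 1) * T)).
      * apply is_derive_translate. apply D. rewrite minus_IZR. lra.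
      * rewrite minus_IZR.
        replace (t - (IZR k - 1) * T) with T by lra.
        replace (t - IZR k * T) with 0 by lra. exact Hdf.
    + apply is_derive_translate. apply D. lra.
  - apply (is_derive_glue _ (fun s => f (s - IZR k * T))
      (fun s => f (s - IZR k * T)) _ _
      (Rmin (t - IZR k * T) (IZR k * T + T - t))).
    + apply Rmin_glb_lt; lra.
    + pose proof (Rmin_l (t - IZR k * T) (IZR k * T + T - t)).
      intros s Hs. apply periodic_extension_window; try assumption. lra.
    + pose proof (Rmin_r (t - IZR k * T) (IZR k * T + T - t)).
      intros s Hs. apply periodic_extension_window; try assumption. lra.
    + apply is_derive_translate. apply D. lra.
    + apply is_derive_translate. apply D. lra.
Qed.

Lemma periodic_extension_base (f : R -> R) (T t : R) :
  0 < T -> f T = f 0 -> 0 <= t <= T -> periodic_extension f T t = f t.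
Proof.
  intros HT Hf Ht. rewrite (periodic_extension_window f T t 0) by (assumption || lra).
  f_equal. ring.
Qed.

Lemma closed_solution_extends (x y : R -> R) (T : R) :
  0 < T -> solution (fun _ => 0) x y T -> x T = x 0 -> y T = y 0 ->
  (forall t, 0 < t < T -> ~ (x t = x 0 /\ y t = y 0)) ->
  exists X Y, periodic_orbit X Y T /\
    forall t, 0 <= t <= T -> X t = x t /\ Y t = y t.
Proof.
  intros HT Hs Hx Hy Hmin.
  exists (periodic_extension x T), (periodic_extension y T).
  assert (Hbase : forall t, 0 <= t <= T ->
    periodic_extension x T t = x t /\ periodic_extension y T t = y t).
  { intros t Ht. now split; apply periodic_extension_base. }
  split; [| exact Hbase]. split; [exact HT |]. split; [| split].
  - intros t. split.
    + apply (periodic_extension_derive x y); try assumption.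
      intros s Hs'. now apply (solution_flow x y T).
    + apply (periodic_extension_derive y (fun t => x t - x t ^ 3));
        try assumption.
      * now rewrite Hx.
      * intros s Hs'. now apply (solution_flow x y T).
  - intros t. now split; apply periodic_extension_period.
  - intros t Ht. destruct (Hbase t) as [-> ->]; [lra |].
    destruct (Hbase 0) as [-> ->]; [lra |]. now apply Hmin.
Qed.

Lemma Ham_derive_flow (x y : R -> R) (t : R) :
  flow x y t -> is_derive (fun s => Ham (x s) (y s)) t 0.
Proof.
  intros [Dx Dy]. unfold Ham. auto_derive; [derivability |].
  rewrite_derive Dx. rewrite_derive Dy. field.
Qed.

Lemma Ham_conserved (x y : R -> R) (t t' : R) :
  (forall s, flow x y s) -> Ham (x t) (y t) = Ham (x t') (y t').
Proof.
  intros Hf.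
  assert (Hle : forall a b, a <= b -> Ham (x b) (y b) = Ham (x a) (y a)).
  { intros a b Hab.
    destruct (mean_value (fun s => Ham (x s) (y s)) (fun _ => 0) a b Hab)
      as [c [_ Hc]].
    - intros s _. now apply Ham_derive_flow.
    - lra. }
  destruct (Rle_lt_dec t t'); [symmetry |]; apply Hle; lra.
Qed.

(** Interior ovals avoid the axis [x = 0], where [H >= 0], so that an orbit
    cannot leave its half-plane. *)
Lemma orbit_stays_on_oval (A : annulus) (h : R) (x y : R -> R) (t : R) :
  energy A h -> (forall s, flow x y s) -> oval A h (x 0) (y 0) ->
  oval A h (x t) (y t).
Proof.
  intros Hh Hf [H0 Hside].
  assert (HH : forall s, Ham (x s) (y s) = h)
    by (intros s; rewrite <- H0; now apply Ham_conserved).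
  split; [apply HH |].
  assert (Hne : A <> exterior -> forall s, x s <> 0).
  { intros HA s E. specialize (HH s). unfold Ham in HH. rewrite E in HH.
    pose proof (pow2_ge_0 (y s)).
    destruct A; simpl in Hh; try lra. now elim HA. }
  assert (Hcont : continuity x).
  { intros s. destruct (Hf s) as [Dx _]. eapply is_derive_continuity_pt, Dx. }
  assert (Hsign : A <> exterior -> 0 < x 0 * x t).
  { intros HA. apply Rnot_le_lt. intros Hle.
    destruct (IVT_gen x 0 t 0 Hcont) as [z [_ Hz]].
    - unfold Rmin, Rmax. pose proof (Hne HA 0). pose proof (Hne HA t).
      destruct (Rle_dec (x 0) (x t)); split; nra.
    - now apply (Hne HA z). }
  destruct A; [| | exact I]; specialize (Hsign ltac:(discriminate)); nra.
Qed.

Lemma increasing_at (f : R -> R) (t l : R) :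
  is_derive f t l -> 0 < l ->
  exists d, 0 < d /\ forall s, 0 < s < d -> f (t - s) < f t < f (t + s).
Proof.
  intros D Hl. apply is_derive_Reals in D.
  destruct (D (l / 2)) as [d Hd]; [lra |].
  exists d. split; [apply cond_pos |]. intros s Hs. split.
  - assert (E := Hd (- s) ltac:(lra) ltac:(rewrite Rabs_Ropp, Rabs_right; lra)).
    apply Rabs_def2 in E. destruct E as [_ E].
    assert (0 < (f (t + - s) - f t) / - s) by lra.
    assert ((f (t + - s) - f t) = (f (t + - s) - f t) / - s * - s) by (field; lra).
    unfold Rminus at 1. nra.
  - assert (E := Hd s ltac:(lra) ltac:(rewrite Rabs_right; lra)).
    apply Rabs_def2 in E. destruct E as [_ E].
    assert (0 < (f (t + s) - f t) / s) by lra.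
    assert ((f (t + s) - f t) = (f (t + s) - f t) / s * s) by (field; lra).
    nra.
Qed.

(** At a maximum of [x] one has [x' = y = 0] and [x'' = x - x^3 <= 0]. *)
Lemma orbit_max_point (x y : R -> R) (T : R) :
  periodic_orbit x y T -> exists t, y t = 0 /\ x t - x t ^ 3 <= 0.
Proof.
  intros [HT [Hf [Hper _]]].
  destruct (continuity_ab_maj x 0 T) as [t1 [Hmax Ht1]].
  - lra.
  - intros t _. destruct (Hf t) as [Dx _]. eapply is_derive_continuity_pt, Dx.
  - assert (Hmax3 : forall t, - T <= t <= 2 * T -> x t <= x t1).
    { intros t Ht. destruct (Rlt_le_dec t 0); [| destruct (Rle_lt_dec t T)].
      - destruct (Hper t) as [<- _]. apply Hmax. lra.
      - apply Hmax. lra.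
      - destruct (Hper (t - T)) as [E _].
        replace (t - T + T) with t in E by ring. rewrite E. apply Hmax. lra. }
    exists t1. destruct (Hf t1) as [Dx Dy].
    assert (Hy : y t1 = 0).
    { apply is_derive_Reals in Dx.
      rewrite <- (deriv_maximum x (t1 - T / 2) (t1 + T / 2) t1 (exist _ _ Dx)).
      - reflexivity.
      - lra.
      - lra.
      - intros t H1 H2. apply Hmax3. lra. }
    split; [exact Hy |]. apply Rnot_lt_le. intros Hpos.
    destruct (increasing_at _ _ _ Dy Hpos) as [d [Hd Hinc]].
    set (s := Rmin (d / 2) (T / 2)).
    assert (Hs : 0 < s) by (unfold s; apply Rmin_glb_lt; lra).
    assert (Hsd : s <= d / 2) by apply Rmin_l.
    assert (HsT : s <= T / 2) by apply Rmin_r.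
    destruct (mean_value x y t1 (t1 + s / 2)) as [c [Hc Ec]];
      [lra | intros t _; apply Hf |].
    destruct (mean_value x y (t1 + s / 2) (t1 + s)) as [c' [Hc' Ec']];
      [lra | intros t _; apply Hf |].
    assert (0 <= y c).
    { destruct (Req_dec c t1) as [-> | Hne]; [lra |].
      destruct (Hinc (c - t1)) as [_ E]; [lra |].
      replace (t1 + (c - t1)) with c in E by ring. lra. }
    assert (0 < y c').
    { destruct (Hinc (c' - t1)) as [_ E]; [lra |].
      replace (t1 + (c' - t1)) with c' in E by ring. lra. }
    assert (x (t1 + s) <= x t1) by (apply Hmax3; lra).
    nra.
Qed.

(** On one oval the conditions [y = 0], [x - x^3 <= 0] single out the
    rightmost point. *)
Lemma max_point_unique (A : annulus) (h x1 x2 : R) :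
  energy A h -> oval A h x1 0 -> oval A h x2 0 ->
  x1 - x1 ^ 3 <= 0 -> x2 - x2 ^ 3 <= 0 -> x1 = x2.
Proof.
  intros Hh [H1 S1] [H2 S2] M1 M2. unfold Ham in H1, H2.
  assert (Hne : h <> 0 /\ h <> - (1 / 4)) by (destruct A; simpl in Hh; lra).
  assert (Hcase : forall z, 1 / 2 * 0 ^ 2 - 1 / 2 * z ^ 2 + 1 / 4 * z ^ 4 = h ->
    z - z ^ 3 <= 0 -> 1 < z \/ -1 < z < 0).
  { intros z Hz Mz.
    assert (z <> 0) by (intros ->; lra).
    assert (z <> 1) by (intros ->; lra).
    assert (z <> -1) by (intros ->; lra).
    destruct (Rlt_le_dec 1 z); [now left | right].
    split; [| apply Rnot_le_lt; intros ?]; [apply Rnot_le_lt; intros ?|]; nra. }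
  assert (C1 := Hcase x1 H1 M1). assert (C2 := Hcase x2 H2 M2).
  assert (E : (x1 ^ 2 - x2 ^ 2) * (x1 ^ 2 + x2 ^ 2 - 2) = 0) by lra.
  destruct C1 as [C1 | C1], C2 as [C2 | C2].
  - apply Rmult_integral in E. destruct E as [E | E]; nra.
  - destruct A; simpl in S1, S2, Hh; try lra. exfalso. nra.
  - destruct A; simpl in S1, S2, Hh; try lra. exfalso. nra.
  - apply Rmult_integral in E. destruct E as [E | E]; nra.
Qed.

(** Both orbits pass through the rightmost point, hence differ by a time
    translation; each period is then a return time of the other orbit. *)
Lemma same_oval_same_orbit (A : annulus) (h : R) (x y x' y' : R -> R) (T T' : R) :
  energy A h -> periodic_orbit x y T -> periodic_orbit x' y' T' ->
  oval A h (x 0) (y 0) -> oval A h (x' 0) (y' 0) ->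
  T' = T /\ exists a, forall t, x' t = x (t + a) /\ y' t = y (t + a).
Proof.
  intros Hh P P' O O'.
  destruct (orbit_max_point _ _ _ P) as [m [Ym Xm]].
  destruct (orbit_max_point _ _ _ P') as [m' [Ym' Xm']].
  destruct P as [HT [Hf [Hper Hmin]]]. destruct P' as [HT' [Hf' [Hper' Hmin']]].
  assert (Hshift : forall t, x' t = x (t + (m - m')) /\ y' t = y (t + (m - m'))).
  { apply (flow_unique x' y' (fun t => x (t + (m - m')))
      (fun t => y (t + (m - m'))) m').
    - exact Hf'.
    - intros t. now apply flow_shift.
    - replace (m' + (m - m')) with m by ring.
      apply (max_point_unique A h); try assumption.
      + rewrite <- Ym'. now apply orbit_stays_on_oval.
      + rewrite <- Ym. now apply orbit_stays_on_oval.
    - replace (m' + (m - m')) with m by ring. lra. }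
  split; [| now exists (m - m')].
  destruct (Rtotal_order T' T) as [Hlt | [Heq | Hgt]]; [| exact Heq |].
  - exfalso. apply (Hmin T'); [lra |].
    destruct (Hper' (0 - (m - m'))) as [E1 E2].
    destruct (Hshift (0 - (m - m') + T')) as [F1 F2].
    destruct (Hshift (0 - (m - m'))) as [G1 G2].
    replace (0 - (m - m') + T' + (m - m')) with T' in F1, F2 by ring.
    replace (0 - (m - m') + (m - m')) with 0 in G1, G2 by ring.
    split; congruence.
  - exfalso. apply (Hmin' T); [lra |].
    destruct (Hper (0 + (m - m'))) as [E1 E2].
    destruct (Hshift T) as [F1 F2]. destruct (Hshift 0) as [G1 G2].
    replace (0 + (m - m') + T) with (T + (m - m')) in E1, E2 by ring.
    split; congruence.
Qed.

Definition continuous_2d (F : R -> R -> R) : Prop :=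
  forall x y, continuity_2d_pt F x y.

Lemma continuous_along (F : R -> R -> R) (x y : R -> R) (t : R) :
  continuous_2d F -> continuity_pt x t -> continuity_pt y t ->
  continuous (fun s => F (x s) (y s)) t.
Proof.
  intros HF Hx Hy. apply continuity_pt_filterlim in Hx, Hy.
  apply (continuous_comp_2 x y F t Hx Hy).
  apply continuity_2d_pt_filterlim. apply HF.
Qed.

Ltac solve_continuous_2d :=
  intros ? ?; simpl pow;
  repeat first [ apply continuity_2d_pt_plus | apply continuity_2d_pt_minus
    | apply continuity_2d_pt_mult | apply continuity_2d_pt_opp
    | apply continuity_2d_pt_id1 | apply continuity_2d_pt_id2
    | apply continuity_2d_pt_const ].

Definition loop_integral (F : R -> R -> R) (x y : R -> R) (T : R) : R :=
  RInt (fun t => F (x t) (y t)) 0 T.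

Lemma flow_continuous_along (F : R -> R -> R) (x y : R -> R) (t : R) :
  continuous_2d F -> flow x y t -> continuous (fun s => F (x s) (y s)) t.
Proof.
  intros HF [Dx Dy]. apply continuous_along; [exact HF | |];
    eapply is_derive_continuity_pt; eassumption.
Qed.

Lemma RInt_period_shift (f : R -> R) (T a : R) :
  (forall t, continuous f t) -> (forall t, f (t + T) = f t) ->
  RInt (fun t => f (t + a)) 0 T = RInt f 0 T.
Proof.
  intros Hc Hper.
  assert (Hex : forall b c, ex_RInt f b c)
    by (intros; apply (ex_RInt_continuous (V := R_CompleteNormedModule)); intros; apply Hc).
  assert (Htr : forall c d, RInt (fun t => f (t + c)) 0 d = RInt f c (d + c)).
  { intros c d. pose proof (RInt_comp_lin (V := R_CompleteNormedModule) f 1 c 0 d) as E.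
    replace (1 * 0 + c) with c in E by ring.
    replace (1 * d + c) with (d + c) in E by ring.
    rewrite <- E by apply Hex.
    apply RInt_ext. intros t _. unfold scal. simpl. unfold mult. simpl.
    rewrite !Rmult_1_l. reflexivity. }
  assert (Hend : RInt f T (a + T) = RInt f 0 a).
  { rewrite <- Htr. apply RInt_ext. intros t _. apply Hper. }
  rewrite Htr.
  pose proof (RInt_Chasles (V := R_CompleteNormedModule) f 0 a (T + a) (Hex _ _) (Hex _ _)) as E1.
  pose proof (RInt_Chasles (V := R_CompleteNormedModule) f 0 T (T + a) (Hex _ _) (Hex _ _)) as E2.
  rewrite (Rplus_comm a T) in Hend. unfold plus in E1, E2. simpl in E1, E2. lra.
Qed.

Lemma oval_integral_on_orbit (A : annulus) (w : R -> R -> R) (h v : R)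
  (x y : R -> R) (T : R) :
  continuous_2d w -> energy A h -> periodic_orbit x y T ->
  oval A h (x 0) (y 0) -> is_oval_integral A w h v ->
  v = loop_integral (fun a b => w a b * b) x y T.
Proof.
  intros Hw Hh P O (x' & y' & T' & HT' & Hs & O' & Ex & Ey & Hmin & HI).
  destruct (closed_solution_extends x' y' T' HT' Hs Ex Ey Hmin)
    as (X & Y & PX & HX).
  assert (OX : oval A h (X 0) (Y 0)).
  { destruct (HX 0) as [-> ->]; [lra | exact O']. }
  destruct (same_oval_same_orbit A h x y X Y T T' Hh P PX O OX)
    as [-> [a Ha]].
  assert (Hc : continuous_2d (fun a b => w a b * b)).
  { intros p q. apply continuity_2d_pt_mult; [apply Hw | apply continuity_2d_pt_id2]. }
  destruct P as [HT [Hf [Hper _]]].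
  rewrite <- (is_RInt_unique _ _ _ _ HI). unfold loop_integral.
  rewrite <- (RInt_period_shift (fun t => w (x t) (y t) * y t) T a).
  - apply RInt_ext. intros t Ht. rewrite Rmin_left, Rmax_right in Ht by lra.
    destruct (solution_flow _ _ _ t Hs) as [Dx _]; [lra |].
    rewrite (is_derive_unique _ _ _ Dx).
    destruct (HX t) as [E1 E2]; [lra |]. destruct (Ha t) as [F1 F2].
    now rewrite <- E1, <- E2, F1, F2.
  - intros t. now apply (flow_continuous_along (fun a b => w a b * b)).
  - intros t. destruct (Hper t) as [-> ->]. reflexivity.
Qed.

(** * The cross-section and the first return *)

Lemma CV_radius_pos (a : nat -> R) (r : R) :
  0 < r -> (forall t : R, Rabs t < r -> ex_pseries a t) ->
  Rbar_lt 0 (CV_radius a).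
Proof.
  intros Hr Ha. apply Rbar_not_le_lt. intros Hle.
  apply (CV_disk_outside a (r / 2)).
  - apply (Rbar_le_lt_trans _ 0); [exact Hle |]. simpl.
    rewrite Rabs_right; lra.
  - apply ex_series_lim_0.
    apply ex_pseries_R. apply Ha. rewrite Rabs_right; lra.
Qed.

Lemma analytic_ex_derive (f : R -> R) (x : R) : analytic_at f x -> ex_derive f x.
Proof.
  intros (a & r & Hr & Ha).
  assert (Hcv : Rbar_lt 0 (CV_radius a)).
  { apply (CV_radius_pos a r Hr). intros t Ht. eexists. now apply Ha. }
  assert (D : is_derive (PSeries a) (x - x) (PSeries (PS_derive a) (x - x))).
  { apply is_derive_PSeries. rewrite Rminus_diag, Rabs_R0. exact Hcv. }
  exists (PSeries (PS_derive a) (x - x)).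
  apply (is_derive_ext_loc (fun s => PSeries a (s - x))).
  - exists (mkposreal r Hr). intros s Hs.
    rewrite (is_pseries_unique _ _ _ (Ha (s - x) Hs)). f_equal. ring.
  - now apply (is_derive_translate (PSeries a) (PSeries (PS_derive a))).
Qed.

Lemma analytic_continuity_pt (f : R -> R) (x : R) :
  analytic_at f x -> continuity_pt f x.
Proof.
  intros Ha. destruct (analytic_ex_derive _ _ Ha) as [d D].
  eapply is_derive_continuity_pt, D.
Qed.

Lemma derivable_lipschitz_at (f : R -> R) (x : R) :
  ex_derive f x -> exists K d, 0 <= K /\ 0 < d /\
  forall p, Rabs (p - x) < d -> Rabs (f p - f x) <= K * Rabs (p - x).
Proof.
  intros [l D]. apply is_derive_Reals in D.
  destruct (D 1 Rlt_0_1) as [d Hd].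
  exists (Rabs l + 1), d. pose proof (Rabs_pos l).
  split; [lra |]. split; [apply cond_pos |]. intros p Hp.
  destruct (Req_dec p x) as [-> | Hne].
  - rewrite !Rminus_diag, Rabs_R0. lra.
  - specialize (Hd (p - x) ltac:(lra) Hp).
    replace (x + (p - x)) with p in Hd by ring.
    assert (E : f p - f x = ((f p - f x) / (p - x) - l + l) * (p - x))
      by (field; lra).
    rewrite E, Rabs_mult. apply Rmult_le_compat_r; [apply Rabs_pos |].
    pose proof (Rabs_triang ((f p - f x) / (p - x) - l) l). lra.
Qed.

Lemma continuity_2d_pt_delta (F : R -> R -> R) (a b eps : R) :
  continuity_2d_pt F a b -> 0 < eps ->
  exists d, 0 < d /\ forall x y, Rabs (x - a) < d -> Rabs (y - b) < d ->
    Rabs (F x y - F a b) < eps.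
Proof.
  intros HF He. destruct (HF (mkposreal eps He)) as [d Hd].
  exists d. split; [apply cond_pos | exact Hd].
Qed.

Lemma continuity_pt_delta (f : R -> R) (a eps : R) :
  continuity_pt f a -> 0 < eps ->
  exists d, 0 < d /\ forall x, Rabs (x - a) < d -> Rabs (f x - f a) < eps.
Proof.
  intros Hf He. destruct (Hf eps He) as [d [Hd H]].
  exists d. split; [exact Hd |]. intros x Hx.
  destruct (Req_dec x a) as [-> | Hne].
  - now rewrite Rminus_diag, Rabs_R0.
  - apply (H x). split; [split; [exact I | lra] | exact Hx].
Qed.

Lemma Ham_continuous_2d : continuous_2d Ham.
Proof. unfold Ham. solve_continuous_2d. Qed.

Lemma energy_open (A : annulus) (h : R) :
  energy A h -> exists d, 0 < d /\ forall q, Rabs (q - h) < d -> energy A q.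
Proof.
  intros Hh. destruct A; simpl in *.
  1, 2: exists (Rmin (h + 1 / 4) (- h)); pose proof (Rmin_l (h + 1 / 4) (- h));
    pose proof (Rmin_r (h + 1 / 4) (- h));
    (split; [apply Rmin_glb_lt; lra |]); intros q Hq;
    apply Rabs_def2 in Hq; lra.
  exists h. split; [exact Hh |]. intros q Hq. apply Rabs_def2 in Hq. lra.
Qed.

Lemma oval_regular (A : annulus) (h x y : R) :
  energy A h -> oval A h x y -> 0 < y ^ 2 + (x - x ^ 3) ^ 2.
Proof.
  intros Hh [HH _]. apply Rnot_le_lt. intros Hle.
  pose proof (pow2_ge_0 y). pose proof (pow2_ge_0 (x - x ^ 3)).
  assert (Ey : y = 0) by nra.
  assert (Ex : x * ((1 - x) * (1 + x)) = 0) by nra.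
  unfold Ham in HH. rewrite Ey in HH.
  apply Rmult_integral in Ex. destruct Ex as [Ex | Ex].
  - rewrite Ex in HH. destruct A; simpl in Hh; lra.
  - assert (x ^ 2 = 1) by lra.
    replace (x ^ 4) with ((x ^ 2) ^ 2) in HH by ring. rewrite H1 in HH.
    destruct A; simpl in Hh; lra.
Qed.

(** Coordinate along the flow direction [(b, c - c^3)] at a point [(c, b)], and
    its rate of change along [X_0]; the latter is also the derivative of [H] in
    the direction normal to the flow. *)
Definition along (c b x y : R) : R := b * x + (c - c ^ 3) * y.
Definition rate (c b x y : R) : R := b * y + (c - c ^ 3) * (x - x ^ 3).

Lemma rate_positive_near (A : annulus) (h c b : R) :
  energy A h -> oval A h c b ->
  exists d, 0 < d /\ forall x y, Rabs (x - c) < d -> Rabs (y - b) < d ->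
    rate c b c b / 2 < rate c b x y.
Proof.
  intros Hh HO. pose proof (oval_regular A h c b Hh HO) as Hpos.
  assert (HR : 0 < rate c b c b) by (unfold rate; lra).
  destruct (continuity_2d_pt_delta (rate c b) c b (rate c b c b / 2))
    as [d [Hd H]].
  - assert (HC : continuous_2d (rate c b)) by (unfold rate; solve_continuous_2d).
    apply HC.
  - lra.
  - exists d. split; [exact Hd |]. intros x y Hx Hy.
    specialize (H x y Hx Hy). apply Rabs_def2 in H. lra.
Qed.

Lemma segment_in_ball (c d z z' s : R) :
  0 <= s <= 1 -> Rabs (z - c) < d -> Rabs (z' - c) < d ->
  Rabs (z' + s * (z - z') - c) < d.
Proof.
  intros Hs Hz Hz'. apply Rabs_def2 in Hz, Hz'.
  replace (z' + s * (z - z') - c) with ((1 - s) * (z' - c) + s * (z - c)) by ring.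
  destruct (Rle_lt_dec (z - c) (z' - c)); apply Rabs_def1; nra.
Qed.

(** [(H, along)] is a local chart: two points with the same [along]-value differ
    by a multiple of the normal, in which direction [H] is strictly monotone. *)
Lemma chart_injective (c b d x y x' y' : R) :
  0 < rate c b c b ->
  (forall u v, Rabs (u - c) < d -> Rabs (v - b) < d ->
     rate c b c b / 2 < rate c b u v) ->
  Rabs (x - c) < d -> Rabs (y - b) < d ->
  Rabs (x' - c) < d -> Rabs (y' - b) < d ->
  Ham x y = Ham x' y' -> along c b x y = along c b x' y' -> x = x' /\ y = y'.
Proof.
  intros HR Hrate Hx Hy Hx' Hy' HH Hal.
  set (a := c - c ^ 3).
  assert (HR2 : b ^ 2 + a ^ 2 = rate c b c b) by (unfold rate, a; ring).
  set (m := (b * (y - y') - a * (x - x')) / rate c b c b).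
  assert (Hal' : b * (x - x') + a * (y - y') = 0)
    by (unfold along in Hal; fold a in Hal; lra).
  assert (Ex : x - x' = - a * m).
  { apply (Rmult_eq_reg_l (rate c b c b)); [| lra].
    replace (rate c b c b * (- a * m)) with (- a * (b * (y - y') - a * (x - x')))
      by (unfold m; field; lra).
    rewrite <- HR2.
    replace ((b ^ 2 + a ^ 2) * (x - x')) with
      (b * (b * (x - x') + a * (y - y')) - a * (b * (y - y') - a * (x - x')))
      by ring.
    rewrite Hal'. ring. }
  assert (Ey : y - y' = b * m).
  { apply (Rmult_eq_reg_l (rate c b c b)); [| lra].
    replace (rate c b c b * (b * m)) with (b * (b * (y - y') - a * (x - x')))
      by (unfold m; field; lra).
    rewrite <- HR2.
    replace ((b ^ 2 + a ^ 2) * (y - y')) with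
      (a * (b * (x - x') + a * (y - y')) + b * (b * (y - y') - a * (x - x')))
      by ring.
    rewrite Hal'. ring. }
  destruct (mean_value (fun s => Ham (x' + s * (- a * m)) (y' + s * (b * m)))
    (fun s => m * rate c b (x' + s * (- a * m)) (y' + s * (b * m))) 0 1)
    as [s [Hs Es]].
  - lra.
  - intros s _. unfold Ham. auto_derive; [exact I |]. unfold rate, a. field.
  - assert (E1 : x' + 1 * (- a * m) = x) by lra.
    assert (E2 : y' + 1 * (b * m) = y) by lra.
    rewrite E1, E2, !Rmult_0_l, !Rplus_0_r, HH, !Rminus_diag in Es.
    assert (Hr : 0 < rate c b (x' + s * (- a * m)) (y' + s * (b * m))).
    { apply Rlt_trans with (rate c b c b / 2); [lra |].
      rewrite <- Ex, <- Ey. apply Hrate; now apply segment_in_ball. }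
    assert (Em : m = 0).
    { destruct (Rmult_integral m _ ltac:(symmetry; rewrite Rminus_0_r, Rmult_1_r in Es; exact Es)); lra. }
    rewrite Em in Ex, Ey. split; lra.
Qed.

(** By [chart_injective], near the section point this vanishes exactly on the
    section; its sign tells the two sides apart. *)
Definition section_gap (c b : R) (sx sy : R -> R) (x y : R) : R :=
  along c b x y - along c b (sx (Ham x y)) (sy (Ham x y)).

Lemma section_gap_continuous (A : annulus) (c b : R) (sx sy : R -> R) (x y : R) :
  cross_section A sx sy -> energy A (Ham x y) ->
  continuity_2d_pt (section_gap c b sx sy) x y.
Proof.
  intros Hsec He. destruct (Hsec _ He) as [Ax [Ay _]].
  unfold section_gap, along.
  assert (Cx := continuity_1d_2d_pt_comp sx Ham x y
    (analytic_continuity_pt _ _ Ax) (Ham_continuous_2d x y)).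
  assert (Cy := continuity_1d_2d_pt_comp sy Ham x y
    (analytic_continuity_pt _ _ Ay) (Ham_continuous_2d x y)).
  repeat first [ exact Cx | exact Cy | apply continuity_2d_pt_const
    | apply continuity_2d_pt_plus | apply continuity_2d_pt_minus | apply continuity_2d_pt_mult
    | apply continuity_2d_pt_opp
    | apply continuity_2d_pt_id1 | apply continuity_2d_pt_id2 ].
Qed.

Lemma zero_gap_on_section (A : annulus) (sx sy : R -> R) (h : R) :
  cross_section A sx sy -> energy A h ->
  exists d, 0 < d /\ forall x y,
    Rabs (x - sx h) < d -> Rabs (y - sy h) < d ->
    energy A (Ham x y) /\
    (section_gap (sx h) (sy h) sx sy x y = 0 ->
     x = sx (Ham x y) /\ y = sy (Ham x y)).
Proof.
  intros Hsec Hh. destruct (Hsec h Hh) as [Ax [Ay HO]].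
  set (c := sx h) in *. set (b := sy h) in *.
  destruct (rate_positive_near A h c b Hh HO) as [d1 [Hd1 Hrate]].
  destruct (energy_open A h Hh) as [d2 [Hd2 Hopen]].
  destruct (continuity_pt_delta sx h d1 (analytic_continuity_pt _ _ Ax) Hd1)
    as [d3 [Hd3 H3]].
  destruct (continuity_pt_delta sy h d1 (analytic_continuity_pt _ _ Ay) Hd1)
    as [d4 [Hd4 H4]].
  assert (HO1 : Ham c b = h) by apply HO.
  destruct (continuity_2d_pt_delta Ham c b (Rmin d2 (Rmin d3 d4))
    (Ham_continuous_2d c b)) as [d5 [Hd5 H5]].
  { repeat apply Rmin_glb_lt; lra. }
  rewrite HO1 in H5.
  exists (Rmin d1 d5). split; [now apply Rmin_glb_lt |].
  intros x y Hx Hy.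
  pose proof (Rmin_l d1 d5). pose proof (Rmin_r d1 d5).
  pose proof (Rmin_l d2 (Rmin d3 d4)). pose proof (Rmin_r d2 (Rmin d3 d4)).
  pose proof (Rmin_l d3 d4). pose proof (Rmin_r d3 d4).
  assert (HH : Rabs (Ham x y - h) < Rmin d2 (Rmin d3 d4)) by (apply H5; lra).
  assert (He : energy A (Ham x y)) by (apply Hopen; lra).
  split; [exact He |]. intros Hgap.
  destruct (Hsec _ He) as [_ [_ [Hq _]]].
  apply (chart_injective c b d1); try lra.
  - pose proof (oval_regular A h c b Hh HO). unfold rate. lra.
  - exact Hrate.
  - apply H3. lra.
  - apply H4. lra.
  - unfold section_gap in Hgap. lra.
Qed.

Lemma flow_continuity_x (x y : R -> R) (t : R) : flow x y t -> continuity_pt x t.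
Proof. intros [D _]. eapply is_derive_continuity_pt, D. Qed.

Lemma flow_continuity_y (x y : R -> R) (t : R) : flow x y t -> continuity_pt y t.
Proof. intros [_ D]. eapply is_derive_continuity_pt, D. Qed.

Lemma along_derive (l : nat -> R) (x y : R -> R) (T t c b : R) :
  solution l x y T -> 0 <= t <= T ->
  is_derive (fun s => along c b (x s) (y s)) t
    (rate c b (x t) (y t) + (c - c ^ 3) * (damping l (x t) (y t) * y t)).
Proof.
  intros Hs Ht. destruct (solution_derive _ _ _ _ _ Hs Ht) as [Dx Dy].
  unfold along. auto_derive; [derivability |].
  rewrite_derive Dx. rewrite_derive Dy. unfold rate. ring.
Qed.

(** A curve close to the periodic orbit passes from the negative to the
    positive side of the section around the time of the unperturbed return. *)
Lemma forced_crossing (A : annulus) (sx sy x0 y0 : R -> R) (h T0 r : R) :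
  cross_section A sx sy -> energy A h -> periodic_orbit x0 y0 T0 ->
  x0 0 = sx h -> y0 0 = sy h -> 0 < r ->
  exists s eta, 0 < s < r /\ 0 < eta /\
  forall x y : R -> R,
    (forall t, T0 - s <= t <= T0 + s -> continuity_pt x t /\ continuity_pt y t) ->
    (forall t, T0 - s <= t <= T0 + s ->
      Rabs (x t - x0 t) < eta /\ Rabs (y t - y0 t) < eta) ->
    exists t q, T0 - s <= t <= T0 + s /\ energy A q /\ x t = sx q /\ y t = sy q.
Proof.
  intros Hsec Hh [HT [Hf [Hper _]]] Ex0 Ey0 Hr.
  destruct (Hper 0) as [PX PY]. rewrite Rplus_0_l in PX, PY.
  rewrite Ex0 in PX. rewrite Ey0 in PY.
  destruct (Hsec h Hh) as [_ [_ HO]].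
  assert (Hlevel : forall t, Ham (x0 t) (y0 t) = h).
  { intros t. rewrite (Ham_conserved x0 y0 t 0 Hf), Ex0, Ey0. apply HO. }
  set (c := sx h) in *. set (b := sy h) in *.
  assert (HR : 0 < rate c b c b).
  { pose proof (oval_regular A h c b Hh HO). unfold rate. lra. }
  destruct (zero_gap_on_section A sx sy h Hsec Hh) as [d1 [Hd1 Hgap]].
  fold c b in Hgap.
  assert (D : is_derive (fun t => along c b (x0 t) (y0 t)) T0 (rate c b c b)).
  { pose proof (along_derive (fun _ => 0) x0 y0 T0 T0 c b) as D.
    rewrite PX, PY in D. replace (rate c b c b) with
      (rate c b c b + (c - c ^ 3) * (damping (fun _ => 0) c b * b))
      by (unfold damping; ring).
    apply D; [| lra]. apply flow_solution. intros; apply Hf. }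
  destruct (increasing_at _ _ _ D HR) as [d2 [Hd2 Hinc]].
  rewrite PX, PY in Hinc.
  destruct (continuity_pt_delta x0 T0 (d1 / 2) (flow_continuity_x _ _ _ (Hf T0)))
    as [d3 [Hd3 H3]]; [lra |].
  destruct (continuity_pt_delta y0 T0 (d1 / 2) (flow_continuity_y _ _ _ (Hf T0)))
    as [d4 [Hd4 H4]]; [lra |].
  rewrite PX in H3. rewrite PY in H4.
  set (m := Rmin (Rmin r d2) (Rmin d3 d4)).
  assert (Hm : 0 < m /\ m <= r /\ m <= d2 /\ m <= d3 /\ m <= d4).
  { unfold m. pose proof (Rmin_l (Rmin r d2) (Rmin d3 d4)).
    pose proof (Rmin_r (Rmin r d2) (Rmin d3 d4)).
    pose proof (Rmin_l r d2). pose proof (Rmin_r r d2).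
    pose proof (Rmin_l d3 d4). pose proof (Rmin_r d3 d4).
    split; [repeat apply Rmin_glb_lt; lra | lra]. }
  set (s := m / 2). assert (Hs : 0 < s < m) by (unfold s; lra).
  destruct (Hinc s) as [Hneg Hpos]; [lra |].
  assert (Hgap0 : forall t, section_gap c b sx sy (x0 t) (y0 t)
    = along c b (x0 t) (y0 t) - along c b c b).
  { intros t. unfold section_gap. now rewrite Hlevel. }
  destruct (continuity_2d_pt_delta (section_gap c b sx sy)
    (x0 (T0 - s)) (y0 (T0 - s))
    (along c b c b - along c b (x0 (T0 - s)) (y0 (T0 - s)))) as [e1 [He1 G1]].
  { apply (section_gap_continuous A); [exact Hsec | now rewrite Hlevel]. }
  { lra. }
  destruct (continuity_2d_pt_delta (section_gap c b sx sy)
    (x0 (T0 + s)) (y0 (T0 + s))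
    (along c b (x0 (T0 + s)) (y0 (T0 + s)) - along c b c b)) as [e2 [He2 G2]].
  { apply (section_gap_continuous A); [exact Hsec | now rewrite Hlevel]. }
  { lra. }
  rewrite Hgap0 in G1, G2.
  set (eta := Rmin (d1 / 2) (Rmin e1 e2)).
  assert (Heta : 0 < eta /\ eta <= d1 / 2 /\ eta <= e1 /\ eta <= e2).
  { unfold eta. pose proof (Rmin_l (d1 / 2) (Rmin e1 e2)).
    pose proof (Rmin_r (d1 / 2) (Rmin e1 e2)).
    pose proof (Rmin_l e1 e2). pose proof (Rmin_r e1 e2).
    split; [repeat apply Rmin_glb_lt; lra | lra]. }
  exists s, eta. split; [lra |]. split; [lra |].
  intros x y Hcont Hclose.
  assert (Hnear : forall t, T0 - s <= t <= T0 + s ->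
    Rabs (x t - c) < d1 /\ Rabs (y t - b) < d1).
  { intros t Ht. destruct (Hclose t Ht) as [C1 C2].
    assert (B1 : Rabs (x0 t - c) < d1 / 2) by (apply H3, Rabs_def1; lra).
    assert (B2 : Rabs (y0 t - b) < d1 / 2) by (apply H4, Rabs_def1; lra).
    apply Rabs_def2 in C1, C2, B1, B2. split; apply Rabs_def1; lra. }
  destruct (IVT_interv (fun t => section_gap c b sx sy (x t) (y t))
    (T0 - s) (T0 + s)) as [t [Ht Et]].
  - intros t Ht. destruct (Hcont t Ht) as [Cx Cy].
    destruct (Hnear t Ht) as [N1 N2]. destruct (Hgap _ _ N1 N2) as [He _].
    apply continuity_pt_filterlim. apply continuity_pt_filterlim in Cx, Cy.
    apply (continuous_comp_2 x y (section_gap c b sx sy) t Cx Cy).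
    apply continuity_2d_pt_filterlim. now apply (section_gap_continuous A).
  - lra.
  - destruct (Hclose (T0 - s)) as [C1 C2]; [lra |].
    specialize (G1 (x (T0 - s)) (y (T0 - s)) ltac:(lra) ltac:(lra)).
    apply Rabs_def2 in G1. lra.
  - destruct (Hclose (T0 + s)) as [C1 C2]; [lra |].
    specialize (G2 (x (T0 + s)) (y (T0 + s)) ltac:(lra) ltac:(lra)).
    apply Rabs_def2 in G2. lra.
  - destruct (Hnear t Ht) as [N1 N2].
    destruct (Hgap _ _ N1 N2) as [He Hon]. destruct (Hon Et) as [E1 E2].
    exists t, (Ham (x t) (y t)). now repeat split.
Qed.

Lemma Ham_derive_solution (l : nat -> R) (x y : R -> R) (T t : R) :
  solution l x y T -> 0 <= t <= T ->
  is_derive (fun s => Ham (x s) (y s)) t (damping l (x t) (y t) * y t ^ 2).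
Proof.
  intros Hs Ht. destruct (solution_derive _ _ _ _ _ Hs Ht) as [Dx Dy].
  unfold Ham. auto_derive; [derivability |].
  rewrite_derive Dx. rewrite_derive Dy. field.
Qed.

Lemma energy_drift (l : nat -> R) (x y : R -> R) (T W rho : R) :
  1 <= W -> 0 <= T -> (forall j, (1 <= j <= 6)%nat -> Rabs (l j) <= rho) ->
  solution l x y T ->
  (forall t, 0 <= t <= T -> Rabs (x t) <= W /\ Rabs (y t) <= W) ->
  Rabs (Ham (x T) (y T) - Ham (x 0) (y 0)) <= 6 * rho * W ^ 8 * T.
Proof.
  intros HW HT Hl Hs HB.
  destruct (mean_value (fun s => Ham (x s) (y s))
    (fun t => damping l (x t) (y t) * y t ^ 2) 0 T HT) as [c [Hc Ec]].
  - intros t Ht. now apply (Ham_derive_solution l x y T).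
  - rewrite Ec, Rminus_0_r, !Rabs_mult, (Rabs_right T) by lra.
    apply Rmult_le_compat_r; [exact HT |]. destruct (HB c Hc) as [Bx By].
    replace (6 * rho * W ^ 8) with (6 * rho * W ^ 6 * W ^ 2) by ring.
    apply Rmult_le_compat; try apply Rabs_pos.
    + now apply damping_bound.
    + rewrite <- RPow_abs. apply pow_incr. split; [apply Rabs_pos | exact By].
Qed.

(** A short orbit moves along the flow direction at a rate bounded below, while
    two points of the section are at distance [O(|p - h|)], and the energy
    drifts by [O(rho T)] only. *)
Lemma no_quick_return (A : annulus) (sx sy : R -> R) (h : R) :
  cross_section A sx sy -> energy A h ->
  exists d rho, 0 < d /\ 0 < rho /\
  forall (l : nat -> R) (x y : R -> R) (T p : R),
    0 < T -> (forall j, (1 <= j <= 6)%nat -> Rabs (l j) <= rho) ->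
    solution l x y T -> energy A p ->
    x 0 = sx h -> y 0 = sy h -> x T = sx p -> y T = sy p ->
    ~ (forall t, 0 <= t <= T ->
        Rabs (x t - sx h) < d /\ Rabs (y t - sy h) < d).
Proof.
  intros Hsec Hh. destruct (Hsec h Hh) as [Ax [Ay HO]].
  assert (HO1 : Ham (sx h) (sy h) = h) by apply HO.
  destruct (derivable_lipschitz_at sx h (analytic_ex_derive _ _ Ax))
    as (K1 & d1 & HK1 & Hd1 & L1).
  destruct (derivable_lipschitz_at sy h (analytic_ex_derive _ _ Ay))
    as (K2 & d2 & HK2 & Hd2 & L2).
  set (c := sx h) in *. set (b := sy h) in *. set (a := c - c ^ 3).
  assert (HR : 0 < rate c b c b).
  { pose proof (oval_regular A h c b Hh HO). unfold rate. lra. }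
  destruct (rate_positive_near A h c b Hh HO) as [d3 [Hd3 Hrate]].
  destruct (continuity_2d_pt_delta Ham c b (Rmin d1 d2)
    (Ham_continuous_2d c b)) as [d4 [Hd4 H4]]; [now apply Rmin_glb_lt |].
  rewrite HO1 in H4.
  set (W := Rabs c + Rabs b + 1).
  pose proof (Rabs_pos c). pose proof (Rabs_pos b). pose proof (Rabs_pos a).
  assert (HW : 1 <= W) by (unfold W; lra).
  set (Q := (Rabs b * K1 + Rabs a * K2) * (6 * W ^ 8) + Rabs a * (6 * W ^ 7)).
  assert (HW8 : 0 <= W ^ 8) by (apply pow_le; lra).
  assert (HW7 : 0 <= W ^ 7) by (apply pow_le; lra).
  assert (HbK : 0 <= Rabs b * K1 + Rabs a * K2)
    by (apply Rplus_le_le_0_compat; now apply Rmult_le_pos).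
  assert (HQ : 0 <= Q).
  { unfold Q. apply Rplus_le_le_0_compat; apply Rmult_le_pos; lra. }
  set (rho := rate c b c b / 4 / (Q + 1)).
  assert (Hrho : 0 < rho) by (unfold rho; apply Rdiv_lt_0_compat; lra).
  assert (HrQ : rho * Q < rate c b c b / 2).
  { assert (rho * (Q + 1) = rate c b c b / 4) by (unfold rho; field; lra). lra. }
  exists (Rmin (Rmin d3 d4) 1), rho.
  split; [repeat apply Rmin_glb_lt; lra |]. split; [exact Hrho |].
  intros l x y T p HT Hl Hs Hp E1 E2 E3 E4 Hnear.
  assert (Hn : forall t, 0 <= t <= T ->
    Rabs (x t - c) < d3 /\ Rabs (y t - b) < d3 /\
    Rabs (x t - c) < d4 /\ Rabs (y t - b) < d4 /\
    Rabs (x t) <= W /\ Rabs (y t) <= W).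
  { intros t Ht. destruct (Hnear t Ht) as [N1 N2].
    pose proof (Rmin_l (Rmin d3 d4) 1). pose proof (Rmin_r (Rmin d3 d4) 1).
    pose proof (Rmin_l d3 d4). pose proof (Rmin_r d3 d4).
    pose proof (Rabs_triang (x t - c) c) as T1.
    pose proof (Rabs_triang (y t - b) b) as T2.
    replace (x t - c + c) with (x t) in T1 by ring.
    replace (y t - b + b) with (y t) in T2 by ring.
    unfold W. repeat split; lra. }
  assert (Hdrift : Rabs (p - h) <= 6 * rho * W ^ 8 * T).
  { pose proof (energy_drift l x y T W rho HW ltac:(lra) Hl Hs) as HD.
    destruct (Hsec p Hp) as [_ [_ [Hp' _]]].
    rewrite E1, E2, E3, E4, HO1, Hp' in HD. apply HD.
    intros t Ht. split; apply (Hn t Ht). }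
  assert (Hph : Rabs (p - h) < Rmin d1 d2).
  { destruct (Hsec p Hp) as [_ [_ [Hp' _]]]. rewrite <- Hp', <- E3, <- E4.
    destruct (Hn T) as (_ & _ & N3 & N4 & _); [lra |]. now apply H4. }
  pose proof (Rmin_l d1 d2). pose proof (Rmin_r d1 d2).
  specialize (L1 p ltac:(lra)). specialize (L2 p ltac:(lra)).
  fold c in L1. fold b in L2.
  destruct (mean_value (fun s => along c b (x s) (y s))
    (fun t => rate c b (x t) (y t) + a * (damping l (x t) (y t) * y t)) 0 T)
    as [t [Ht Et]].
  - lra.
  - intros t Ht. now apply (along_derive l x y T).
  - destruct (Hn t Ht) as (N1 & N2 & _ & _ & Bx & By).
    specialize (Hrate _ _ N1 N2).
    assert (Hf : Rabs (a * (damping l (x t) (y t) * y t))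
      <= Rabs a * (6 * rho * W ^ 7)).
    { rewrite !Rabs_mult. apply Rmult_le_compat_l; [apply Rabs_pos |].
      replace (6 * rho * W ^ 7) with (6 * rho * W ^ 6 * W) by ring.
      apply Rmult_le_compat; try apply Rabs_pos; [| exact By].
      now apply damping_bound. }
    apply Rabs_le_between in Hf.
    assert (Hup : along c b (x T) (y T) - along c b (x 0) (y 0)
      <= (Rabs b * K1 + Rabs a * K2) * (6 * rho * W ^ 8 * T)).
    { rewrite E1, E2, E3, E4.
      replace (along c b (sx p) (sy p) - along c b c b)
        with (b * (sx p - c) + a * (sy p - b)) by (unfold along, a; ring).
      eapply Rle_trans; [apply Rle_abs |].
      eapply Rle_trans; [apply Rabs_triang |]. rewrite !Rabs_mult.
      apply Rle_trans with (Rabs b * (K1 * Rabs (p - h))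
        + Rabs a * (K2 * Rabs (p - h))).
      - apply Rplus_le_compat; apply Rmult_le_compat_l; assumption.
      - replace (Rabs b * (K1 * Rabs (p - h)) + Rabs a * (K2 * Rabs (p - h)))
          with ((Rabs b * K1 + Rabs a * K2) * Rabs (p - h)) by ring.
        now apply Rmult_le_compat_l. }
    rewrite Et, Rminus_0_r in Hup.
    replace ((Rabs b * K1 + Rabs a * K2) * (6 * rho * W ^ 8 * T))
      with ((Rabs b * K1 + Rabs a * K2) * (6 * rho * W ^ 8) * T) in Hup by ring.
    apply Rmult_le_reg_r in Hup; [| exact HT].
    assert (rho * Q = (Rabs b * K1 + Rabs a * K2) * (6 * rho * W ^ 8)
      + Rabs a * (6 * rho * W ^ 7)) by (unfold Q; ring).
    lra.
Qed.

Lemma no_return_between (x0 y0 : R -> R) (T0 s : R) :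
  periodic_orbit x0 y0 T0 -> 0 < s ->
  exists m, 0 < m /\ forall t, s <= t <= T0 - s ->
    m <= Rabs (x0 t - x0 0) + Rabs (y0 t - y0 0).
Proof.
  intros [HT [Hf [_ Hmin]]] Hs.
  destruct (Rle_lt_dec s (T0 - s)) as [Hle | Hgt].
  - destruct (continuity_ab_min
      (fun t => Rabs (x0 t - x0 0) + Rabs (y0 t - y0 0)) s (T0 - s) Hle)
      as [t1 [Hm Ht1]].
    + intros t _. apply continuity_pt_plus.
      * apply (continuity_pt_comp (fun t => x0 t - x0 0) Rabs);
          [| apply Rcontinuity_abs].
        apply continuity_pt_minus; [eapply flow_continuity_x, Hf |].
        apply continuity_pt_const. now intros ? ?.
      * apply (continuity_pt_comp (fun t => y0 t - y0 0) Rabs);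
          [| apply Rcontinuity_abs].
        apply continuity_pt_minus; [eapply flow_continuity_y, Hf |].
        apply continuity_pt_const. now intros ? ?.
    + exists (Rabs (x0 t1 - x0 0) + Rabs (y0 t1 - y0 0)).
      split; [| exact Hm]. apply Rnot_le_lt. intros H0.
      pose proof (Rabs_pos (x0 t1 - x0 0)) as P1.
      pose proof (Rabs_pos (y0 t1 - y0 0)) as P2.
      apply (Hmin t1); [lra |].
      split; apply Rminus_diag_uniq;
        match goal with |- ?z = 0 => destruct (Req_dec z 0) as [E | E];
          [exact E | apply Rabs_pos_lt in E; lra] end.
  - exists 1. split; [lra |]. intros t Ht. lra.
Qed.

(** The witnesses hidden in [first_return]. *)
Definition return_orbit (A : annulus) (sx sy : R -> R) (l : nat -> R)
  (h p : R) (x y : R -> R) (T : R) : Prop :=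
  energy A p /\ 0 < T /\ solution l x y T /\
  x 0 = sx h /\ y 0 = sy h /\ x T = sx p /\ y T = sy p /\
  forall t q, 0 < t < T -> energy A q -> ~ (x t = sx q /\ y t = sy q).

(** The first return depends continuously on the parameters at [X_0].  The
    return time is at most about [T0] because a crossing is forced there; it is
    not small because of the lower bound on the rate; and it is not in between,
    where the unperturbed orbit stays away from its starting point. *)
Lemma first_return_close (A : annulus) (sx sy x0 y0 : R -> R) (h T0 eta : R) :
  cross_section A sx sy -> energy A h -> periodic_orbit x0 y0 T0 ->
  x0 0 = sx h -> y0 0 = sy h -> 0 < eta ->
  exists rho, 0 < rho /\
  forall (l : nat -> R) (p : R) (x y : R -> R) (T : R),
    (forall j, (1 <= j <= 6)%nat -> Rabs (l j) <= rho) ->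
    return_orbit A sx sy l h p x y T ->
    Rabs (T - T0) < eta /\
    forall t, 0 <= t <= T -> Rabs (x t - x0 t) < eta /\ Rabs (y t - y0 t) < eta.
Proof.
  intros Hsec Hh HP Ex0 Ey0 Heta.
  destruct (Hsec h Hh) as [Ax [Ay [HO1 _]]].
  pose proof HP as [HT0 [Hf [Hper Hmin]]].
  destruct (no_quick_return A sx sy h Hsec Hh)
    as (d1 & rho1 & Hd1 & Hrho1 & Hquick).
  (* On [0, r) the unperturbed orbit is within [d1 / 2] of its start. *)
  destruct (continuity_pt_delta x0 0 (d1 / 2) (flow_continuity_x _ _ _ (Hf 0)))
    as [r1 [Hr1 R1]]; [lra |].
  destruct (continuity_pt_delta y0 0 (d1 / 2) (flow_continuity_y _ _ _ (Hf 0)))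
    as [r2 [Hr2 R2]]; [lra |].
  rewrite Ex0 in R1. rewrite Ey0 in R2.
  set (r := Rmin (Rmin r1 r2) (Rmin eta T0)).
  assert (Hr : 0 < r /\ r <= r1 /\ r <= r2 /\ r <= eta /\ r <= T0).
  { unfold r. pose proof (Rmin_l (Rmin r1 r2) (Rmin eta T0)).
    pose proof (Rmin_r (Rmin r1 r2) (Rmin eta T0)).
    pose proof (Rmin_l r1 r2). pose proof (Rmin_r r1 r2).
    pose proof (Rmin_l eta T0). pose proof (Rmin_r eta T0).
    split; [repeat apply Rmin_glb_lt; lra | lra]. }
  destruct (forced_crossing A sx sy x0 y0 h T0 r Hsec Hh HP Ex0 Ey0)
    as (s & eta1 & Hs & Heta1 & Hcross); [lra |].
  destruct (no_return_between x0 y0 T0 s HP) as [m [Hm Hbetween]]; [lra |].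
  rewrite Ex0, Ey0 in Hbetween.
  destruct (derivable_lipschitz_at sx h (analytic_ex_derive _ _ Ax))
    as (K1 & e1 & HK1 & He1 & L1).
  destruct (derivable_lipschitz_at sy h (analytic_ex_derive _ _ Ay))
    as (K2 & e2 & HK2 & He2 & L2).
  destruct (flow_bounded x0 y0 (T0 + s)) as [B [HB HB0]];
    [lra | intros; apply Hf |].
  set (eta2 := Rmin (Rmin eta eta1) (Rmin (Rmin (d1 / 2) (m / 4)) 1)).
  assert (Heta2 : 0 < eta2 /\ eta2 <= eta /\ eta2 <= eta1 /\ eta2 <= d1 / 2
    /\ eta2 <= m / 4 /\ eta2 <= 1).
  { unfold eta2.
    pose proof (Rmin_l (Rmin eta eta1) (Rmin (Rmin (d1 / 2) (m / 4)) 1)).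
    pose proof (Rmin_r (Rmin eta eta1) (Rmin (Rmin (d1 / 2) (m / 4)) 1)).
    pose proof (Rmin_l eta eta1). pose proof (Rmin_r eta eta1).
    pose proof (Rmin_l (Rmin (d1 / 2) (m / 4)) 1).
    pose proof (Rmin_r (Rmin (d1 / 2) (m / 4)) 1).
    pose proof (Rmin_l (d1 / 2) (m / 4)). pose proof (Rmin_r (d1 / 2) (m / 4)).
    split; [repeat apply Rmin_glb_lt; lra | lra]. }
  destruct (orbit_comparison B (T0 + s) eta2 HB) as [rho2 [Hrho2 Hcmp]];
    [lra | lra |].
  set (W := B + 1). assert (HW : 1 <= W) by (unfold W; lra).
  set (D := 6 * W ^ 8 * (T0 + s)).
  assert (HD : 0 <= D).
  { unfold D. assert (0 <= W ^ 8) by (apply pow_le; lra).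
    apply Rmult_le_pos; lra. }
  set (Q := D + (K1 + K2) * D).
  assert (HQ : 0 <= (K1 + K2) * D) by (apply Rmult_le_pos; lra).
  set (e := Rmin (Rmin e1 e2) (m / 4)).
  assert (He : 0 < e /\ e <= e1 /\ e <= e2 /\ e <= m / 4).
  { unfold e. pose proof (Rmin_l (Rmin e1 e2) (m / 4)).
    pose proof (Rmin_r (Rmin e1 e2) (m / 4)).
    pose proof (Rmin_l e1 e2). pose proof (Rmin_r e1 e2).
    split; [repeat apply Rmin_glb_lt; lra | lra]. }
  set (rho3 := e / (Q + 1)).
  assert (Hrho3 : 0 < rho3).
  { unfold rho3. apply Rdiv_lt_0_compat; unfold Q; lra. }
  assert (HrQ : rho3 * Q < e).
  { assert (rho3 * (Q + 1) = e) by (unfold rho3; field; unfold Q; lra). lra. }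
  exists (Rmin (Rmin rho1 rho2) rho3).
  split; [repeat apply Rmin_glb_lt; lra |].
  intros l p x y T Hl (Hp & HT & Hsol & E1 & E2 & E3 & E4 & Hfirst).
  pose proof (Rmin_l (Rmin rho1 rho2) rho3).
  pose proof (Rmin_r (Rmin rho1 rho2) rho3).
  pose proof (Rmin_l rho1 rho2). pose proof (Rmin_r rho1 rho2).
  assert (Hl1 : forall j, (1 <= j <= 6)%nat -> Rabs (l j) <= rho1)
    by (intros j Hj; specialize (Hl j Hj); lra).
  assert (Hl2 : forall j, (1 <= j <= 6)%nat -> Rabs (l j) <= rho2)
    by (intros j Hj; specialize (Hl j Hj); lra).
  assert (Hl3 : forall j, (1 <= j <= 6)%nat -> Rabs (l j) <= rho3)
    by (intros j Hj; specialize (Hl j Hj); lra).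
  assert (Hclose : forall T', T' <= T -> T' <= T0 + s ->
    forall t, 0 <= t <= T' ->
      Rabs (x t - x0 t) < eta2 /\ Rabs (y t - y0 t) < eta2).
  { intros T' HT' HT's. apply (Hcmp l x y x0 y0 T'); try assumption.
    - now apply (solution_shorten l x y T).
    - intros; apply Hf.
    - intros t Ht. apply HB0. lra.
    - now rewrite E1.
    - now rewrite E2. }
  assert (HTup : T <= T0 + s).
  { apply Rnot_lt_le. intros Hlt.
    destruct (Hcross x y) as (t & q & Ht & Hq & F1 & F2).
    - intros t Ht. destruct (solution_derive l x y T t Hsol) as [Dx Dy]; [lra |].
      split; eapply is_derive_continuity_pt; eassumption.
    - intros t Ht. destruct (Hclose (T0 + s) ltac:(lra) ltac:(lra) t) as [C1 C2];
        [lra |]. split; lra.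
    - apply (Hfirst t q); [lra | exact Hq | now split]. }
  assert (HC := Hclose T (Rle_refl _) HTup).
  assert (HTlow : s <= T).
  { apply Rnot_lt_le. intros Hlt.
    apply (Hquick l x y T p); try assumption.
    intros t Ht. destruct (HC t Ht) as [C1 C2].
    assert (B1 : Rabs (x0 t - sx h) < d1 / 2) by (apply R1, Rabs_def1; lra).
    assert (B2 : Rabs (y0 t - sy h) < d1 / 2) by (apply R2, Rabs_def1; lra).
    apply Rabs_def2 in C1, C2, B1, B2. split; apply Rabs_def1; lra. }
  assert (Hdrift : Rabs (p - h) <= rho3 * D).
  { pose proof (energy_drift l x y T W rho3 HW ltac:(lra) Hl3 Hsol) as HE.
    destruct (Hsec p Hp) as [_ [_ [Hp' _]]].
    rewrite E1, E2, E3, E4, HO1, Hp' in HE.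
    apply Rle_trans with (6 * rho3 * W ^ 8 * T).
    - apply HE. intros t Ht. destruct (HC t Ht) as [C1 C2].
      destruct (HB0 t) as [B1 B2]; [lra |].
      pose proof (Rabs_triang (x t - x0 t) (x0 t)) as T1.
      pose proof (Rabs_triang (y t - y0 t) (y0 t)) as T2.
      replace (x t - x0 t + x0 t) with (x t) in T1 by ring.
      replace (y t - y0 t + y0 t) with (y t) in T2 by ring.
      unfold W. split; lra.
    - unfold D. replace (rho3 * (6 * W ^ 8 * (T0 + s)))
        with (6 * rho3 * W ^ 8 * (T0 + s)) by ring.
      apply Rmult_le_compat_l; [| exact HTup].
      apply Rmult_le_pos; [lra | apply pow_le; lra]. }
  assert (HrK : 0 <= rho3 * ((K1 + K2) * D)) by (apply Rmult_le_pos; lra).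
  assert (HrD : 0 <= rho3 * D) by (apply Rmult_le_pos; lra).
  unfold Q in HrQ.
  assert (HTfar : T0 - s < T).
  { apply Rnot_le_lt. intros Hle.
    specialize (Hbetween T ltac:(lra)). destruct (HC T) as [C1 C2]; [lra |].
    specialize (L1 p ltac:(lra)). specialize (L2 p ltac:(lra)).
    rewrite <- E3 in L1. rewrite <- E4 in L2.
    assert (M1 : K1 * Rabs (p - h) <= K1 * (rho3 * D))
      by now apply Rmult_le_compat_l.
    assert (M2 : K2 * Rabs (p - h) <= K2 * (rho3 * D))
      by now apply Rmult_le_compat_l.
    pose proof (Rabs_triang (x0 T - x T) (x T - sx h)) as T1.
    pose proof (Rabs_triang (y0 T - y T) (y T - sy h)) as T2.
    replace (x0 T - x T + (x T - sx h)) with (x0 T - sx h) in T1 by ring.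
    replace (y0 T - y T + (y T - sy h)) with (y0 T - sy h) in T2 by ring.
    rewrite (Rabs_minus_sym (x0 T) (x T)) in T1.
    rewrite (Rabs_minus_sym (y0 T) (y T)) in T2.
    lra. }
  split; [apply Rabs_def1; lra |].
  intros t Ht. destruct (HC t Ht). split; lra.
Qed.

(** * Moments of an oval *)

Lemma loop_ex_RInt (F : R -> R -> R) (x y : R -> R) (T a b : R) :
  periodic_orbit x y T -> continuous_2d F ->
  ex_RInt (fun t => F (x t) (y t)) a b.
Proof.
  intros (_ & Hf & _) HF.
  apply (ex_RInt_continuous (V := R_CompleteNormedModule)). intros t _.
  now apply (flow_continuous_along F).
Qed.

Lemma loop_integral_plus (F G : R -> R -> R) (x y : R -> R) (T : R) :
  periodic_orbit x y T -> continuous_2d F -> continuous_2d G ->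
  loop_integral (fun a b => F a b + G a b) x y T
  = loop_integral F x y T + loop_integral G x y T.
Proof.
  intros HP HF HG. unfold loop_integral.
  apply (RInt_plus (V := R_CompleteNormedModule)
    (fun t => F (x t) (y t)) (fun t => G (x t) (y t)));
    now apply loop_ex_RInt with T.
Qed.

Lemma loop_integral_scal (F : R -> R -> R) (c : R) (x y : R -> R) (T : R) :
  periodic_orbit x y T -> continuous_2d F ->
  loop_integral (fun a b => c * F a b) x y T = c * loop_integral F x y T.
Proof.
  intros HP HF. unfold loop_integral.
  apply (RInt_scal (V := R_CompleteNormedModule) (fun t => F (x t) (y t)) 0 T c).
  now apply loop_ex_RInt with T.
Qed.

Lemma loop_integral_ext (F G : R -> R -> R) (x y : R -> R) (T h : R) :
  (forall t, Ham (x t) (y t) = h) ->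
  (forall a b, Ham a b = h -> F a b = G a b) ->
  loop_integral F x y T = loop_integral G x y T.
Proof. intros HH HE. apply RInt_ext. intros t _. apply HE, HH. Qed.

Lemma loop_integral_eq (F G : R -> R -> R) (x y : R -> R) (T : R) :
  (forall a b, F a b = G a b) -> loop_integral F x y T = loop_integral G x y T.
Proof. intros HE. apply RInt_ext. intros t _. apply HE. Qed.

Lemma loop_integral_le (F G : R -> R -> R) (x y : R -> R) (T h : R) :
  periodic_orbit x y T -> continuous_2d F -> continuous_2d G ->
  (forall t, Ham (x t) (y t) = h) ->
  (forall a b, Ham a b = h -> F a b <= G a b) ->
  loop_integral F x y T <= loop_integral G x y T.
Proof.
  intros HP HF HG HH HE. apply RInt_le.
  - destruct HP. lra.
  - now apply loop_ex_RInt with T.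
  - now apply loop_ex_RInt with T.
  - intros t _. apply HE, HH.
Qed.

Lemma loop_integral_exact (B F : R -> R -> R) (x y : R -> R) (T : R) :
  periodic_orbit x y T -> continuous_2d F ->
  (forall t : R, is_derive (fun s => B (x s) (y s)) t (F (x t) (y t))) ->
  loop_integral F x y T = 0.
Proof.
  intros (HT & Hf & Hper & _) HF HB. unfold loop_integral.
  apply is_RInt_unique.
  replace 0 with (minus (B (x T) (y T)) (B (x 0) (y 0))) at 2.
  - apply (is_RInt_derive (fun s => B (x s) (y s))).
    + intros t _. apply HB.
    + intros t _. now apply (flow_continuous_along F).
  - destruct (Hper 0) as [E1 E2]. rewrite Rplus_0_l in E1, E2.
    rewrite E1, E2. unfold minus, plus, opp. simpl. ring.
Qed.

Definition moment (x y : R -> R) (T : R) (k : nat) : R :=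
  loop_integral (fun a b => (a ^ 2 - 1) ^ k * b ^ 2) x y T.

Lemma continuous_2d_pow (F : R -> R -> R) (k : nat) :
  continuous_2d F -> continuous_2d (fun a b => F a b ^ k).
Proof.
  intros HF p q. induction k as [| k IH]; simpl.
  - apply continuity_2d_pt_const.
  - apply continuity_2d_pt_mult; [apply HF | exact IH].
Qed.

Lemma moment_continuous (k : nat) :
  continuous_2d (fun a b => (a ^ 2 - 1) ^ k * b ^ 2).
Proof.
  intros p q. apply continuity_2d_pt_mult.
  - apply (continuous_2d_pow (fun a b => a ^ 2 - 1)). solve_continuous_2d.
  - apply (continuous_2d_pow (fun a b => b)). solve_continuous_2d.
Qed.

(** With [u = x^2 - 1] and [s = 1 + 4 h] the oval is [2 y^2 = s - u^2]. *)
Lemma oval_equation (a b h : R) :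
  Ham a b = h -> b ^ 2 = (1 + 4 * h - (a ^ 2 - 1) ^ 2) / 2.
Proof. intros <-. unfold Ham. field. Qed.

(** On an oval [y^2] is a polynomial in [u], so every integrand below reduces to
    a polynomial in [u] times [y^2], given by its list of coefficients. *)
Fixpoint horner (c : list R) (u : R) : R :=
  match c with nil => 0 | cons c0 c' => c0 + u * horner c' u end.

Fixpoint combine_moments (mu : nat -> R) (c : list R) (k : nat) : R :=
  match c with
  | nil => 0
  | cons c0 c' => c0 * mu k + combine_moments mu c' (S k)
  end.

Lemma horner_continuous (c : list R) (k : nat) :
  continuous_2d (fun a b => (a ^ 2 - 1) ^ k * horner c (a ^ 2 - 1) * b ^ 2).
Proof.
  assert (Hu : continuous_2d (fun a b => a ^ 2 - 1)) by solve_continuous_2d.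
  assert (Hc : continuous_2d (fun a b => horner c (a ^ 2 - 1))).
  { intros p q. induction c as [| c0 c IH]; simpl horner.
    - apply continuity_2d_pt_const.
    - apply continuity_2d_pt_plus; [apply continuity_2d_pt_const |].
      apply continuity_2d_pt_mult; [apply Hu | exact IH]. }
  intros p q. apply continuity_2d_pt_mult; [apply continuity_2d_pt_mult |].
  - now apply (continuous_2d_pow (fun a b => a ^ 2 - 1)).
  - apply Hc.
  - apply (continuous_2d_pow (fun a b => b)). solve_continuous_2d.
Qed.

Lemma loop_integral_horner (x y : R -> R) (T : R) (c : list R) (k : nat) :
  periodic_orbit x y T ->
  loop_integral (fun a b => (a ^ 2 - 1) ^ k * horner c (a ^ 2 - 1) * b ^ 2) x y T
  = combine_moments (moment x y T) c k.
Proof.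
  intros HP. revert k.
  induction c as [| c0 c IH]; intros k; cbn [horner combine_moments].
  - transitivity (0 * moment x y T k); [| ring]. unfold moment.
    rewrite <- loop_integral_scal; [| exact HP | apply moment_continuous].
    apply loop_integral_eq. intros a b. ring.
  - rewrite <- IH. unfold moment.
    rewrite <- loop_integral_scal; [| exact HP | apply moment_continuous].
    rewrite <- loop_integral_plus.
    + apply loop_integral_eq. intros a b. change ((a ^ 2 - 1) ^ S k) with ((a ^ 2 - 1) * (a ^ 2 - 1) ^ k). ring.
    + exact HP.
    + intros p q. apply continuity_2d_pt_mult;
        [apply continuity_2d_pt_const | apply moment_continuous].
    + apply horner_continuous.
Qed.

Lemma loop_integral_moments (F : R -> R -> R) (c : list R) (x y : R -> R) (T h : R) :
  periodic_orbit x y T -> (forall t, Ham (x t) (y t) = h) ->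
  (forall a b, Ham a b = h -> F a b = horner c (a ^ 2 - 1) * b ^ 2) ->
  loop_integral F x y T = combine_moments (moment x y T) c 0.
Proof.
  intros HP HH HF. rewrite <- loop_integral_horner by exact HP.
  apply (loop_integral_ext _ _ x y T h HH). intros a b Hab.
  rewrite (HF a b Hab), pow_O. ring.
Qed.

(** Integrating the derivative of [x u^k y^3] over the closed orbit. *)
Lemma moment_recursion (x y : R -> R) (T h : R) (k : nat) :
  periodic_orbit x y T -> (forall t, Ham (x t) (y t) = h) ->
  (INR k + 3) * moment x y T (S k) + (INR k + 7 / 2) * moment x y T (S (S k))
  = (1 + 4 * h) * (INR k * moment x y T (pred k) + (INR k + 1 / 2) * moment x y T k).
Proof.
  intros HP HH. set (mu := moment x y T).
  set (c1 := INR k). set (s := 1 + 4 * h).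
  assert (HC := moment_continuous).
  assert (E : loop_integral (fun a b =>
      s * c1 * ((a ^ 2 - 1) ^ pred k * b ^ 2)
      + (s * (c1 + 1 / 2) * ((a ^ 2 - 1) ^ k * b ^ 2)
      + (- (c1 + 3) * ((a ^ 2 - 1) ^ S k * b ^ 2)
      + - (c1 + 7 / 2) * ((a ^ 2 - 1) ^ S (S k) * b ^ 2)))) x y T = 0).
  { apply (loop_integral_exact (fun a b => a * (a ^ 2 - 1) ^ k * b ^ 3)).
    - exact HP.
    - intros p q. repeat apply continuity_2d_pt_plus;
        (apply continuity_2d_pt_mult; [apply continuity_2d_pt_const | apply HC]).
    - intros t. destruct HP as (_ & Hf & _). destruct (Hf t) as [Dx Dy].
      pose proof (oval_equation _ _ _ (HH t)) as Hy. fold s in Hy.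
      auto_derive; [derivability |].
      rewrite_derive Dx. rewrite_derive Dy. fold c1.
      assert (Hk : c1 * (x t ^ 2 - 1) ^ k
        = c1 * ((x t ^ 2 - 1) * (x t ^ 2 - 1) ^ pred k)).
      { unfold c1. destruct k; simpl; ring. }
      simpl (_ ^ S _). simpl (_ ^ 2) in Hy, Hk. rewrite !Rmult_1_r in *.
      change (x t * x t + - (1)) with (x t * x t - 1).
      set (u := x t * x t - 1) in *.
      assert (Hx : x t * x t = 1 + u) by (unfold u; ring).
      set (Q := u ^ k) in *. set (P := u ^ pred k) in *.
      set (Y := y t * y t) in *. clearbody u Q P.
      match goal with |- ?lhs = _ => transitivity
        (Y * (Y * Q + 2 * (x t * x t) * Y * (c1 * P)
         + 3 * (x t * x t) * (1 - x t * x t) * Q)) end.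
      { unfold Y. ring. }
      rewrite Hx.
      match goal with |- _ = ?rhs => transitivity
        (Y * (s * (c1 * P) + s / 2 * Q - 3 * u * Q - 7 / 2 * u * u * Q
         + (s - u - u * u) * (c1 * Q))) end; [| field].
      rewrite Hk. f_equal. rewrite Hy. field. }
  rewrite !loop_integral_plus in E; try exact HP; try apply HC;
    try (intros p q; repeat apply continuity_2d_pt_plus;
      (apply continuity_2d_pt_mult; [apply continuity_2d_pt_const | apply HC])).
  rewrite !loop_integral_scal in E; try exact HP; try apply HC.
  fold (moment x y T (pred k)) in E. fold (moment x y T k) in E.
  fold (moment x y T (S k)) in E. fold (moment x y T (S (S k))) in E.
  fold mu in E. lra.
Qed.
(** The derivative [y^2] of the partial integrals would vanish identically if
    the total did, and the orbit would be at rest. *)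
Lemma moment_0_pos (x y : R -> R) (T : R) :
  periodic_orbit x y T -> 0 < moment x y T 0.
Proof.
  intros HP. pose proof HP as (HT & Hf & _ & Hmin).
  set (I := fun t : R => RInt (fun s => y s ^ 2) 0 t : R).
  assert (Hc : forall t : R, continuous (fun s => y s ^ 2) t).
  { intros t. apply (flow_continuous_along (fun _ b => b ^ 2) x y); [| apply Hf].
    solve_continuous_2d. }
  assert (DI : forall t : R, is_derive I t (y t ^ 2)).
  { intros t. apply (is_derive_RInt (V := R_NormedModule) (fun s => y s ^ 2) I 0);
      [| apply Hc].
    apply filter_forall. intros b. apply (RInt_correct (V := R_CompleteNormedModule)).
    apply (ex_RInt_continuous (V := R_CompleteNormedModule)). intros z _. apply Hc. }
  assert (I0 : I 0 = 0) by apply (RInt_point (V := R_CompleteNormedModule)).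
  assert (Hmono : forall a b, a <= b -> I a <= I b).
  { intros a b Hab. destruct (mean_value I (fun t => y t ^ 2) a b Hab) as [c [_ E]].
    - intros t _. apply DI.
    - pose proof (pow2_ge_0 (y c)). nra. }
  replace (moment x y T 0) with (I T).
  2: { apply (RInt_ext (V := R_CompleteNormedModule)). intros t _. simpl. ring. }
  apply Rnot_le_lt. intros HI.
  assert (HIz : forall t, 0 < t < T -> I t = 0).
  { intros t Ht. pose proof (Hmono 0 t ltac:(lra)).
    pose proof (Hmono t T ltac:(lra)). lra. }
  assert (Hy : forall t, 0 < t < T -> y t = 0).
  { intros t Ht. assert (E : is_derive I t 0).
    { apply (is_derive_ext_loc (fun _ => 0)).
      - assert (Hd : 0 < Rmin t (T - t)) by (apply Rmin_glb_lt; lra).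
        exists (mkposreal _ Hd). intros s Hs.
        change (Rabs (s - t) < Rmin t (T - t)) in Hs.
        pose proof (Rmin_l t (T - t)). pose proof (Rmin_r t (T - t)).
        apply Rabs_def2 in Hs. symmetry. apply HIz. lra.
      - apply (is_derive_const (K := R_AbsRing) (V := R_NormedModule) 0). }
    apply is_derive_unique in E. pose proof (DI t) as E'.
    apply is_derive_unique in E'. rewrite E in E'.
    assert (y t * y t = 0) by (simpl in E'; lra).
    now destruct (Rmult_integral _ _ H). }
  apply (Hmin (T / 2)); [lra |].
  assert (Cy : y 0 = 0).
  { apply cond_eq. intros e He.
    destruct (continuity_pt_delta y 0 e (flow_continuity_y _ _ _ (Hf 0)) He)
      as [d [Hd H]].
    set (t := Rmin (d / 2) (T / 2)).
    assert (0 < t) by (unfold t; apply Rmin_glb_lt; lra).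
    assert (t <= d / 2) by apply Rmin_l. assert (t <= T / 2) by apply Rmin_r.
    specialize (H t ltac:(rewrite Rminus_0_r, Rabs_right; lra)).
    rewrite (Hy t) in H by lra. rewrite Rabs_minus_sym in H.
    exact H. }
  split; [| rewrite Cy; apply Hy; lra].
  destruct (mean_value x y 0 (T / 2)) as [c [Hc' E]].
  - lra.
  - intros t _. apply Hf.
  - assert (y c = 0) by (destruct (Req_dec c 0) as [-> | Hne]; [exact Cy | apply Hy; lra]).
    rewrite H in E. lra.
Qed.

(** On an oval [y^2 >= 0] and [x^2 >= 0] confine [u] to [u^2 <= s], [u >= -1]. *)
Lemma moment_le (x y : R -> R) (T h : R) (c c' : list R) :
  periodic_orbit x y T -> (forall t, Ham (x t) (y t) = h) ->
  (forall u, u ^ 2 <= 1 + 4 * h -> - 1 <= u -> horner c u <= horner c' u) ->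
  combine_moments (moment x y T) c 0 <= combine_moments (moment x y T) c' 0.
Proof.
  intros HP HH Hle. rewrite <- !loop_integral_horner by exact HP.
  apply (loop_integral_le _ _ x y T h HP); try apply horner_continuous.
  - exact HH.
  - intros a b Hab. rewrite !pow_O, !Rmult_1_l.
    pose proof (pow2_ge_0 b) as Hb. pose proof (pow2_ge_0 a).
    apply Rmult_le_compat_r; [exact Hb |].
    pose proof (oval_equation _ _ _ Hab). apply Hle; lra.
Qed.

Lemma linear_melnikov (l : nat -> R) (x y : R -> R) (T h : R) :
  periodic_orbit x y T -> (forall t, Ham (x t) (y t) = h) ->
  loop_integral (fun a b => damping l a b * b ^ 2) x y T
  = ((4/3 * l 6%nat + 320/231 * l 5%nat) * h
     + (32/21 * l 6%nat + 40/231 * l 5%nat + 8/7 * l 4%nat + 3/7 * l 3%nat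
        + l 2%nat)) * (moment x y T 0 + moment x y T 1)
    + (240/77 * l 5%nat * h^2
       + (16/21 * l 6%nat + 20/231 * l 5%nat + 4/7 * l 4%nat + 12/7 * l 3%nat) * h
       + l 1%nat) * moment x y T 0.
Proof.
  intros HP HH. set (s := 1 + 4 * h).
  rewrite (loop_integral_moments _ (cons
    (l 1%nat + l 2%nat + l 3%nat * s / 2 + l 4%nat + l 5%nat * s ^ 2 / 4 + l 6%nat)
    (cons (l 2%nat + 2 * l 4%nat + 3 * l 6%nat)
    (cons (- l 3%nat / 2 + l 4%nat - l 5%nat * s / 2 + 3 * l 6%nat)
    (cons (l 6%nat) (cons (l 5%nat / 4) nil))))) x y T h HP HH).
  - pose proof (moment_recursion x y T h 0 HP HH) as R0.
    pose proof (moment_recursion x y T h 1 HP HH) as R1.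
    pose proof (moment_recursion x y T h 2 HP HH) as R2.
    fold s in R0, R1, R2. cbn [combine_moments]. simpl INR in R0, R1, R2.
    simpl pred in R0, R1, R2.
    set (m0 := moment x y T 0) in *. set (m1 := moment x y T 1) in *.
    set (m2 := moment x y T 2) in *. set (m3 := moment x y T 3) in *.
    set (m4 := moment x y T 4) in *.
    assert (E2 : m2 = 2 / 7 * (s / 2 * m0 - 3 * m1)) by lra.
    assert (E3 : m3 = 2 / 9 * (s * (m0 + 3 / 2 * m1) - 4 * m2)) by lra.
    assert (E4 : m4 = 2 / 11 * (s * (2 * m1 + 5 / 2 * m2) - 5 * m3)) by lra.
    rewrite E4, E3, E2. unfold s. field.
  - intros a b Hab. pose proof (oval_equation _ _ _ Hab) as Hb. fold s in Hb.
    cbn [horner]. f_equal. unfold damping.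
    replace (b ^ 4) with ((b ^ 2) ^ 2) by ring. rewrite Hb. field.
Qed.

(** The factor [(3 x^2 + y^2 - 3 x^4) y] times the [y]-derivative of the second
    corrector of the energy: what is left of the null direction after two
    corrections. *)
Definition cubic_integrand (a b : R) : R :=
  (3 * a ^ 2 + b ^ 2 - 3 * a ^ 4) * b ^ 2
  * (6 * a ^ 2 * b ^ 2 + 3 / 2 * a ^ 4 - a ^ 6).

Lemma cubic_melnikov (x y : R -> R) (T h : R) :
  periodic_orbit x y T -> (forall t, Ham (x t) (y t) = h) ->
  loop_integral cubic_integrand x y T
  = - (8 / 1001 * ((308 * h^2 + 181 * h + 24) * (moment x y T 0 + moment x y T 1)
                   + (80 * h^2 + 12 * h) * moment x y T 0)).
Proof.
  intros HP HH. set (s := 1 + 4 * h).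
  rewrite (loop_integral_moments _ (cons (s / 2 * (3 * s + 1 / 2))
    (cons (3 / 2 * s ^ 2 - 3 * (3 * s + 1 / 2))
    (cons (- 9 / 4 * s - 9 * s - 7 / 2 * (3 * s + 1 / 2))
    (cons (- 2 * s + 27 / 2 - 21 / 2 * s)
    (cons (12 + 63 / 4) (cons 14 nil)))))) x y T h HP HH).
  - pose proof (moment_recursion x y T h 0 HP HH) as R0.
    pose proof (moment_recursion x y T h 1 HP HH) as R1.
    pose proof (moment_recursion x y T h 2 HP HH) as R2.
    pose proof (moment_recursion x y T h 3 HP HH) as R3.
    fold s in R0, R1, R2, R3. cbn [combine_moments].
    simpl INR in R0, R1, R2, R3. simpl pred in R0, R1, R2, R3.
    set (m0 := moment x y T 0) in *. set (m1 := moment x y T 1) in *.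
    set (m2 := moment x y T 2) in *. set (m3 := moment x y T 3) in *.
    set (m4 := moment x y T 4) in *. set (m5 := moment x y T 5) in *.
    assert (E2 : m2 = 2 / 7 * (s / 2 * m0 - 3 * m1)) by lra.
    assert (E3 : m3 = 2 / 9 * (s * (m0 + 3 / 2 * m1) - 4 * m2)) by lra.
    assert (E4 : m4 = 2 / 11 * (s * (2 * m1 + 5 / 2 * m2) - 5 * m3)) by lra.
    assert (E5 : m5 = 2 / 13 * (s * (3 * m2 + 7 / 2 * m3) - 6 * m4)) by lra.
    rewrite E5, E4, E3, E2. unfold s. field.
  - intros a b Hab. pose proof (oval_equation _ _ _ Hab) as Hb. fold s in Hb.
    cbn [horner]. unfold cubic_integrand. 
    match goal with |- ?p * b ^ 2 * ?q = ?r * b ^ 2 =>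
      transitivity (p * q * b ^ 2); [ring | f_equal] end.
    rewrite Hb. field.
Qed.

(** * Independence of the first two moments *)

(** The weights [w i] allow for terms that are not pure powers of [t] but only
    comparable to them, such as those containing [mu_1 / (z mu_0)] at infinity. *)
Fixpoint weighted_sum (c : list R) (w : nat -> R) (t : R) : R :=
  match c with
  | nil => 0
  | cons c0 c' => c0 * w 0%nat + t * weighted_sum c' (fun i => w (S i)) t
  end.

Lemma weighted_sum_bounded (c : list R) (b : R) :
  0 <= b -> exists B, 0 <= B /\ forall w t, 0 < t < 1 ->
    (forall i, 0 <= w i <= b) -> Rabs (weighted_sum c w t) <= B.
Proof.
  intros Hb. induction c as [| c0 c [B [HB IH]]]; simpl.
  - exists 0. split; [lra |]. intros. rewrite Rabs_R0. lra.
  - exists (Rabs c0 * b + B). pose proof (Rabs_pos c0).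
    split; [apply Rplus_le_le_0_compat; [now apply Rmult_le_pos | exact HB] |].
    intros w t Ht Hw.
    eapply Rle_trans; [apply Rabs_triang |]. apply Rplus_le_compat.
    + rewrite Rabs_mult. apply Rmult_le_compat_l; [exact H |].
      rewrite Rabs_right; [apply Hw | apply Rle_ge, Hw].
    + rewrite Rabs_mult, (Rabs_right t) by lra.
      specialize (IH (fun i => w (S i)) t Ht (fun i => Hw (S i))).
      pose proof (Rabs_pos (weighted_sum c (fun i => w (S i)) t)). nra.
Qed.

(** Coefficients are read off one order at a time as [t -> 0], because the
    weights stay between positive constants. *)
Lemma weighted_sum_coefficients (c : list R) (a b K d : R) (N : nat) :
  0 < a -> 0 < d -> 0 <= K ->
  (forall t, 0 < t < d -> exists w : nat -> R,
     (forall i, a <= w i <= b) /\ Rabs (weighted_sum c w t) <= K * t ^ N) ->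
  forall i, (i < N)%nat -> List.nth i c 0 = 0.
Proof.
  intros Ha Hd HK. revert N. induction c as [| c0 c IH]; intros N Hc i Hi.
  - now destruct i.
  - destruct N as [| N]; [lia |].
    assert (Hb : 0 <= b).
    { destruct (Hc (d / 2)) as [w [Hw _]]; [lra |]. specialize (Hw 0%nat). lra. }
    destruct (weighted_sum_bounded c b Hb) as [B [HB HBw]].
    assert (E0 : c0 = 0).
    { destruct (Req_dec c0 0) as [E | Hne]; [exact E | exfalso].
      apply Rabs_pos_lt in Hne.
      set (t := Rmin (Rmin (d / 2) (1 / 2)) (Rabs c0 * a / (2 * (K + B + 1)))).
      assert (Hpos : 0 < Rabs c0 * a / (2 * (K + B + 1))).
      { apply Rdiv_lt_0_compat; [now apply Rmult_lt_0_compat | lra]. }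
      assert (Ht : 0 < t) by (unfold t; repeat apply Rmin_glb_lt; lra).
      assert (Ht1 : t <= Rmin (d / 2) (1 / 2)) by apply Rmin_l.
      assert (Ht2 : t <= Rabs c0 * a / (2 * (K + B + 1))) by apply Rmin_r.
      pose proof (Rmin_l (d / 2) (1 / 2)). pose proof (Rmin_r (d / 2) (1 / 2)).
      destruct (Hc t) as [w [Hw HwK]]; [lra |]. simpl in HwK.
      set (S' := weighted_sum c (fun i => w (S i)) t) in HwK.
      assert (HS : Rabs S' <= B).
      { apply HBw; [lra |]. intros j. specialize (Hw (S j)). lra. }
      assert (HtN : 0 <= t ^ N <= 1).
      { split; [apply pow_le; lra |]. rewrite <- (pow1 N). apply pow_incr. lra. }
      assert (Hup : Rabs (c0 * w 0%nat) <= (K + B) * t).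
      { replace (c0 * w 0%nat) with (c0 * w 0%nat + t * S' - t * S') by ring.
        eapply Rle_trans; [apply Rabs_triang |].
        rewrite Rabs_Ropp, (Rabs_mult t), (Rabs_right t) by lra.
        assert (K * (t * t ^ N) <= K * t) by (apply Rmult_le_compat_l; nra).
        assert (t * Rabs S' <= t * B) by (apply Rmult_le_compat_l; lra).
        lra. }
      assert (Hlow : Rabs c0 * a <= Rabs (c0 * w 0%nat)).
      { rewrite Rabs_mult. specialize (Hw 0%nat).
        rewrite (Rabs_right (w 0%nat)) by lra.
        apply Rmult_le_compat_l; lra. }
      assert (Hmul : t * (2 * (K + B + 1)) <= Rabs c0 * a).
      { apply (Rmult_le_compat_r (2 * (K + B + 1))) in Ht2; [| lra].
        unfold Rdiv in Ht2. rewrite Rmult_assoc, Rinv_l, Rmult_1_r in Ht2 by lra.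
        exact Ht2. }
      nra. }
    destruct i as [| i]; [exact E0 |]. simpl.
    apply (IH N); [| lia]. intros t Ht.
    destruct (Hc t Ht) as [w [Hw HwK]].
    exists (fun j => w (S j)). split; [intros j; apply Hw |].
    simpl in HwK. rewrite E0, Rmult_0_l, Rplus_0_l, Rabs_mult in HwK.
    rewrite (Rabs_right t) in HwK by lra.
    apply (Rmult_le_reg_l t); [lra |]. lra.
Qed.

(** Solving the moment recursion forward expresses every moment through the
    first two, with coefficients polynomial in [s]. *)
Lemma moment_12 (mu : nat -> R) (s : R) :
  (forall k, (INR k + 3) * mu (S k) + (INR k + 7 / 2) * mu (S (S k))
     = s * (INR k * mu (pred k) + (INR k + 1 / 2) * mu k)) ->
  mu 12%nat
    = ((-1048576/2340135) + (-65536/264537) * s + (-553984/3187041) * s^2 + (-414016/3187041) * s^3 + (-38208/391391) * s^4 + (-370948/5311735) * s^5) * mu 1%nat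
      + ((-131072/2340135) * s + (-438272/10140585) * s^2 + (-542656/15935205) * s^3 + (-33424/1225785) * s^4 + (-73628/3380195) * s^5 + 221/14421 * s^6) * mu 0%nat.
Proof.
  intros Hrec.
  assert (E2 : mu 2%nat
    = ((-6/7)) * mu 1%nat
      + (1/7 * s) * mu 0%nat).
  { pose proof (Hrec 0%nat) as R; simpl INR in R; simpl pred in R.
    lra. }
  assert (E3 : mu 3%nat
    = (16/21 + 1/3 * s) * mu 1%nat
      + (2/21 * s) * mu 0%nat).
  { pose proof (Hrec 1%nat) as R; simpl INR in R; simpl pred in R.
    rewrite E2 in R. lra. }
  assert (E4 : mu 4%nat
    = ((-160/231) + (-76/231) * s) * mu 1%nat
      + ((-20/231) * s + 5/77 * s^2) * mu 0%nat).
  { pose proof (Hrec 2%nat) as R; simpl INR in R; simpl pred in R.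
    rewrite E3, E2 in R. lra. }
  assert (E5 : mu 5%nat
    = (640/1001 + 956/3003 * s + 7/39 * s^2) * mu 1%nat
      + (80/1001 * s + 172/3003 * s^2) * mu 0%nat).
  { pose proof (Hrec 3%nat) as R; simpl INR in R; simpl pred in R.
    rewrite E4, E3, E2 in R. lra. }
  assert (E6 : mu 6%nat
    = ((-256/429) + (-920/3003) * s + (-562/3003) * s^2) * mu 1%nat
      + ((-32/429) * s + (-164/3003) * s^2 + 3/77 * s^3) * mu 0%nat).
  { pose proof (Hrec 4%nat) as R; simpl INR in R; simpl pred in R.
    rewrite E5, E4, E3 in R. lra. }
  assert (E7 : mu 7%nat
    = (4096/7293 + 15040/51051 * s + 9628/51051 * s^2 + 77/663 * s^3) * mu 1%nat
      + (512/7293 * s + 888/17017 * s^2 + 1970/51051 * s^3) * mu 0%nat).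
  { pose proof (Hrec 5%nat) as R; simpl INR in R; simpl pred in R.
    rewrite E6, E5, E4 in R. lra. }
  assert (E8 : mu 8%nat
    = ((-24576/46189) + (-39296/138567) * s + (-181600/969969) * s^2 + (-120968/969969) * s^3) * mu 1%nat
      + ((-3072/46189) * s + (-6928/138567) * s^2 + (-36616/969969) * s^3 + 39/1463 * s^4) * mu 0%nat).
  { pose proof (Hrec 6%nat) as R; simpl INR in R; simpl pred in R.
    rewrite E7, E6, E5 in R. lra. }
  assert (E9 : mu 9%nat
    = (163840/323323 + 37888/138567 * s + 178960/969969 * s^2 + 124856/969969 * s^3 + 55/663 * s^4) * mu 1%nat
      + (20480/323323 * s + 512/10659 * s^2 + 11904/323323 * s^3 + 27304/969969 * s^4) * mu 0%nat).
  { pose proof (Hrec 7%nat) as R; simpl INR in R; simpl pred in R.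
    rewrite E8, E7, E6 in R. lra. }
  assert (E10 : mu 10%nat
    = ((-327680/676039) + (-280576/1062347) * s + (-577312/3187041) * s^2 + (-969040/7436429) * s^3 + (-2024270/22309287) * s^4) * mu 1%nat
      + ((-40960/676039) * s + (-49152/1062347) * s^2 + (-114320/3187041) * s^3 + (-624280/22309287) * s^4 + 663/33649 * s^5) * mu 0%nat).
  { pose proof (Hrec 8%nat) as R; simpl INR in R; simpl pred in R.
    rewrite E9, E8, E7 in R. lra. }
  assert (E11 : mu 11%nat
    = (1572864/3380195 + 1900544/7436429 * s + 2560/14421 * s^2 + 171280/1312311 * s^3 + 124856/1312311 * s^4 + 209/3315 * s^5) * mu 1%nat
      + (196608/3380195 * s + 1660928/37182145 * s^2 + 556832/15935205 * s^3 + 1028656/37182145 * s^4 + 2417398/111546435 * s^5) * mu 0%nat).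
  { pose proof (Hrec 9%nat) as R; simpl INR in R; simpl pred in R.
    rewrite E10, E9, E8 in R. lra. }
  assert (E12 : mu 12%nat
    = ((-1048576/2340135) + (-65536/264537) * s + (-553984/3187041) * s^2 + (-414016/3187041) * s^3 + (-38208/391391) * s^4 + (-370948/5311735) * s^5) * mu 1%nat
      + ((-131072/2340135) * s + (-438272/10140585) * s^2 + (-542656/15935205) * s^3 + (-33424/1225785) * s^4 + (-73628/3380195) * s^5 + 221/14421 * s^6) * mu 0%nat).
  { pose proof (Hrec 10%nat) as R; simpl INR in R; simpl pred in R.
    rewrite E11, E10, E9 in R. lra. }
  exact E12.
Qed.

(** Near the center ([s -> 0]): a relation [p mu_1 + q mu_0 = 0] turns
    [mu_12 = P mu_1 + Q mu_0] into [p mu_12 = (p Q - q P) mu_0], and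
    [mu_12 = O(s^6 mu_0)] forces the coefficients of [p Q - q P] of degree below
    6 to vanish: six independent equations for the six unknowns. *)
Lemma interior_independence (p0 p1 p2 q0 q1 q2 : R) :
  (forall s, 0 < s < 1 -> exists mu : nat -> R,
     0 < mu 0%nat /\ 0 <= mu 12%nat <= s ^ 6 * mu 0%nat /\
     (forall k, (INR k + 3) * mu (S k) + (INR k + 7 / 2) * mu (S (S k))
       = s * (INR k * mu (pred k) + (INR k + 1 / 2) * mu k)) /\
     (p0 + p1 * s + p2 * s ^ 2) * mu 1%nat
     + (q0 + q1 * s + q2 * s ^ 2) * mu 0%nat = 0) ->
  p0 = 0 /\ p1 = 0 /\ p2 = 0 /\ q0 = 0 /\ q1 = 0 /\ q2 = 0.
Proof.
  intros Hmu.
  set (c :=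
    (cons (- q0 * (-1048576/2340135))
    (cons (p0 * (-131072/2340135) - q0 * (-65536/264537) - q1 * (-1048576/2340135))
    (cons (p0 * (-438272/10140585) - q0 * (-553984/3187041) + p1 * (-131072/2340135) - q1 * (-65536/264537) - q2 * (-1048576/2340135))
    (cons (p0 * (-542656/15935205) - q0 * (-414016/3187041) + p1 * (-438272/10140585) - q1 * (-553984/3187041) + p2 * (-131072/2340135) - q2 * (-65536/264537))
    (cons (p0 * (-33424/1225785) - q0 * (-38208/391391) + p1 * (-542656/15935205) - q1 * (-414016/3187041) + p2 * (-438272/10140585) - q2 * (-553984/3187041))
    (cons (p0 * (-73628/3380195) - q0 * (-370948/5311735) + p1 * (-33424/1225785) - q1 * (-38208/391391) + p2 * (-542656/15935205) - q2 * (-414016/3187041))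
    (cons (p0 * (221/14421) + p1 * (-73628/3380195) - q1 * (-370948/5311735) + p2 * (-33424/1225785) - q2 * (-38208/391391))
    (cons (p1 * (221/14421) + p2 * (-73628/3380195) - q2 * (-370948/5311735))
    (cons (p2 * (221/14421))
    nil)))))))))).
  set (K := Rabs p0 + Rabs p1 + Rabs p2).
  assert (HK : 0 <= K).
  { unfold K. pose proof (Rabs_pos p0). pose proof (Rabs_pos p1).
    pose proof (Rabs_pos p2). lra. }
  assert (Hcoef : forall i, (i < 6)%nat -> List.nth i c 0 = 0).
  { apply (weighted_sum_coefficients c 1 1 K 1); try lra.
    intros s Hs. exists (fun _ => 1). split; [intros; lra |].
    destruct (Hmu s Hs) as (mu & H0 & H12 & Hrec & Hrel).
    pose proof (moment_12 mu s Hrec) as E.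
    set (m0 := mu 0%nat) in *. set (m1 := mu 1%nat) in *.
    set (m12 := mu 12%nat) in *.
    assert (Hkey : (p0 + p1 * s + p2 * s ^ 2) * m12
      = weighted_sum c (fun _ => 1) s * m0).
    { apply Rminus_diag_uniq.
      transitivity (((-1048576/2340135) + (-65536/264537) * s + (-553984/3187041) * s^2 + (-414016/3187041) * s^3 + (-38208/391391) * s^4 + (-370948/5311735) * s^5)
        * ((p0 + p1 * s + p2 * s ^ 2) * m1 + (q0 + q1 * s + q2 * s ^ 2) * m0)).
      - rewrite E. unfold c. cbn [weighted_sum]. field.
      - rewrite Hrel. ring. }
    apply (Rmult_le_reg_r m0); [exact H0 |].
    rewrite <- (Rabs_right m0) at 1 by lra. rewrite <- Rabs_mult, <- Hkey, Rabs_mult.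
    rewrite (Rabs_right m12) by lra.
    rewrite (Rmult_assoc K). apply Rmult_le_compat; [apply Rabs_pos | lra | | lra].
    unfold K. eapply Rle_trans; [apply Rabs_triang |].
    apply Rplus_le_compat.
    - eapply Rle_trans; [apply Rabs_triang |]. apply Rplus_le_compat; [lra |].
      rewrite Rabs_mult, (Rabs_right s) by lra. pose proof (Rabs_pos p1). nra.
    - rewrite Rabs_mult, (Rabs_right (s ^ 2)) by nra.
      assert (s ^ 2 <= 1) by nra. pose proof (Rabs_pos p2). nra. }
  pose proof (Hcoef 0%nat ltac:(lia)) as C0. pose proof (Hcoef 1%nat ltac:(lia)) as C1.
  pose proof (Hcoef 2%nat ltac:(lia)) as C2. pose proof (Hcoef 3%nat ltac:(lia)) as C3.
  pose proof (Hcoef 4%nat ltac:(lia)) as C4. pose proof (Hcoef 5%nat ltac:(lia)) as C5.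
  unfold c in C0, C1, C2, C3, C4, C5. simpl in C0, C1, C2, C3, C4, C5.
  repeat split; lra.
Qed.

(** Near infinity [mu_1 / mu_0] is comparable to [z = sqrt s], so the terms of
    the relation have the distinct orders [z^5, z^4, z^3, z^2, z, 1]. *)
Lemma exterior_independence (p0 p1 p2 q0 q1 q2 : R) :
  (forall z, 1 < z -> exists mu : nat -> R,
     0 < mu 0%nat /\ mu 1%nat <= z * mu 0%nat /\
     mu 2%nat <= z * mu 0%nat + (z - 1) * mu 1%nat /\
     3 * mu 1%nat + 7 / 2 * mu 2%nat = z ^ 2 / 2 * mu 0%nat /\
     (p0 + p1 * z ^ 2 + p2 * z ^ 4) * mu 1%nat
     + (q0 + q1 * z ^ 2 + q2 * z ^ 4) * mu 0%nat = 0) ->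
  p0 = 0 /\ p1 = 0 /\ p2 = 0 /\ q0 = 0 /\ q1 = 0 /\ q2 = 0.
Proof.
  intros Hmu.
  set (c := cons p2 (cons q2 (cons p1 (cons q1 (cons p0 (cons q0 nil)))))).
  assert (Hcoef : forall i, (i < 6)%nat -> List.nth i c 0 = 0).
  { apply (weighted_sum_coefficients c (1 / 14) 1 0 (1 / 14)); try lra.
    intros t Ht.
    assert (Hz : 14 < / t).
    { rewrite <- (Rinv_inv 14). apply Rinv_lt_contravar; [| lra].
      apply Rmult_lt_0_compat; [lra | apply Rinv_0_lt_compat; lra]. }
    destruct (Hmu (/ t)) as (mu & H0 & H1 & H2 & Hrec & Hrel); [lra |].
    set (z := / t) in *. assert (Ez : t * z = 1) by (unfold z; field; lra).
    set (m0 := mu 0%nat) in *. set (m1 := mu 1%nat) in *.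
    set (m2 := mu 2%nat) in *.
    set (m := t * (m1 / m0)).
    assert (Em : m1 = z * m * m0).
    { unfold m. replace (z * (t * (m1 / m0)) * m0) with (t * z * m1) by (field; lra).
      rewrite Ez. ring. }
    (* The recursion and the bound on [mu_2] give
       [(7 z - 1) mu_1 >= z (z - 7) mu_0], and [z - 7 >= z / 2] for [z >= 14]. *)
    assert (Hlow : z * m0 <= 14 * m1).
    { assert (7 * z * (z - 7) * m0 <= 49 * z * m1 - 7 * m1) by nra.
      assert (0 <= m1) by nra.
      assert (z * (z * m0) <= z * (14 * m1)) by nra.
      apply Rmult_le_reg_l with z; lra. }
    assert (Hm : 1 / 14 <= m <= 1).
    { rewrite Em in H1, Hlow. assert (0 < z * m0) by (apply Rmult_lt_0_compat; lra).
      split; apply Rmult_le_reg_r with (z * m0); lra. }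
    exists (fun i => if Nat.even i then m else 1). split.
    - intros i. destruct (Nat.even i); lra.
    - rewrite Rmult_0_l. right. unfold c. cbn [weighted_sum Nat.even].
      match goal with |- Rabs ?v = 0 => assert (E : v = 0); [| now rewrite E, Rabs_R0] end.
      apply (Rmult_eq_reg_r (z ^ 5 * m0)).
      2: { apply Rgt_not_eq, Rmult_lt_0_compat; [apply pow_lt; lra | exact H0]. }
      rewrite Rmult_0_l. rewrite Em in Hrel.
      etransitivity; [| exact Hrel].
      replace z with (/ t) by reflexivity. field. lra. }
  pose proof (Hcoef 0%nat ltac:(lia)). pose proof (Hcoef 1%nat ltac:(lia)).
  pose proof (Hcoef 2%nat ltac:(lia)). pose proof (Hcoef 3%nat ltac:(lia)).
  pose proof (Hcoef 4%nat ltac:(lia)). pose proof (Hcoef 5%nat ltac:(lia)).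
  now repeat split.
Qed.
Lemma moments_independent (A : annulus) (a0 a1 a2 b0 b1 b2 : R) :
  (forall h, energy A h -> exists x y T,
     periodic_orbit x y T /\ oval A h (x 0) (y 0) /\
     (a2 * h ^ 2 + a1 * h + a0) * (moment x y T 0 + moment x y T 1)
     + (b2 * h ^ 2 + b1 * h + b0) * moment x y T 0 = 0) ->
  a0 = 0 /\ a1 = 0 /\ a2 = 0 /\ b0 = 0 /\ b1 = 0 /\ b2 = 0.
Proof.
  intros Horb.
  assert (Hlevel : forall h x y T, periodic_orbit x y T ->
    oval A h (x 0) (y 0) -> forall t, Ham (x t) (y t) = h).
  { intros h x y T (_ & Hf & _) [HO _] t. rewrite <- HO.
    now apply Ham_conserved. }
  assert (Hgoal : a0 - a1 / 4 + a2 / 16 = 0 /\ a1 / 4 - a2 / 8 = 0 /\ a2 / 16 = 0 /\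
    (a0 + b0) - (a1 + b1) / 4 + (a2 + b2) / 16 = 0 /\
    (a1 + b1) / 4 - (a2 + b2) / 8 = 0 /\ (a2 + b2) / 16 = 0); [| lra].
  assert (Hcase : (forall h, - (1 / 4) < h < 0 -> energy A h) \/ A = exterior)
    by (destruct A; [left; now intros | left; now intros | now right]).
  destruct Hcase as [Hint | ->].
  - apply interior_independence. intros s Hs.
    destruct (Horb ((s - 1) / 4)) as (x & y & T & HP & HO & Hrel);
      [apply Hint; lra |].
    pose proof (Hlevel _ _ _ _ HP HO) as HH.
    assert (Es : 1 + 4 * ((s - 1) / 4) = s) by field.
    exists (moment x y T). split; [now apply moment_0_pos |]. split; [| split].
    + set (e12 := cons 0 (cons 0 (cons 0 (cons 0 (cons 0 (cons 0 (cons 0 (cons 0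
        (cons 0 (cons 0 (cons 0 (cons 0 (cons 1 nil))))))))))))).
      assert (E12 : forall u, horner e12 u = (u ^ 2) ^ 6)
        by (intros u; unfold e12; cbn [horner]; ring).
      pose proof (moment_le x y T _ nil e12 HP HH) as L1.
      pose proof (moment_le x y T _ e12 (cons (s ^ 6) nil) HP HH) as L2.
      rewrite Es in L1, L2.
      assert (Hsq : forall u, u ^ 2 <= s -> 0 <= (u ^ 2) ^ 6 <= s ^ 6).
      { intros u Hu. pose proof (pow2_ge_0 u).
        split; [now apply pow_le | now apply pow_incr]. }
      assert (L1' := L1 ltac:(intros u Hu _; rewrite E12; now apply Hsq)).
      assert (L2' := L2 ltac:(intros u Hu _; rewrite E12; cbn [horner];
        rewrite Rmult_0_r, Rplus_0_r; now apply Hsq)).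
      unfold e12 in L1', L2'. cbn [combine_moments] in L1', L2'. lra.
    + intros k. rewrite (moment_recursion x y T _ k HP HH), Es. reflexivity.
    + rewrite <- Hrel. field.
  - apply exterior_independence. intros z Hz.
    destruct (Horb ((z ^ 2 - 1) / 4)) as (x & y & T & HP & HO & Hrel);
      [simpl; nra |].
    pose proof (Hlevel _ _ _ _ HP HO) as HH.
    assert (Es : 1 + 4 * ((z ^ 2 - 1) / 4) = z ^ 2) by field.
    exists (moment x y T). split; [now apply moment_0_pos |].
    assert (Hsq : forall u, u ^ 2 <= z ^ 2 -> u <= z) by (intros u Hu; nra).
    split; [| split; [| split]].
    + pose proof (moment_le x y T _ (cons 0 (cons 1 nil)) (cons z nil) HP HH) as L1.
      rewrite Es in L1. cbn [combine_moments horner] in L1.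
      assert (L1' := L1 ltac:(intros u Hu _; specialize (Hsq u Hu); lra)). lra.
    + pose proof (moment_le x y T _ (cons 0 (cons 0 (cons 1 nil)))
        (cons z (cons (z - 1) nil)) HP HH) as L2.
      rewrite Es in L2. cbn [combine_moments horner] in L2.
      assert (L2' := L2 ltac:(intros u Hu Hu1; specialize (Hsq u Hu);
        assert (0 <= (z - u) * (u + 1)) by (apply Rmult_le_pos; lra); lra)).
      lra.
    + pose proof (moment_recursion x y T _ 0 HP HH) as R. rewrite Es in R.
      simpl INR in R. simpl pred in R. lra.
    + rewrite <- Hrel. field.
Qed.

(** * Limits along the arc *)

Lemma is_lim_mult_finite (f g : R -> R) (x : Rbar) (lf lg : R) :
  is_lim f x lf -> is_lim g x lg -> is_lim (fun t => f t * g t) x (lf * lg).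
Proof. intros Hf Hg. exact (is_lim_mult f g x lf lg Hf Hg I). Qed.

Lemma near_zero (P : R -> Prop) (r : R) :
  0 < r -> (forall e, e <> 0 -> Rabs e < r -> P e) -> Rbar_locally' 0 P.
Proof.
  intros Hr HP. exists (mkposreal r Hr). intros e He Hne. apply HP; [exact Hne |].
  change (Rabs (e - 0) < r) in He. now rewrite Rminus_0_r in He.
Qed.

Lemma leading_coefficient (a : nat -> R) (f : R -> R) (r : R) (n : nat) :
  0 < r -> (forall e : R, Rabs e < r -> is_pseries a e (f e)) ->
  (forall k, (k < n)%nat -> a k = 0) ->
  is_lim (fun e => f e / e ^ n) 0 (a n).
Proof.
  intros Hr Ha Hz.
  apply (is_lim_ext_loc (PSeries (PS_decr_n a n))).
  - apply (near_zero _ r Hr). intros e Hne He.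
    rewrite <- (is_pseries_unique _ _ _ (Ha e He)), (PSeries_decr_n_aux a n e Hz).
    field. now apply pow_nonzero.
  - replace (a n) with (PSeries (PS_decr_n a n) 0).
    2: { rewrite PSeries_0. unfold PS_decr_n. f_equal. lia. }
    apply is_lim_continuity, PSeries_continuity. rewrite Rabs_R0.
    apply (CV_radius_pos _ r Hr). intros e He.
    apply (ex_pseries_decr_n a n e).
    + destruct (Req_dec e 0) as [-> | Hne]; [now left | right].
      exists (/ e). now apply Rinv_l.
    + eexists. now apply Ha.
Qed.

Lemma finite_min_radius (P : nat -> R -> Prop) (N : nat) :
  (forall j, (1 <= j <= N)%nat -> exists r, 0 < r /\ forall e, Rabs e < r -> P j e) ->
  exists r, 0 < r /\ forall e, Rabs e < r -> forall j, (1 <= j <= N)%nat -> P j e.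
Proof.
  induction N as [| N IH]; intros HP.
  - exists 1. split; [lra |]. intros; lia.
  - destruct IH as [r1 [Hr1 H1]]; [intros; apply HP; lia |].
    destruct (HP (S N)) as [r2 [Hr2 H2]]; [lia |].
    exists (Rmin r1 r2). split; [now apply Rmin_glb_lt |].
    intros e He j Hj. pose proof (Rmin_l r1 r2). pose proof (Rmin_r r1 r2).
    destruct (Nat.eq_dec j (S N)) as [-> | Hne].
    + apply H2. lra.
    + apply H1; [lra | lia].
Qed.

Lemma arc_pseries (lam : nat -> nat -> R) :
  analytic_arc lam -> exists r, 0 < r /\ forall e : R, Rabs e < r ->
    forall j, (1 <= j <= 6)%nat -> is_pseries (lam j) e (arc lam e j).
Proof.
  intros Hl. apply (finite_min_radius (fun j e => is_pseries (lam j) e (arc lam e j))).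
  intros j Hj. destruct (Hl j Hj) as [_ Hcv].
  assert (Hr : exists r, 0 < r /\ Rbar_le r (CV_radius (lam j))).
  { destruct (CV_radius (lam j)) as [c | |].
    - exists c. split; [exact Hcv | apply Rle_refl].
    - exists 1. split; [lra | exact I].
    - contradiction. }
  destruct Hr as [r [Hr Hle]]. exists r. split; [exact Hr |]. intros e He.
  apply PSeries_correct, CV_radius_inside.
  now apply Rbar_lt_le_trans with r.
Qed.

Lemma arc_zero (lam : nat -> nat -> R) (j : nat) :
  analytic_arc lam -> (1 <= j <= 6)%nat -> arc lam 0 j = 0.
Proof. intros Hl Hj. unfold arc. rewrite PSeries_0. now apply Hl. Qed.

Lemma arc_small (lam : nat -> nat -> R) (rho : R) :
  analytic_arc lam -> 0 < rho ->
  exists r, 0 < r /\ forall e, Rabs e < r ->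
    forall j, (1 <= j <= 6)%nat -> Rabs (arc lam e j) <= rho.
Proof.
  intros Hl Hrho. apply (finite_min_radius (fun j e => Rabs (arc lam e j) <= rho)).
  intros j Hj. destruct (Hl j Hj) as [_ Hcv].
  destruct (continuity_pt_delta (PSeries (lam j)) 0 rho) as [d [Hd H]].
  - apply PSeries_continuity. rewrite Rabs_R0. exact Hcv.
  - exact Hrho.
  - exists d. split; [exact Hd |]. intros e He. left.
    specialize (H e). rewrite Rminus_0_r in H. specialize (H He).
    pose proof (arc_zero lam j Hl Hj) as E. unfold arc in *.
    rewrite E, Rminus_0_r in H. exact H.
Qed.

(** The displacement vanishes at [eps = 0], so its series starts at order 1. *)
Definition shifted_series (M : nat -> R -> R) (h : R) (k : nat) : R :=
  match k with O => 0 | _ => M k h end.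

Lemma displacement_pseries (A : annulus) (P : R -> R -> R) (M : nat -> R -> R) (h : R) :
  displacement_expansion A P M -> energy A h ->
  exists r, 0 < r /\ forall e : R, Rabs e < r ->
    is_pseries (shifted_series M h) e (displacement P h e).
Proof.
  intros HM Hh. destruct (HM h Hh) as [r [Hr H]]. exists r. split; [exact Hr |].
  intros e He. apply is_pseries_R. apply is_series_decr_1.
  simpl shifted_series at 2. rewrite Rmult_0_l.
  match goal with |- is_series _ ?v => replace v with (displacement P h e) end.
  - now apply H.
  - unfold plus, opp. simpl. ring.
Qed.

Lemma solution_ext (l l' : nat -> R) (x y : R -> R) (T : R) :
  (forall j, (1 <= j <= 6)%nat -> l j = l' j) ->
  solution l x y T -> solution l' x y T.
Proof.
  intros Hl Hs t Ht. destruct (Hs t Ht) as [Hx Hy]. split; [exact Hx |].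
  unfold damping in *. rewrite <- !Hl by lia. exact Hy.
Qed.

(** The orbit of [X_0] through the section point is the return orbit at
    [eps = 0]. *)
Lemma unperturbed_orbit (A : annulus) (lam : nat -> nat -> R) (sx sy : R -> R)
  (P : R -> R -> R) (M : nat -> R -> R) (h : R) :
  analytic_arc lam -> return_map A sx sy lam P -> displacement_expansion A P M ->
  energy A h ->
  exists x y T, periodic_orbit x y T /\ x 0 = sx h /\ y 0 = sy h.
Proof.
  intros Hl HP HM Hh.
  destruct (displacement_pseries A P M h HM Hh) as [r [Hr Hd]].
  assert (E : P h 0 = h).
  { pose proof (is_pseries_unique _ _ _ (Hd 0 ltac:(rewrite Rabs_R0; lra))) as E.
    rewrite PSeries_0 in E. unfold displacement in E. simpl in E. lra. }
  destruct (HP h Hh) as [r0 [Hr0 H0]].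
  destruct (H0 0) as (Hp & x & y & T & HT & Hs & E1 & E2 & E3 & E4 & Hmin);
    [rewrite Rabs_R0; lra |].
  rewrite E in E3, E4.
  destruct (closed_solution_extends x y T HT) as (X & Y & PX & HX).
  - apply (solution_ext (arc lam 0)); [| exact Hs].
    intros j Hj. now apply arc_zero.
  - congruence.
  - congruence.
  - intros t Ht. rewrite E1, E2. now apply Hmin.
  - exists X, Y, T. split; [exact PX |]. destruct (HX 0) as [-> ->]; [lra |].
    now split.
Qed.

Lemma RInt_increment_bound (f : R -> R) (a b m : R) :
  (forall t : R, continuous f t) ->
  (forall t, Rmin a b <= t <= Rmax a b -> Rabs (f t) <= m) ->
  Rabs (RInt f 0 b - RInt f 0 a) <= m * Rabs (b - a).
Proof.
  intros Hc Hb.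
  assert (Hex : forall c d, ex_RInt f c d).
  { intros c d. apply (ex_RInt_continuous (V := R_CompleteNormedModule)).
    intros t _. apply Hc. }
  pose proof (RInt_Chasles (V := R_CompleteNormedModule) f 0 a b (Hex _ _) (Hex _ _))
    as E. unfold plus in E. simpl in E.
  replace (RInt f 0 b - RInt f 0 a) with (RInt f a b) by lra.
  destruct (Rle_lt_dec a b) as [Hle | Hlt].
  - rewrite (Rabs_right (b - a)), Rmult_comm by lra.
    apply abs_RInt_le_const; [exact Hle | apply Hex |].
    intros t Ht. apply Hb. rewrite Rmin_left, Rmax_right; lra.
  - rewrite <- (opp_RInt_swap (V := R_CompleteNormedModule)) by apply Hex.
    unfold opp. simpl. rewrite Rabs_Ropp, (Rabs_left (b - a)), Rmult_comm by lra.
    replace (- (b - a)) with (a - b) by ring.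
    apply abs_RInt_le_const; [lra | apply Hex |].
    intros t Ht. apply Hb. rewrite Rmin_right, Rmax_left; lra.
Qed.

Lemma solution_continuous_along (l : nat -> R) (F : R -> R -> R) (x y : R -> R)
  (T t : R) :
  continuous_2d F -> solution l x y T -> 0 <= t <= T ->
  continuous (fun s => F (x s) (y s)) t.
Proof.
  intros HF Hs Ht. destruct (solution_derive _ _ _ _ _ Hs Ht) as [Dx Dy].
  apply continuous_along; [exact HF | |]; eapply is_derive_continuity_pt; eassumption.
Qed.

Lemma solution_ex_RInt (l : nat -> R) (F : R -> R -> R) (x y : R -> R) (T : R) :
  continuous_2d F -> 0 <= T -> solution l x y T ->
  ex_RInt (fun t => F (x t) (y t)) 0 T.
Proof.
  intros HF HT Hs. apply (ex_RInt_continuous (V := R_CompleteNormedModule)).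
  intros t Ht. rewrite Rmin_left, Rmax_right in Ht by lra.
  now apply (solution_continuous_along l F x y T).
Qed.

(** The integrands are uniformly close on the common time interval, and the
    discrepancy of the periods contributes [O(|T - T0|)]. *)
Lemma return_integral_close (A : annulus) (sx sy x0 y0 : R -> R) (h T0 : R)
  (F : R -> R -> R) (eta : R) :
  cross_section A sx sy -> energy A h -> periodic_orbit x0 y0 T0 ->
  x0 0 = sx h -> y0 0 = sy h -> continuous_2d F -> 0 < eta ->
  exists rho, 0 < rho /\
  forall (l : nat -> R) (p : R) (x y : R -> R) (T : R),
    (forall j, (1 <= j <= 6)%nat -> Rabs (l j) <= rho) ->
    return_orbit A sx sy l h p x y T ->
    Rabs (loop_integral F x y T - loop_integral F x0 y0 T0) < eta.
Proof.
  intros Hsec Hh HP Ex Ey HF Heta. pose proof HP as [HT0 [Hf _]].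
  destruct (flow_bounded x0 y0 (T0 + 1)) as [B [HB HB0]];
    [lra | intros; apply Hf |].
  assert (Hc0 : forall t : R, continuous (fun s => F (x0 s) (y0 s)) t)
    by (intros t; now apply flow_continuous_along).
  destruct (continuity_ab_maj (fun t => Rabs (F (x0 t) (y0 t))) 0 (T0 + 1))
    as [tm [Hm _]].
  { lra. }
  { intros t _. apply (continuity_pt_comp (fun t => F (x0 t) (y0 t)) Rabs).
    - apply continuity_pt_filterlim, Hc0.
    - apply Rcontinuity_abs. }
  set (m := Rabs (F (x0 tm) (y0 tm))) in Hm.
  assert (Hm0 : 0 <= m) by apply Rabs_pos.
  assert (He : 0 < eta / (4 * (T0 + 1))) by (apply Rdiv_lt_0_compat; lra).
  destruct (uniform_continuity_2d F (- (B + 1)) (B + 1) (- (B + 1)) (B + 1))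
    with (eps := mkposreal _ He) as [d Hd]; [intros; apply HF |].
  simpl in Hd.
  set (eta1 := Rmin (Rmin d 1) (eta / (2 * (m + 1)))).
  assert (Heta1 : 0 < eta1 /\ eta1 <= d /\ eta1 <= 1 /\ eta1 <= eta / (2 * (m + 1))).
  { unfold eta1. pose proof (Rmin_l (Rmin d 1) (eta / (2 * (m + 1)))).
    pose proof (Rmin_r (Rmin d 1) (eta / (2 * (m + 1)))).
    pose proof (Rmin_l d 1). pose proof (Rmin_r d 1). pose proof (cond_pos d).
    assert (0 < eta / (2 * (m + 1))) by (apply Rdiv_lt_0_compat; lra).
    split; [repeat apply Rmin_glb_lt; lra | lra]. }
  destruct (first_return_close A sx sy x0 y0 h T0 eta1) as [rho [Hrho Hclose]];
    try assumption; [lra |].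
  exists rho. split; [exact Hrho |]. intros l p x y T Hl Hret.
  destruct (Hclose l p x y T Hl Hret) as [HT HC].
  destruct Hret as (_ & HTpos & Hs & _).
  apply Rabs_def2 in HT.
  assert (D1 : Rabs (loop_integral F x y T - loop_integral F x0 y0 T)
    <= T * (eta / (4 * (T0 + 1)))).
  { unfold loop_integral.
    assert (X1 : ex_RInt (fun t => F (x t) (y t)) 0 T)
      by (apply (solution_ex_RInt l); [exact HF | lra | exact Hs]).
    assert (X2 : ex_RInt (fun t => F (x0 t) (y0 t)) 0 T)
      by (apply (loop_ex_RInt F x0 y0 T0); assumption).
    pose proof (RInt_minus (V := R_CompleteNormedModule) _ _ 0 T X1 X2) as E.
    unfold minus, plus, opp in E. simpl in E.
    unfold Rminus. rewrite <- E. rewrite <- (Rminus_0_r T) at 2.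
    apply abs_RInt_le_const.
    - lra.
    - apply (ex_RInt_minus (V := R_NormedModule) _ _ 0 T X1 X2).
    - intros t Ht. destruct (HC t Ht) as [C1 C2].
      destruct (HB0 t) as [B1 B2]; [lra |].
      apply Rabs_le_between in B1, B2.
      pose proof C1 as C1'. pose proof C2 as C2'. apply Rabs_def2 in C1', C2'.
      left. apply Hd; lra. }
  assert (D2 : Rabs (loop_integral F x0 y0 T - loop_integral F x0 y0 T0)
    <= m * Rabs (T - T0)).
  { apply RInt_increment_bound; [exact Hc0 |]. intros t Ht. apply Hm.
    unfold Rmin, Rmax in Ht. destruct (Rle_dec T0 T); lra. }
  assert (D1' : T * (eta / (4 * (T0 + 1))) <= eta / 4).
  { replace (eta / 4) with ((T0 + 1) * (eta / (4 * (T0 + 1)))) by (field; lra).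
    apply Rmult_le_compat_r; lra. }
  assert (D2' : m * Rabs (T - T0) <= eta / 2).
  { assert (Rabs (T - T0) <= eta / (2 * (m + 1))) by (apply Rabs_le; lra).
    apply Rle_trans with (m * (eta / (2 * (m + 1)))).
    - now apply Rmult_le_compat_l.
    - replace (m * (eta / (2 * (m + 1)))) with (eta / 2 * (m / (m + 1)))
        by (field; lra).
      rewrite <- (Rmult_1_r (eta / 2)) at 2. apply Rmult_le_compat_l; [lra |].
      apply Rmult_le_reg_r with (m + 1); [lra |].
      unfold Rdiv. rewrite Rmult_assoc, Rinv_l by lra. lra. }
  pose proof (Rabs_triang (loop_integral F x y T - loop_integral F x0 y0 T)
    (loop_integral F x0 y0 T - loop_integral F x0 y0 T0)) as Htri.
  replace (loop_integral F x y T - loop_integral F x0 y0 T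
    + (loop_integral F x0 y0 T - loop_integral F x0 y0 T0))
    with (loop_integral F x y T - loop_integral F x0 y0 T0) in Htri by ring.
  lra.
Qed.

(** * The corrected energy *)

(** The direction of parameters along which the linear part vanishes:
    [3 x^2 + y^2 - 3 x^4]. *)
Definition null_direction (j : nat) : R :=
  match j with 2%nat => 3 | 3%nat => 1 | 4%nat => - 3 | _ => 0 end.

Definition residual (l : nat -> R) (j : nat) : R := l j - l 3%nat * null_direction j.

Lemma damping_split (l : nat -> R) (a b : R) :
  damping l a b
  = l 3%nat * (3 * a ^ 2 + b ^ 2 - 3 * a ^ 4) + damping (residual l) a b.
Proof. unfold damping, residual, null_direction. ring. Qed.

Definition first_corrector (a b : R) : R := - (a * b ^ 3).
(** The terms after the first are [2 H g + k] with [g' = x^3 - x^5] and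
    [k' = g' (x^2 - x^4 / 2)]: a primitive of [(x^3 - x^5) y^2 dx] once [y^2] is
    eliminated by [y^2 = 2 H + x^2 - x^4 / 2]. *)
Definition second_corrector (a b : R) : R :=
  3 * (a ^ 2 * b ^ 4 / 2 + 2 * Ham a b * (a ^ 4 / 4 - a ^ 6 / 6)
       + a ^ 6 / 6 - 3 / 16 * a ^ 8 + a ^ 10 / 20).

(** Along [X_l] the corrected energy varies only through the residual
    parameters and the cube of [c = l 3].  The correctors are primitives:
    [X_0 (x y^3) = (3 x^2 + y^2 - 3 x^4) y^2], and then
    [X_0 second_corrector = 3 x y^3 (3 x^2 + y^2 - 3 x^4)], the terms of order
    [c] and [c^2] produced by the null direction. *)
Lemma corrected_energy_derive (l : nat -> R) (x y : R -> R) (T t : R) :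
  solution l x y T -> 0 <= t <= T ->
  let c := l 3%nat in
  is_derive (fun s => Ham (x s) (y s) + c * first_corrector (x s) (y s)
                      + c ^ 2 * second_corrector (x s) (y s)) t
    (c ^ 3 * cubic_integrand (x t) (y t)
     + damping (residual l) (x t) (y t) * y t ^ 2
     + (- 3 * c) * (damping (residual l) (x t) (y t) * (x t * y t ^ 3))
     + c ^ 2 * (damping (residual l) (x t) (y t)
                * (6 * x t ^ 2 * y t ^ 4
                   + 6 * y t ^ 2 * (x t ^ 4 / 4 - x t ^ 6 / 6)))).
Proof.
  intros Hs Ht c. destruct (solution_derive _ _ _ _ _ Hs Ht) as [Dx Dy].
  rewrite damping_split in Dy. fold c in Dy.
  set (r := damping (residual l) (x t) (y t)) in *. clearbody r.
  unfold first_corrector, second_corrector, Ham. auto_derive; [derivability |].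
  rewrite_derive Dx. rewrite_derive Dy. unfold cubic_integrand. field.
Qed.

Definition monomial (j : nat) (a b : R) : R :=
  match j with
  | 1%nat => 1 | 2%nat => a ^ 2 | 3%nat => b ^ 2 | 4%nat => a ^ 4
  | 5%nat => b ^ 4 | _ => a ^ 6
  end.

Definition pairing (l m : nat -> R) : R :=
  l 1%nat * m 1%nat + l 2%nat * m 2%nat + l 3%nat * m 3%nat + l 4%nat * m 4%nat
  + l 5%nat * m 5%nat + l 6%nat * m 6%nat.

Lemma monomial_continuous (j : nat) (G : R -> R -> R) :
  continuous_2d G -> continuous_2d (fun a b => monomial j a b * G a b).
Proof.
  intros HG p q. apply continuity_2d_pt_mult; [| apply HG].
  destruct j as [| [| [| [| [| [| j]]]]]]; simpl monomial;
    revert p q; solve_continuous_2d.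
Qed.

Lemma damping_integral (l l' : nat -> R) (G : R -> R -> R) (x y : R -> R) (T : R) :
  continuous_2d G -> 0 <= T -> solution l' x y T ->
  is_RInt (fun t => damping l (x t) (y t) * G (x t) (y t)) 0 T
    (pairing l (fun j => loop_integral (fun a b => monomial j a b * G a b) x y T)).
Proof.
  intros HG HT Hs.
  assert (HI : forall j, is_RInt (fun t => l j * (monomial j (x t) (y t) * G (x t) (y t)))
    0 T (l j * loop_integral (fun a b => monomial j a b * G a b) x y T)).
  { intros j. apply (is_RInt_scal (V := R_NormedModule)
      (fun t => monomial j (x t) (y t) * G (x t) (y t)) 0 T (l j)).
    apply (RInt_correct (V := R_CompleteNormedModule)).
    apply (solution_ex_RInt l' (fun a b => monomial j a b * G a b));
      [now apply monomial_continuous | exact HT | exact Hs]. }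
  unfold pairing.
  pose proof (is_RInt_plus (V := R_NormedModule) _ _ _ _ _ _
    (is_RInt_plus (V := R_NormedModule) _ _ _ _ _ _
    (is_RInt_plus (V := R_NormedModule) _ _ _ _ _ _
    (is_RInt_plus (V := R_NormedModule) _ _ _ _ _ _
    (is_RInt_plus (V := R_NormedModule) _ _ _ _ _ _
      (HI 1%nat) (HI 2%nat)) (HI 3%nat)) (HI 4%nat)) (HI 5%nat)) (HI 6%nat)) as H.
  refine (is_RInt_ext _ _ _ _ _ _ H).
  intros t _. unfold plus. simpl. unfold damping. ring.
Qed.

Lemma return_energy_balance (A : annulus) (sx sy : R -> R) (l : nat -> R) (h p : R)
  (x y : R -> R) (T : R) :
  cross_section A sx sy -> energy A h -> return_orbit A sx sy l h p x y T ->
  let c := l 3%nat in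
  let int := fun F => loop_integral F x y T in
  let A1 := fun q => first_corrector (sx q) (sy q) in
  let A2 := fun q => second_corrector (sx q) (sy q) in
  (p - h) + c * (A1 p - A1 h) + c ^ 2 * (A2 p - A2 h)
  = c ^ 3 * int cubic_integrand
    + pairing (residual l) (fun j => int (fun a b => monomial j a b * b ^ 2))
    + (- 3 * c) * pairing (residual l)
        (fun j => int (fun a b => monomial j a b * (a * b ^ 3)))
    + c ^ 2 * pairing (residual l)
        (fun j => int (fun a b => monomial j a b
           * (6 * a ^ 2 * b ^ 4 + 6 * b ^ 2 * (a ^ 4 / 4 - a ^ 6 / 6)))).
Proof.
  intros Hsec Hh (Hp & HT & Hs & E1 & E2 & E3 & E4 & _) c int A1 A2.
  assert (HF : forall F, continuous_2d F -> forall t : R, 0 <= t <= T ->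
    continuous (fun s => F (x s) (y s)) t)
    by (intros; now apply (solution_continuous_along l _ x y T)).
  assert (G1 : continuous_2d (fun _ b => b ^ 2)) by solve_continuous_2d.
  assert (G2 : continuous_2d (fun a b => a * b ^ 3)) by solve_continuous_2d.
  assert (G3 : continuous_2d (fun a b =>
    6 * a ^ 2 * b ^ 4 + 6 * b ^ 2 * (a ^ 4 / 4 - a ^ 6 / 6)))
    by (unfold Rdiv; solve_continuous_2d).
  assert (G0 : continuous_2d cubic_integrand)
    by (unfold cubic_integrand; solve_continuous_2d).
  assert (GD : continuous_2d (damping (residual l)))
    by (unfold damping; solve_continuous_2d).
  assert (I0 : is_RInt (fun t => cubic_integrand (x t) (y t)) 0 T (int cubic_integrand)).
  { apply (RInt_correct (V := R_CompleteNormedModule)).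
    apply (solution_ex_RInt l); [exact G0 | lra | exact Hs]. }
  pose proof (damping_integral (residual l) l _ x y T G1 ltac:(lra) Hs) as I1.
  pose proof (damping_integral (residual l) l _ x y T G2 ltac:(lra) Hs) as I2.
  pose proof (damping_integral (residual l) l _ x y T G3 ltac:(lra) Hs) as I3.
  cbv beta in I1, I2, I3.
  apply (is_RInt_scal (V := R_NormedModule) _ _ _ (c ^ 3)) in I0.
  apply (is_RInt_scal (V := R_NormedModule) _ _ _ (- 3 * c)) in I2.
  apply (is_RInt_scal (V := R_NormedModule) _ _ _ (c ^ 2)) in I3.
  pose proof (is_RInt_plus (V := R_NormedModule) _ _ _ _ _ _
    (is_RInt_plus (V := R_NormedModule) _ _ _ _ _ _
      (is_RInt_plus (V := R_NormedModule) _ _ _ _ _ _ I0 I1) I2) I3) as IR.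
  assert (IL := is_RInt_derive (V := R_CompleteNormedModule)
    (fun s => Ham (x s) (y s) + c * first_corrector (x s) (y s)
              + c ^ 2 * second_corrector (x s) (y s)) _ 0 T
    (fun t Ht => corrected_energy_derive l x y T t Hs
       ltac:(rewrite Rmin_left, Rmax_right in Ht by lra; exact Ht))).
  fold c in IL.
  destruct (Hsec h Hh) as [_ [_ [Hh1 _]]]. destruct (Hsec p Hp) as [_ [_ [Hp1 _]]].
  assert (IL' : is_RInt (fun t => c ^ 3 * cubic_integrand (x t) (y t)
     + damping (residual l) (x t) (y t) * y t ^ 2
     + (- 3 * c) * (damping (residual l) (x t) (y t) * (x t * y t ^ 3))
     + c ^ 2 * (damping (residual l) (x t) (y t)
                * (6 * x t ^ 2 * y t ^ 4
                   + 6 * y t ^ 2 * (x t ^ 4 / 4 - x t ^ 6 / 6)))) 0 T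
     ((p - h) + c * (A1 p - A1 h) + c ^ 2 * (A2 p - A2 h))).
  { eapply eq_rect.
    - apply IL. intros t Ht. rewrite Rmin_left, Rmax_right in Ht by lra.
      apply (HF (fun a b => c ^ 3 * cubic_integrand a b
        + damping (residual l) a b * b ^ 2
        + (- 3 * c) * (damping (residual l) a b * (a * b ^ 3))
        + c ^ 2 * (damping (residual l) a b
          * (6 * a ^ 2 * b ^ 4 + 6 * b ^ 2 * (a ^ 4 / 4 - a ^ 6 / 6))))); [| exact Ht].
      intros u v.
      repeat first [ apply G0 | apply GD | apply G1 | apply G2 | apply G3
        | apply continuity_2d_pt_const | apply continuity_2d_pt_plus
        | apply continuity_2d_pt_mult ].
    - rewrite E1, E2, E3, E4, Hh1, Hp1.
      unfold A1, A2, minus, plus, opp. simpl. ring. }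
  rewrite <- (is_RInt_unique _ _ _ _ IL'). apply is_RInt_unique.
  exact IR.
Qed.

(** * The first nonzero coefficient of the displacement *)

Lemma is_lim_pairing (l m : R -> nat -> R) (l0 m0 : nat -> R) :
  (forall j, (1 <= j <= 6)%nat -> is_lim (fun e => l e j) 0 (l0 j)) ->
  (forall j, (1 <= j <= 6)%nat -> is_lim (fun e => m e j) 0 (m0 j)) ->
  is_lim (fun e => pairing (l e) (m e)) 0 (pairing l0 m0).
Proof.
  intros Hl Hm. unfold pairing.
  apply is_lim_plus'; [apply is_lim_plus'; [apply is_lim_plus';
    [apply is_lim_plus'; [apply is_lim_plus' |] |] |] |];
    apply is_lim_mult_finite; (apply Hl || apply Hm); lia.
Qed.

Lemma is_lim_pow_zero (n : nat) : (1 <= n)%nat -> is_lim (fun e => e ^ n) 0 0.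
Proof.
  intros Hn. replace (Finite 0) with (Finite (0 ^ n)) at 2.
  - apply is_lim_continuity, derivable_continuous_pt, derivable_pt_pow.
  - rewrite pow_ne_zero; [reflexivity | lia].
Qed.

(** Boundary terms: a function of the endpoint changes by
    [O(|p - h|) = O(eps^n)], and its coefficient tends to 0. *)
Lemma boundary_term_negligible (f p c : R -> R) (h D : R) (n : nat) :
  (1 <= n)%nat -> ex_derive f h ->
  is_lim (fun e => (p e - h) / e ^ n) 0 D -> is_lim c 0 0 ->
  is_lim (fun e => c e * ((f (p e) - f h) / e ^ n)) 0 0.
Proof.
  intros Hn Hf Hp Hc.
  destruct (derivable_lipschitz_at f h Hf) as (K & d & HK & Hd & HL).
  assert (Hp0 : is_lim (fun e => p e - h) 0 0).
  { apply (is_lim_ext_loc (fun e => (p e - h) / e ^ n * e ^ n)).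
    - apply (near_zero _ 1 Rlt_0_1). intros e He _. field. now apply pow_nonzero.
    - replace 0 with (D * 0) at 2 by ring.
      apply is_lim_mult_finite; [exact Hp | now apply is_lim_pow_zero]. }
  assert (Hlim : is_lim (fun e => c e * (K * ((p e - h) / e ^ n))) 0 0).
  { replace 0 with (0 * (K * D)) at 2 by ring.
    apply is_lim_mult_finite; [exact Hc |].
    apply is_lim_mult_finite; [apply is_lim_const | exact Hp]. }
  apply is_lim_spec in Hlim. apply is_lim_spec in Hp0. apply is_lim_spec.
  intros eps. specialize (Hlim eps). specialize (Hp0 (mkposreal d Hd)).
  simpl in Hp0. generalize (filter_and _ _ Hlim Hp0). apply filter_imp.
  intros e [H1 H2]. rewrite Rminus_0_r in H1, H2. rewrite Rminus_0_r.
  eapply Rle_lt_trans; [| exact H1].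
  unfold Rdiv. rewrite !Rabs_mult. apply Rmult_le_compat_l; [apply Rabs_pos |].
  rewrite (Rabs_right K), <- Rmult_assoc by lra.
  apply Rmult_le_compat_r; [apply Rabs_pos | now apply HL].
Qed.

(** What the vanishing of the lower coefficients of the displacement imposes on
    the arc, up to order [n]: it follows the null direction, and its speed
    [lambda_3] is of order at least [n / 3]. *)
Definition normal_form (lam : nat -> nat -> R) (n : nat) : Prop :=
  (forall k, (k < n)%nat -> forall j, (1 <= j <= 6)%nat ->
     residual (fun i => lam i k) j = 0) /\
  (forall k, (3 * k < n)%nat -> lam 3%nat k = 0).

Lemma residual_limit (lam : nat -> nat -> R) (n j : nat) :
  analytic_arc lam -> normal_form lam n -> (1 <= j <= 6)%nat ->
  is_lim (fun e => residual (arc lam e) j / e ^ n) 0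
    (residual (fun i => lam i n) j).
Proof.
  intros Hl [Hres _] Hj. destruct (arc_pseries lam Hl) as [r [Hr Hps]].
  apply (leading_coefficient (fun k => residual (fun i => lam i k) j) _ r n Hr).
  - intros e He. unfold residual.
    pose proof (is_pseries_minus _ _ e _ _ (Hps e He j Hj)
      (is_pseries_scal (null_direction j) _ e _ (Rmult_comm _ _)
        (Hps e He 3%nat ltac:(lia)))) as H.
    unfold plus, opp, scal in H. simpl in H. unfold mult in H. simpl in H.
    rewrite Rmult_comm in H.
    refine (is_pseries_ext _ _ _ _ _ H).
    intros k. unfold PS_minus, PS_plus, PS_opp, PS_scal, plus, opp, scal.
    simpl. unfold mult. simpl. ring.
  - intros k Hk. now apply Hres.
Qed.

Lemma cube_limit (lam : nat -> nat -> R) (n : nat) :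
  analytic_arc lam -> normal_form lam n ->
  (forall m, n = (3 * m)%nat ->
     is_lim (fun e => arc lam e 3%nat ^ 3 / e ^ n) 0 (lam 3%nat m ^ 3)) /\
  (~ Nat.divide 3 n -> is_lim (fun e => arc lam e 3%nat ^ 3 / e ^ n) 0 0).
Proof.
  intros Hl [_ Hz]. destruct (arc_pseries lam Hl) as [r [Hr Hps]].
  assert (Hlead : forall m, (forall k, (k < m)%nat -> lam 3%nat k = 0) ->
    is_lim (fun e => (arc lam e 3%nat / e ^ m) ^ 3) 0 (lam 3%nat m ^ 3)).
  { intros m Hm.
    assert (H1 : is_lim (fun e => arc lam e 3%nat / e ^ m) 0 (lam 3%nat m)).
    { apply (leading_coefficient (lam 3%nat) _ r m Hr); [| exact Hm].
      intros e He. apply Hps; [exact He | lia]. }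
    replace (lam 3%nat m ^ 3) with (lam 3%nat m * (lam 3%nat m * lam 3%nat m)) by ring.
    apply (is_lim_ext (fun e => arc lam e 3%nat / e ^ m
      * (arc lam e 3%nat / e ^ m * (arc lam e 3%nat / e ^ m)))).
    - intros e. ring.
    - apply is_lim_mult_finite; [exact H1 | now apply is_lim_mult_finite]. }
  split.
  - intros m ->. apply (is_lim_ext_loc (fun e => (arc lam e 3%nat / e ^ m) ^ 3)).
    + apply (near_zero _ 1 Rlt_0_1). intros e He _.
      rewrite (Nat.mul_comm 3 m), pow_mult. field. now apply pow_nonzero.
    + apply Hlead. intros k Hk. apply Hz. lia.
  (* The first integer [m] with [3 m > n]; there [c^3 = O(eps^(3 m))]. *)
  - intros Hdiv. set (m := S (n / 3)).
    assert (Hm : (n < 3 * m)%nat).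
    { unfold m. pose proof (Nat.div_mod_eq n 3).
      pose proof (Nat.mod_upper_bound n 3). lia. }
    assert (Hsmall : forall k, (k < m)%nat -> lam 3%nat k = 0).
    { intros k Hk. apply Hz. unfold m in Hk.
      pose proof (Nat.div_mod_eq n 3) as E.
      assert (n mod 3 <> 0)%nat.
      { intros E0. apply Hdiv. exists (n / 3)%nat. lia. }
      lia. }
    apply (is_lim_ext_loc
      (fun e => (arc lam e 3%nat / e ^ m) ^ 3 * e ^ (3 * m - n))).
    + apply (near_zero _ 1 Rlt_0_1). intros e He _.
      assert (E : (e ^ m) ^ 3 = e ^ n * e ^ (3 * m - n)).
      { rewrite <- pow_mult, <- pow_add. f_equal. lia. }
      assert (e ^ n <> 0) by now apply pow_nonzero.
      assert (e ^ m <> 0) by now apply pow_nonzero.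
      assert (e ^ (3 * m - n) <> 0) by now apply pow_nonzero.
      unfold Rdiv at 1. rewrite Rpow_mult_distr, pow_inv, E. field. now split.
    + replace 0 with (lam 3%nat m ^ 3 * 0) at 2 by ring.
      apply is_lim_mult_finite; [now apply Hlead | apply is_lim_pow_zero; lia].
Qed.

Lemma is_lim_of_close (f : R -> R) (v : R) :
  (forall eta, 0 < eta -> exists r, 0 < r /\
     forall e, Rabs e < r -> Rabs (f e - v) < eta) -> is_lim f 0 v.
Proof.
  intros H. apply is_lim_spec. intros eta.
  destruct (H eta (cond_pos eta)) as [r [Hr Hf]].
  apply (near_zero _ r Hr). intros e _ He. now apply Hf.
Qed.

(** The energy balance divided by [eps^n], in the limit [eps -> 0]. *)
Lemma melnikov_formula (A : annulus) (lam : nat -> nat -> R) (sx sy : R -> R)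
  (P : R -> R -> R) (M : nat -> R -> R) (n : nat) (h kappa : R)
  (x0 y0 : R -> R) (T0 : R) :
  analytic_arc lam -> cross_section A sx sy -> return_map A sx sy lam P ->
  displacement_expansion A P M -> energy A h ->
  periodic_orbit x0 y0 T0 -> x0 0 = sx h -> y0 0 = sy h ->
  (1 <= n)%nat -> normal_form lam n ->
  (forall k, (1 <= k < n)%nat -> M k h = 0) ->
  is_lim (fun e => arc lam e 3%nat ^ 3 / e ^ n) 0 kappa ->
  M n h = L lam (fun _ => moment x0 y0 T0 0)
            (fun _ => moment x0 y0 T0 0 + moment x0 y0 T0 1) n h
          - 8/1001 * kappa
            * ((308 * h^2 + 181 * h + 24) * (moment x0 y0 T0 0 + moment x0 y0 T0 1)
               + (80 * h^2 + 12 * h) * moment x0 y0 T0 0).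
Proof.
  intros Hl Hsec HP HM Hh HO Ex Ey Hn Hnf Hz Hkappa.
  destruct (HP h Hh) as [r0 [Hr0 Hret]].
  assert (Hex : forall e, exists o : (R -> R) * (R -> R) * R, Rabs e < r0 ->
    return_orbit A sx sy (arc lam e) h (P h e) (fst (fst o)) (snd (fst o)) (snd o)).
  { intros e. destruct (Rlt_le_dec (Rabs e) r0) as [Hlt | Hge].
    - destruct (Hret e Hlt) as (Hp & x & y & T & H). exists (x, y, T). intros _.
      now split.
    - exists (fun _ => 0, fun _ => 0, 0). intros. lra. }
  (* A choice of return orbits, to speak of limits of their integrals. *)
  set (o := fun e => proj1_sig (constructive_indefinite_description _ (Hex e))).
  assert (Ho : forall e, Rabs e < r0 ->
    return_orbit A sx sy (arc lam e) h (P h e)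
      (fst (fst (o e))) (snd (fst (o e))) (snd (o e)))
    by (intros e; exact (proj2_sig (constructive_indefinite_description _ (Hex e)))).
  clearbody o.
  set (int := fun F e => loop_integral F (fst (fst (o e))) (snd (fst (o e))) (snd (o e))).
  assert (Hint : forall F, continuous_2d F ->
    is_lim (int F) 0 (loop_integral F x0 y0 T0)).
  { intros F HF. apply is_lim_of_close. intros eta Heta.
    destruct (return_integral_close A sx sy x0 y0 h T0 F eta)
      as [rho [Hrho Hclose]]; try assumption.
    destruct (arc_small lam rho Hl Hrho) as [r1 [Hr1 Hsmall]].
    exists (Rmin r0 r1). split; [now apply Rmin_glb_lt |]. intros e He.
    pose proof (Rmin_l r0 r1). pose proof (Rmin_r r0 r1).
    apply (Hclose (arc lam e) (P h e)); [apply Hsmall; lra | apply Ho; lra]. }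
  set (c := fun e => arc lam e 3%nat).
  assert (Hc : is_lim c 0 0).
  { apply is_lim_of_close. intros eta Heta.
    destruct (arc_small lam (eta / 2) Hl ltac:(lra)) as [r1 [Hr1 Hsmall]].
    exists r1. split; [exact Hr1 |]. intros e He. rewrite Rminus_0_r.
    specialize (Hsmall e He 3%nat ltac:(lia)). unfold c. lra. }
  assert (Hc2 : is_lim (fun e => c e ^ 2) 0 0).
  { apply (is_lim_ext (fun e => c e * c e)); [intros; ring |].
    replace 0 with (0 * 0) at 2 by ring. now apply is_lim_mult_finite. }
  assert (Hd : is_lim (fun e => (P h e - h) / e ^ n) 0 (M n h)).
  { destruct (displacement_pseries A P M h HM Hh) as [r [Hr Hd]].
    replace (M n h) with (shifted_series M h n) by (destruct n; [lia | reflexivity]).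
    apply (leading_coefficient _ (fun e => P h e - h) r n Hr Hd).
    intros k Hk. destruct k; [reflexivity |]. apply Hz. lia. }
  destruct (Hsec h Hh) as [Ax [Ay _]].
  apply analytic_ex_derive in Ax. apply analytic_ex_derive in Ay.
  set (A1 := fun q => first_corrector (sx q) (sy q)).
  set (A2 := fun q => second_corrector (sx q) (sy q)).
  assert (D1 : ex_derive A1 h).
  { unfold A1, first_corrector. auto_derive. repeat apply conj; try exact I; assumption. }
  assert (D2 : ex_derive A2 h).
  { unfold A2, second_corrector, Ham. auto_derive.
    repeat apply conj; try exact I; assumption. }
  pose proof (boundary_term_negligible A1 (P h) c h _ n Hn D1 Hd Hc) as B1.
  pose proof (boundary_term_negligible A2 (P h) _ h _ n Hn D2 Hd Hc2) as B2.
  set (res := fun e j => residual (arc lam e) j / e ^ n).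
  assert (Hpair : forall G, continuous_2d G ->
    is_lim (fun e => pairing (res e) (fun j => int (fun a b => monomial j a b * G a b) e))
      0 (pairing (residual (fun i => lam i n))
         (fun j => loop_integral (fun a b => monomial j a b * G a b) x0 y0 T0))).
  { intros G HG. apply is_lim_pairing; intros j Hj.
    - now apply residual_limit.
    - apply Hint. now apply monomial_continuous. }
  assert (G1 : continuous_2d (fun _ b => b ^ 2)) by solve_continuous_2d.
  assert (G2 : continuous_2d (fun a b => a * b ^ 3)) by solve_continuous_2d.
  assert (G3 : continuous_2d (fun a b =>
    6 * a ^ 2 * b ^ 4 + 6 * b ^ 2 * (a ^ 4 / 4 - a ^ 6 / 6)))
    by (unfold Rdiv; solve_continuous_2d).
  assert (G0 : continuous_2d cubic_integrand)
    by (unfold cubic_integrand; solve_continuous_2d).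
  pose proof (Hpair _ G1) as P1. pose proof (Hpair _ G2) as P2.
  pose proof (Hpair _ G3) as P3. cbv beta in P1, P2, P3.
  set (q1 := pairing _ (fun j => loop_integral (fun a b => monomial j a b * b ^ 2) x0 y0 T0)) in P1.
  assert (Hleft : is_lim (fun e => (P h e - h) / e ^ n
      + c e * ((A1 (P h e) - A1 h) / e ^ n)
      + c e ^ 2 * ((A2 (P h e) - A2 h) / e ^ n)) 0 (M n h + 0 + 0))
    by (apply is_lim_plus'; [apply is_lim_plus' |]; assumption).
  assert (Hright : is_lim (fun e => (P h e - h) / e ^ n
      + c e * ((A1 (P h e) - A1 h) / e ^ n)
      + c e ^ 2 * ((A2 (P h e) - A2 h) / e ^ n)) 0
      (kappa * loop_integral cubic_integrand x0 y0 T0 + q1)).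
  { apply (is_lim_ext_loc (fun e => c e ^ 3 / e ^ n * int cubic_integrand e
      + pairing (res e) (fun j => int (fun a b => monomial j a b * b ^ 2) e)
      + (- 3 * c e) * pairing (res e)
          (fun j => int (fun a b => monomial j a b * (a * b ^ 3)) e)
      + c e ^ 2 * pairing (res e) (fun j => int (fun a b => monomial j a b
          * (6 * a ^ 2 * b ^ 4 + 6 * b ^ 2 * (a ^ 4 / 4 - a ^ 6 / 6))) e))).
    - apply (near_zero _ r0 Hr0). intros e He Her.
      pose proof (return_energy_balance _ _ _ _ _ _ _ _ _ Hsec Hh (Ho e Her)) as E.
      cbv zeta in E. fold (c e) in E. fold (A1 h) (A2 h) in E.
      change (first_corrector (sx (P h e)) (sy (P h e))) with (A1 (P h e)) in E.
      change (second_corrector (sx (P h e)) (sy (P h e))) with (A2 (P h e)) in E.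
      assert (Hen : e ^ n <> 0) by now apply pow_nonzero.
      symmetry. transitivity ((P h e - h + c e * (A1 (P h e) - A1 h)
        + c e ^ 2 * (A2 (P h e) - A2 h)) / e ^ n); [now field |].
      eapply eq_trans; [exact (f_equal (fun v => v / e ^ n) E) |].
      unfold res, pairing, int. cbv beta. now field.
    - replace (kappa * loop_integral cubic_integrand x0 y0 T0 + q1) with
        (kappa * loop_integral cubic_integrand x0 y0 T0 + q1
         + (- 3 * 0) * pairing (residual (fun i => lam i n)) (fun j =>
             loop_integral (fun a b => monomial j a b * (a * b ^ 3)) x0 y0 T0)
         + 0 * pairing (residual (fun i => lam i n)) (fun j =>
             loop_integral (fun a b => monomial j a b
               * (6 * a ^ 2 * b ^ 4 + 6 * b ^ 2 * (a ^ 4 / 4 - a ^ 6 / 6))) x0 y0 T0))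
        by ring.
      apply is_lim_plus'; [apply is_lim_plus'; [apply is_lim_plus' |] |].
      + apply is_lim_mult_finite; [exact Hkappa | now apply Hint].
      + exact P1.
      + apply is_lim_mult_finite; [| exact P2].
        apply is_lim_mult_finite; [apply is_lim_const | exact Hc].
      + apply is_lim_mult_finite; [exact Hc2 | exact P3]. }
  apply is_lim_unique in Hleft. apply is_lim_unique in Hright.
  rewrite Hleft in Hright. injection Hright as E.
  assert (HH : forall t, Ham (x0 t) (y0 t) = h).
  { intros t. destruct HO as (_ & Hf & _).
    rewrite (Ham_conserved x0 y0 t 0 Hf), Ex, Ey. now apply Hsec. }
  assert (Eq1 : q1 = loop_integral
    (fun a b => damping (residual (fun i => lam i n)) a b * b ^ 2) x0 y0 T0).
  { symmetry. apply is_RInt_unique.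
    destruct HO as (HT & Hf & _).
    apply (damping_integral _ (fun _ => 0) _ x0 y0 T0 G1 ltac:(lra)).
    apply flow_solution. intros; apply Hf. }
  rewrite Eq1, (linear_melnikov _ x0 y0 T0 h HO HH),
    (cubic_melnikov x0 y0 T0 h HO HH) in E.
  unfold L. cbv zeta. unfold residual, null_direction in E.
  replace (M n h) with (M n h + 0 + 0) by ring. rewrite E. field.
Qed.

(** If the next coefficient vanishes identically too, so do the polynomials that
    multiply the independent moments in it.  The coefficient of [h^2 mu_1] is a
    multiple of [kappa] alone. *)
Lemma normal_form_step (A : annulus) (lam : nat -> nat -> R) (sx sy : R -> R)
  (P : R -> R -> R) (M : nat -> R -> R) (n : nat) :
  analytic_arc lam -> cross_section A sx sy -> return_map A sx sy lam P ->
  displacement_expansion A P M -> (1 <= n)%nat -> normal_form lam n ->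
  (forall k, (1 <= k <= n)%nat -> forall h, energy A h -> M k h = 0) ->
  normal_form lam (S n).
Proof.
  intros Hl Hsec HP HM Hn Hnf Hz.
  destruct (cube_limit lam n Hl Hnf) as [C3 C0].
  assert (Hkappa : exists kappa : R,
    is_lim (fun e => arc lam e 3%nat ^ 3 / e ^ n) 0 kappa /\
    forall m, n = (3 * m)%nat -> kappa = lam 3%nat m ^ 3).
  { destruct (Nat.eq_dec (n mod 3) 0) as [E0 | Hne].
    - assert (E : n = (3 * (n / 3))%nat) by (pose proof (Nat.div_mod_eq n 3); lia).
      exists (lam 3%nat (n / 3)%nat ^ 3). split; [now apply C3 |].
      intros m Hm. replace (n / 3)%nat with m by lia. reflexivity.
    - assert (Hdiv : ~ Nat.divide 3 n).
      { intros Hd. now apply Hne, Nat.Lcm0.mod_divide. }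
      exists 0. split; [now apply C0 |]. intros m Hm. elim Hdiv. exists m. lia. }
  destruct Hkappa as [kappa [Hlim Hk3]].
  destruct (moments_independent A
    (32/21 * lam 6%nat n + 40/231 * lam 5%nat n + 8/7 * lam 4%nat n
     + 3/7 * lam 3%nat n + lam 2%nat n - 8/1001 * kappa * 24)
    (4/3 * lam 6%nat n + 320/231 * lam 5%nat n - 8/1001 * kappa * 181)
    (- (8/1001 * kappa * 308))
    (lam 1%nat n)
    (16/21 * lam 6%nat n + 20/231 * lam 5%nat n + 4/7 * lam 4%nat n
     + 12/7 * lam 3%nat n - 8/1001 * kappa * 12)
    (240/77 * lam 5%nat n - 8/1001 * kappa * 80))
    as (Z0 & Z1 & Z2 & Z3 & Z4 & Z5).
  { intros h Hh.
    destruct (unperturbed_orbit A lam sx sy P M h Hl HP HM Hh)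
      as (x & y & T & HO & Ex & Ey).
    exists x, y, T. split; [exact HO |]. split; [rewrite Ex, Ey; now apply Hsec |].
    pose proof (melnikov_formula A lam sx sy P M n h kappa x y T) as E.
    rewrite (Hz n) in E by (assumption || lia). unfold L in E. cbv zeta in E.
    assert (E' := E Hl Hsec HP HM Hh HO Ex Ey Hn Hnf
      ltac:(intros k Hk; apply Hz; [lia | exact Hh]) Hlim).
    etransitivity; [| symmetry; exact E']. ring. }
  assert (Ek : kappa = 0) by lra. rewrite Ek in *.
  destruct Hnf as [Hres Hcube]. split.
  - intros k Hk j Hj. destruct (Nat.eq_dec k n) as [-> | Hne].
    2: { apply Hres; [lia | exact Hj]. }
    unfold residual, null_direction.
    assert (Hj' : (j = 1 \/ j = 2 \/ j = 3 \/ j = 4 \/ j = 5 \/ j = 6)%nat) by lia.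
    destruct Hj' as [-> | [-> | [-> | [-> | [-> | ->]]]]]; lra.
  - intros k Hk. destruct (Nat.eq_dec (3 * k) n) as [E | Hne].
    + specialize (Hk3 k (eq_sym E)).
      destruct (Req_dec (lam 3%nat k) 0) as [Ez | Hnz]; [exact Ez |].
      apply (pow_nonzero _ 3) in Hnz. now elim Hnz.
    + apply Hcube. lia.
Qed.

Theorem theorem5 (A : annulus) (lam : nat -> nat -> R) (sx sy : R -> R)
  (P : R -> R -> R) (M : nat -> R -> R) (I0 I2 : R -> R) (n : nat)
  (hlam : analytic_arc lam)
  (hsec : cross_section A sx sy)
  (hP : return_map A sx sy lam P)
  (hM : displacement_expansion A P M)
  (hI0 : forall h, energy A h -> is_oval_integral A (fun x y => y) h (I0 h))
  (hI2 : forall h, energy A h -> is_oval_integral A (fun x y => x^2 * y) h (I2 h))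
  (hn : first_nonzero A M n) :
  (forall m : nat, n = (3 * m)%nat ->
     forall h, energy A h ->
       M n h = L lam I0 I2 n h
               - 8/1001 * (lam 3%nat m)^3
                 * ((308 * h^2 + 181 * h + 24) * I2 h
                    + (80 * h^2 + 12 * h) * I0 h)) /\
  (~ Nat.divide 3 n ->
     forall h, energy A h -> M n h = L lam I0 I2 n h).
Proof.
  destruct hn as [Hn [Hz _]].
  assert (Hnf : forall k, (1 <= k <= n)%nat -> normal_form lam k).
  { intros k. induction k as [| k IH]; [lia |]. intros Hk.
    destruct (Nat.eq_dec k 0) as [-> | Hne].
    - split.
      + intros i Hi j Hj. replace i with 0%nat by lia. unfold residual.
        destruct (hlam j Hj) as [-> _]. destruct (hlam 3%nat) as [-> _]; [lia | ring].
      + intros i Hi. replace i with 0%nat by lia. apply hlam. lia.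
    - apply (normal_form_step A lam sx sy P M k); try assumption; [lia | apply IH; lia |].
      intros i Hi. apply Hz. lia. }
  specialize (Hnf n ltac:(lia)).
  destruct (cube_limit lam n hlam Hnf) as [C3 C0].
  assert (Hformula : forall kappa h : R,
    is_lim (fun e => arc lam e 3%nat ^ 3 / e ^ n) 0 kappa -> energy A h ->
    M n h = L lam I0 I2 n h
      - 8/1001 * kappa * ((308 * h^2 + 181 * h + 24) * I2 h
                          + (80 * h^2 + 12 * h) * I0 h)).
  { intros kappa h Hk Hh.
    destruct (unperturbed_orbit A lam sx sy P M h hlam hP hM Hh)
      as (x & y & T & HO & Ex & Ey).
    assert (HOv : oval A h (x 0) (y 0)) by (rewrite Ex, Ey; now apply hsec).
    assert (E0 : I0 h = moment x y T 0).
    { rewrite (oval_integral_on_orbit A (fun x y => y) h (I0 h) x y T);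
        [| solve_continuous_2d | exact Hh | exact HO | exact HOv | now apply hI0].
      apply loop_integral_eq. intros a b. ring. }
    assert (E2 : I2 h = moment x y T 0 + moment x y T 1).
    { rewrite (oval_integral_on_orbit A (fun x y => x ^ 2 * y) h (I2 h) x y T);
        [| solve_continuous_2d | exact Hh | exact HO | exact HOv | now apply hI2].
      unfold moment. rewrite <- loop_integral_plus by
        (exact HO || apply moment_continuous).
      apply loop_integral_eq. intros a b. ring. }
    rewrite (melnikov_formula A lam sx sy P M n h kappa x y T) by
      (assumption || (intros k Hk'; now apply Hz)).
    unfold L. cbv zeta. rewrite E0, E2. reflexivity. }
  split.
  - intros m Hm h Hh. apply Hformula; [now apply C3 | exact Hh].
  - intros Hdiv h Hh. rewrite (Hformula 0 h) by (try assumption; now apply C0). ring.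
Qed.
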